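(* Let $k\ge 1$ and let $\{T_1^z\}_{z\in\mathbb{Z}^2},\ldots,\{T_k^z\}_{z\in\mathbb{Z}^2}$ be measure-preserving $\mathbb{Z}^2$-actions on Lebesgue spaces such that the product action $\{(T_1^z\times T_1^z)\times\cdots\times(T_k^z\times T_k^z)\}_{z\in\mathbb{Z}^2}$, whose Koopman operators are $(\hat T_1^z\otimes\hat T_1^z)\otimes\cdots\otimes(\hat T_k^z\otimes\hat T_k^z)$, is totally ergodic. Suppose that: 1. each of the actions $\{\hat T_1^z\odot\hat T_1^z\}_{z\in\mathbb{Z}^2},\ldots,\{\hat T_k^z\odot\hat T_k^z\}_{z\in\mathbb{Z}^2}$ has simple spectrum; 2. for each $i\in\{1,\ldots,k\}$ there are sequences $\{w_n^i\}_{n}$, $\{u_n^i\}_{n}$ in $\mathbb{Z}^2$ and numbers $a_j^i,b_j^i>0$, $j\in\{1,\ldots,k\}$, such that, in the weak operator topology as $n\to\infty$, $$\hat T_i^{w_n^i}\to a_i^i\hat T_i^{(1,0)}+(1-a_i^i)\Theta,\qquad \hat T_j^{w_n^i}\to a_j^iI+(1-a_j^i)\Theta\quad\text{for all } j\ne i,$$ $$\hat T_i^{u_n^i}\to b_i^i\hat T_i^{(0,1)}+(1-b_i^i)\Theta,\qquad \hat T_j^{u_n^i}\to b_j^iI+(1-b_j^i)\Theta\quad\text{for all } j\ne i.$$ Then the set of spectral multiplicities of the action $\{(T_1^z\times T_1^z)\times\cdots\times(T_k^z\times T_k^z)\}_{z\in\mathbb{Z}^2}$ is $\{2,4,8,\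ldots,2^k\}$.
   Context: A $\mathbb{Z}^2$-action is a family $\{S^z\}_{z\in\mathbb{Z}^2}$ of measure-preserving automorphisms of a Lebesgue space (standard nonatomic probability space) $(Y,\nu)$ with $S^{z_1}\circ S^{z_2}=S^{z_1+z_2}$ for all $z_1,z_2\in\mathbb{Z}^2$. The automorphism $S^z$ induces the unitary operator $\hat S^z$ on $L_2(Y,\nu)$, $(\hat S^z f)(y)=f(S^z y)$. The action is totally ergodic if $S^z$ is ergodic for every $z\neq 0$. $I$ is the identity operator and $\Theta$ is the orthogonal projection onto the subspace of constants in the relevant $L_2$ space. $\hat S^z\odot\hat S^z$ denotes the restriction of $\hat S^z\otimes\hat S^z$ to the invariant subspace of symmetric functions $\{g\in L_2(Y\times Y,\nu\otimes\nu): g(x,y)=g(y,x)\}$. Simple spectrum of $\{\hat S^z\odot\hat S^z\}$ means that the orthogonal complement of the constants in this symmetric subspace is cyclic, i.e. is the closed linear span of the orbit of a single vector. The set of spectral multiplicities of an action is the set of essential values of the spectral multiplicity function of the associated unitary representation of $\mathbb{Z}^2$ on the orthogonal complement of the constants in $L_2$. *)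

(* Defs.v *)
From HB Require Import structures.
From mathcomp Require Import all_boot all_order all_algebra.
From mathcomp Require Import complex.
From mathcomp Require Import all_classical all_reals all_analysis.
Set Implicit Arguments.
Unset Strict Implicit.
Unset Printing Implicit Defensive.
Import Order.TTheory GRing.Theory Num.Theory numFieldNormedType.Exports.
Local Open Scope classical_set_scope.
Local Open Scope ring_scope.

(* The real line with the sigma-algebra of Lebesgue-measurable sets, on which
   completed_lebesgue_measure is defined. *)
Definition lebesgueR (R : realType) := caratheodory_type (@wlength R idfun)^*%mu.

(* Standard nonatomic probability space: isomorphic mod 0 to [0, 1] with
   Lebesgue measure. Asking psi to be measurable only for the completed
   sigma-algebra makes the definition cover both a standard Borel space and its
   completion. *)
Definition lebesgue_space (R : realType) d (Y : measurableType d)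
    (nu : probability Y R) : Prop :=
  exists (phi : Y -> R) (psi : lebesgueR R -> Y),
  [/\ measurable_fun setT phi /\ measurable_fun setT psi,
      forall B : set R, measurable B ->
        nu (phi @^-1` B) = lebesgue_measure (B `&` `[0, 1]),
      forall A : set Y, measurable A ->
        completed_lebesgue_measure (psi @^-1` A `&` `[0, 1]) = nu A,
      {ae nu, forall y, psi (phi y) = y} &
      {ae @lebesgue_measure R, forall x : R, 0 <= x <= 1 -> phi (psi x) = x}].

Section L2.
Context (R : realType) d (T : measurableType d).
Variable mu : {measure set T -> \bar R}.
Local Notation C := R[i].

Definition cintegral (f : T -> C) : C :=
  Complex (\int[mu]_x complex.Re (f x)) (\int[mu]_x complex.Im (f x)).

(* Elements of L_2 are represented by functions, not by classes mod 0. *)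
Definition L2 : set (T -> C) :=
  [set f | (fun x => complex.Re (f x)) \in Lfun mu 2%:E /\
           (fun x => complex.Im (f x)) \in Lfun mu 2%:E].

Definition inner (f g : T -> C) : C := cintegral (fun x => f x * conjc (g x)).

Definition l2norm (f : T -> C) : R := Num.sqrt (complex.Re (inner f f)).

(* Since mu is a probability measure wherever this is used, Theta is the
   orthogonal projection onto the constants, and L20 its kernel. *)
Definition Theta (f : T -> C) : T -> C := fun=> cintegral f.

Definition L20 : set (T -> C) :=
  L2 `&` [set f | forall c : C, inner f (cst c) = 0].

Definition weak_cvg (U : nat -> (T -> C) -> (T -> C)) (V : (T -> C) -> (T -> C))
    : Prop :=
  forall f g, L2 f -> L2 g ->
    (fun n => inner (U n f) g : C^o) @ \oo --> (inner (V f) g : C^o).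

Definition mix (a : R) (U : (T -> C) -> (T -> C)) (f : T -> C) : T -> C :=
  fun x => a%:C%C * U f x + (1 - a)%:C%C * Theta f x.

Definition closed_span (I : Type) (e : I -> T -> C) : set (T -> C) :=
  L2 `&` [set f | forall eps : R, 0 < eps -> exists s : seq (I * C),
    l2norm (fun x => f x - \sum_(p <- s) p.2 * e p.1 x) < eps].

(* H is a U-invariant closed subspace of L2. *)
Definition simple_spectrum (U : int * int -> (T -> C) -> (T -> C))
    (H : set (T -> C)) : Prop :=
  exists2 h, H h & H = closed_span (fun z => U z h).

End L2.

(* The dual group of Z^2 is [0, 1)^2, the point x standing for the character
   z |-> exp (2 pi i (z.1 x.1 + z.2 x.2)). *)
Definition torus (R : realType) : set (R * R)%type :=
  [set x | 0 <= x.1 < 1 /\ 0 <= x.2 < 1].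

Definition character (R : realType) (z : int * int) (x : R * R) : R[i] :=
  let t := 2 * pi * (z.1%:~R * x.1 + z.2%:~R * x.2) in Complex (cos t) (sin t).

Section Multiplicity.
Context (R : realType) d (T : measurableType d).
Variables (mu : {measure set T -> \bar R}).
Variables (U : int * int -> (T -> R[i]) -> (T -> R[i])) (H : set (T -> R[i])).

Definition is_spectral_measure (h : T -> R[i])
    (sigma : {finite_measure set (R * R)%type -> \bar R}) : Prop :=
  sigma (~` @torus R) = 0%E /\
  forall z, inner mu (U z h) h = cintegral sigma (character z).

(* Hahn-Hellinger theorem: H is the orthogonal sum of the cyclic subspaces
   generated by vectors h 0, h 1, ... (possibly 0 from some point on) with
   decreasing spectral measures sigma 0 >> sigma 1 >> ...; here A n supports
   the density of sigma n with respect to sigma 0. Then sigma 0 is a measure of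
   maximal spectral type and m x = #{n | x in A n} is the multiplicity function.
   The class of sigma 0, and m up to sigma 0-null sets, do not depend on h. *)
Definition is_spectral_multiplicity
    (sigma0 : {finite_measure set (R * R)%type -> \bar R})
    (m : R * R -> \bar R) : Prop :=
  exists (h : nat -> T -> R[i])
         (sigma : nat -> {finite_measure set (R * R)%type -> \bar R})
         (A : nat -> set (R * R)%type),
  [/\ (forall n, H (h n)) /\
      (forall n n' z z', n != n' -> inner mu (U z (h n)) (U z' (h n')) = 0),
      H = closed_span mu (fun i : nat * (int * int) => U i.2 (h i.1)),
      forall n, is_spectral_measure (h n) (sigma n),
      forall n, sigma n.+1 `<< sigma n &
      [/\ forall n, measurable (A n),
          forall n B, measurable B ->
            (sigma n B = 0%E <-> sigma 0%N (B `&` A n) = 0%E),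
          sigma0 = sigma 0%N &
          m = fun x => (\sum_(0 <= n <oo) (\1_(A n) x)%:E)%E]].

(* m takes values in the discrete set {0, 1, 2, ..., +oo}, so its essential
   values are those taken on a set of positive measure. *)
Definition essential_values
    (sigma : {finite_measure set (R * R)%type -> \bar R})
    (m : R * R -> \bar R) : set (\bar R) :=
  [set v | (0 < sigma (m @^-1` [set v]))%E].

Definition has_spectral_multiplicities (M : set (\bar R)) : Prop :=
  exists sigma m,
    is_spectral_multiplicity sigma m /\ M = essential_values sigma m.

End Multiplicity.

(* The data of a Z^2-action; the axioms are in is_action. *)
Record Z2system (R : realType) := Z2System {
  sys_display : measure_display;
  sys_space :> measurableType sys_display;
  sys_prob : probability sys_space R;
  sys_act : int * int -> sys_space -> sys_space }.

Section Systems.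
Context (R : realType).
Implicit Types X : Z2system R.

(* Automorphisms of a measure space are taken mod 0: the invertibility of
   sys_act X z follows from the last two clauses. *)
Definition is_action X : Prop :=
  [/\ forall z, measurable_fun setT (@sys_act R X z),
      forall z A, measurable A -> sys_prob X (sys_act z @^-1` A) = sys_prob X A,
      forall z1 z2,
        {ae sys_prob X, forall x : X,
          sys_act z1 (sys_act z2 x) = sys_act (z1 + z2) x} &
      {ae sys_prob X, forall x : X, sys_act 0 x = x}].

Definition koopman X (z : int * int) (f : X -> R[i]) : X -> R[i] :=
  fun x => f (sys_act z x).

Definition totally_ergodic X : Prop :=
  forall z : int * int, z != 0 ->
  forall A : set X, measurable A -> sys_act z @^-1` A = A ->
    sys_prob X A = 0%E \/ sys_prob X A = 1%E.

Definition sys_prod2 (X Y : Z2system R) : Z2system R :=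
  @Z2System R _ (X * Y)%type (sys_prob X \x sys_prob Y)%E
    (fun z x => (sys_act z x.1, sys_act z x.2)).

Fixpoint sys_prod (k : nat) : ('I_k.+1 -> Z2system R) -> Z2system R :=
  match k with
  | 0 => fun F => F ord0
  | k'.+1 => fun F =>
      sys_prod2 (sys_prod (fun i : 'I_k'.+1 => F (widen_ord (leqnSn _) i)))
                (F ord_max)
  end.

Definition sys_square X : Z2system R := sys_prod2 X X.

(* Symmetric functions on X * X orthogonal to the constants; the Koopman
   operators of sys_square X, restricted to it, are those of the symmetric
   tensor square. *)
Definition L20_sym X : set (sys_square X -> R[i]) :=
  L20 (sys_prob (sys_square X)) `&`
  [set g | {ae sys_prob (sys_square X), forall p : X * X, g p = g (p.2, p.1)}].

End Systems.

Arguments koopman {R} X z f _.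
Arguments L20_sym {R} X _.

(* Main.v *)
(* For each i the Koopman representation of T_i on L20 is cyclic, because the
   one on the symmetric functions of two variables is. By Bochner's theorem it is
   multiplication by characters on L2 of a spectral measure sigma_i on the torus;
   adding to sigma_i an atom outside the torus for the constants, the product
   action becomes multiplication by [character z (s x)] on a space of sequences
   x = (x_1, x_1', x_2, x_2', ...), where s x is the sum of all coordinates.
   The multiplicity function counts the points in the fibres of s.
   - Simplicity of the spectrum on symmetric functions says that s_i = x_i + x_i'
     determines the unordered pair {x_i, x_i'} almost everywhere.
   - The weak limits exhibit [c x * character v (s_i x)] with c x > 0 and
     v = (1, 0) or (0, 1) as a weak limit of functions of s, hence as a function
     of s; so s determines every s_i.
   - By ergodicity sigma_i has no atoms, so x_i = x_i' only if both coordinates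
     are the extra point.
   Hence the fibres of s are the orbits of the coordinate swaps x_i <-> x_i',
   and that of x has 2^j points, j being the number of i such that (x_i, x_i')
   is not the pair of extra points; j = 0 corresponds to the constants and each
   j between 1 and k + 1 occurs on a set of positive measure. *)

Require Import Defs.
From HB Require Import structures.
From mathcomp Require Import all_boot all_order all_algebra.
From mathcomp Require Import complex.
From mathcomp Require Import all_classical all_reals all_analysis.
From mathcomp Require Import measurable_realfun ring lra zify.
Set Implicit Arguments.
Unset Strict Implicit.
Unset Printing Implicit Defensive.
Import Order.TTheory GRing.Theory Num.Theory numFieldNormedType.Exports.
Local Open Scope classical_set_scope.
Local Open Scope ring_scope.

(** The elements of $L_2$ are functions, and no unitary operators are built. A spectral isomorphism
    is a relation: two functions correspond if they have the same inner products with two total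
    families whose Gram matrices agree. Such data multiply under products, so all models come from
    that of one factor.

    Simplicity is used through quotients: symmetric functions vanishing at the pair of extra points
    have the form [psi (s x) * gamma x] with a common [gamma], which cancels in a quotient of two of
    them. Likewise the positive factor [c] of a weak limit disappears on division by the modulus.

    What has to survive the induction over the factors is gathered in [fibred_model]:
    representatives and numberings of the fibres, and the equidistribution law [fm_fibre]. Fixing
    the number [n] gives a section of the sum map, whose functions form a cyclic subspace. By
    equidistribution its spectral measure is that of section 0 restricted to the fibres with more
    than [n] points, which is the shape required by [is_spectral_multiplicity]. *)

Section ComplexParts.
Variable R : realType.
Implicit Types x y : R[i].

Lemma ReD x y : complex.Re (x + y) = complex.Re x + complex.Re y.
Proof. by case: x y => a b [c d]. Qed.

Lemma ImD x y : complex.Im (x + y) = complex.Im x + complex.Im y.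
Proof. by case: x y => a b [c d]. Qed.

Lemma ReN x : complex.Re (- x) = - complex.Re x.
Proof. by case: x. Qed.

Lemma ImN x : complex.Im (- x) = - complex.Im x.
Proof. by case: x. Qed.

Lemma ReM x y :
  complex.Re (x * y) = complex.Re x * complex.Re y - complex.Im x * complex.Im y.
Proof. by case: x y => a b [c d]. Qed.

Lemma ImM x y :
  complex.Im (x * y) = complex.Re x * complex.Im y + complex.Im x * complex.Re y.
Proof. by case: x y => a b [c d]. Qed.

Lemma ReJ x : complex.Re (conjc x) = complex.Re x.
Proof. by case: x. Qed.

Lemma ImJ x : complex.Im (conjc x) = - complex.Im x.
Proof. by case: x. Qed.

Definition cplxE := (ReD, ImD, ReN, ImN, ReM, ImM, ReJ, ImJ).

Lemma cplx_ext x y :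
  complex.Re x = complex.Re y -> complex.Im x = complex.Im y -> x = y.
Proof. by case: x y => a b [c d] /= -> ->. Qed.

Lemma conjcD x y : conjc (x + y) = conjc x + conjc y.
Proof. by apply: cplx_ext; rewrite !cplxE ?opprD. Qed.

Lemma conjcB x y : conjc (x - y) = conjc x - conjc y.
Proof. by apply: cplx_ext; rewrite !cplxE ?opprD. Qed.

Lemma conjcN x : conjc (- x) = - conjc x.
Proof. by apply: cplx_ext; rewrite !cplxE. Qed.

Lemma conjcM x y : conjc (x * y) = conjc x * conjc y.
Proof. by apply: cplx_ext; rewrite !cplxE ?mulrN ?mulNr ?opprK ?opprD. Qed.

(** The squared modulus as an element of [R]: the norm of [R[i]] takes its values in [R[i]], whereas
    integrands have to be real. *)
Definition cabs2 x : R := complex.Re x ^+ 2 + complex.Im x ^+ 2.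

Lemma cabs2_ge0 x : 0 <= cabs2 x.
Proof. by rewrite addr_ge0// sqr_ge0. Qed.

Lemma cabs2_eq0 x : cabs2 x = 0 -> x = 0.
Proof.
move=> /eqP; rewrite paddr_eq0 ?sqr_ge0// !sqrf_eq0 => /andP[/eqP a /eqP b].
exact: cplx_ext.
Qed.

Lemma cabs2M x y : cabs2 (x * y) = cabs2 x * cabs2 y.
Proof. by rewrite /cabs2 !cplxE; ring. Qed.

Lemma cabs2J x : cabs2 (conjc x) = cabs2 x.
Proof. by rewrite /cabs2 !cplxE sqrrN. Qed.

Lemma cabs2N x : cabs2 (- x) = cabs2 x.
Proof. by rewrite /cabs2 !cplxE !sqrrN. Qed.

Lemma cabs2D_le x y : cabs2 (x + y) <= 2 * (cabs2 x + cabs2 y).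
Proof.
rewrite /cabs2 !cplxE; have := sqr_ge0 (complex.Re x - complex.Re y).
by have := sqr_ge0 (complex.Im x - complex.Im y); nra.
Qed.

Lemma mulJ_cabs2 x : x * conjc x = (cabs2 x)%:C%C.
Proof. by case: x => a b; apply: cplx_ext; rewrite /cabs2 /=; ring. Qed.

Lemma Re_sum (I : Type) (s : seq I) (F : I -> R[i]) :
  complex.Re (\sum_(i <- s) F i) = \sum_(i <- s) complex.Re (F i).
Proof. exact: (big_morph _ ReD). Qed.

Lemma Im_sum (I : Type) (s : seq I) (F : I -> R[i]) :
  complex.Im (\sum_(i <- s) F i) = \sum_(i <- s) complex.Im (F i).
Proof. exact: (big_morph _ ImD). Qed.

(* Optimisation over the parameter of a nonnegative quadratic polynomial, which
   yields both the Cauchy-Schwarz inequality and the projection theorem. *)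
Lemma discriminant_le (a b c : R) : 0 <= c ->
  (forall t, 0 <= a - 2 * t * b + t ^+ 2 * c) -> b ^+ 2 <= a * c.
Proof.
move=> c0 H; have [c00|cp] := eqVneq c 0.
  have [->|b0] := eqVneq b 0; first by rewrite expr0n c00 mulr0.
  (* For [c = 0] the polynomial is affine, and this parameter gives it the value -1. *)
  have := H ((a + 1) / (2 * b)); rewrite c00 !mulr0 addr0.
  have -> : a - 2 * ((a + 1) / (2 * b)) * b = -1 by field.
  by rewrite lerNr oppr0 ler10.
(* The minimiser of the polynomial. *)
have := H (b / c).
have -> : a - 2 * (b / c) * b + (b / c) ^+ 2 * c = (a * c - b ^+ 2) / c by field.
by rewrite ler_pdivlMr ?mul0r ?subr_ge0// lt_neqAle eq_sym cp.
Qed.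

End ComplexParts.

(** * Integrals of complex-valued functions *)

Section ComplexIntegral.
Context (R : realType) d (T : measurableType d).
Variable mu : {measure set T -> \bar R}.
Local Notation C := R[i].
Implicit Types f g : T -> C.

Definition cmeasurable f := measurable_fun setT (fun x => complex.Re (f x)) /\
  measurable_fun setT (fun x => complex.Im (f x)).

Definition cintegrable f :=
  mu.-integrable setT (EFin \o (fun x => complex.Re (f x))) /\
  mu.-integrable setT (EFin \o (fun x => complex.Im (f x))).

Lemma integrableDr (f g : T -> R) : mu.-integrable setT (EFin \o f) ->
  mu.-integrable setT (EFin \o g) ->
  mu.-integrable setT (EFin \o (fun x => f x + g x)).
Proof. by move=> hf hg; have := integrableD measurableT hf hg. Qed.

Lemma integrableBr (f g : T -> R) : mu.-integrable setT (EFin \o f) ->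
  mu.-integrable setT (EFin \o g) ->
  mu.-integrable setT (EFin \o (fun x => f x - g x)).
Proof. by move=> hf hg; have := integrableB measurableT hf hg. Qed.

Lemma integrableZr (c : R) (f : T -> R) : mu.-integrable setT (EFin \o f) ->
  mu.-integrable setT (EFin \o (fun x => c * f x)).
Proof. by move=> hf; have := integrableZl measurableT c hf. Qed.

Lemma cintegrableD f g : cintegrable f -> cintegrable g ->
  cintegrable (fun x => f x + g x).
Proof.
move=> [f1 f2] [g1 g2]; split.
  by under eq_fun do rewrite ReD; exact: integrableDr.
by under eq_fun do rewrite ImD; exact: integrableDr.
Qed.

Lemma cintegrableZ c f : cintegrable f -> cintegrable (fun x => c * f x).
Proof.
move=> [f1 f2]; split.
  by under eq_fun do rewrite ReM; apply: integrableBr; exact: integrableZr.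
by under eq_fun do rewrite ImM; apply: integrableDr; exact: integrableZr.
Qed.

Lemma cintegralD f g : cintegrable f -> cintegrable g ->
  cintegral mu (fun x => f x + g x) = cintegral mu f + cintegral mu g.
Proof.
move=> [f1 f2] [g1 g2]; apply: cplx_ext; rewrite !cplxE /=.
  by rewrite -RintegralD//; apply: eq_Rintegral => x _; rewrite ReD.
by rewrite -RintegralD//; apply: eq_Rintegral => x _; rewrite ImD.
Qed.

Lemma cintegralZ c f : cintegrable f ->
  cintegral mu (fun x => c * f x) = c * cintegral mu f.
Proof.
move=> [f1 f2]; apply: cplx_ext; rewrite !cplxE /=.
  rewrite -!RintegralZl// -RintegralB//; [|exact: integrableZr..].
  by apply: eq_Rintegral => x _; rewrite ReM.
rewrite -!RintegralZl// -RintegralD//; [|exact: integrableZr..].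
by apply: eq_Rintegral => x _; rewrite ImM.
Qed.

Lemma cintegralJ f : cintegrable f ->
  cintegral mu (fun x => conjc (f x)) = conjc (cintegral mu f).
Proof.
move=> [f1 f2]; apply: cplx_ext; rewrite !cplxE /=.
  by apply: eq_Rintegral => x _; rewrite ReJ.
rewrite -mulN1r -RintegralZl//.
by apply: eq_Rintegral => x _; rewrite ImJ mulN1r.
Qed.

Lemma eq_cintegral f g : f =1 g -> cintegral mu f = cintegral mu g.
Proof. by move=> /funext ->. Qed.

Lemma ae_eq_Rintegral (f g : T -> R) : measurable_fun setT f ->
  measurable_fun setT g -> {ae mu, forall x, f x = g x} ->
  \int[mu]_x f x = \int[mu]_x g x.
Proof.
move=> mf mg fg; congr fine; apply: ae_eq_integral => //.
- exact/measurable_EFinP.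
- exact/measurable_EFinP.
- by apply: filterS fg => x + _ => ->.
Qed.

Lemma ae_eq_cintegral f g : cmeasurable f -> cmeasurable g ->
  {ae mu, forall x, f x = g x} -> cintegral mu f = cintegral mu g.
Proof.
move=> [f1 f2] [g1 g2] fg; apply: cplx_ext; rewrite /=.
  by apply: ae_eq_Rintegral => //; apply: filterS fg => x ->.
by apply: ae_eq_Rintegral => //; apply: filterS fg => x ->.
Qed.

Lemma cmeasurableD f g : cmeasurable f -> cmeasurable g ->
  cmeasurable (fun x => f x + g x).
Proof.
move=> [f1 f2] [g1 g2]; split.
  by under eq_fun do rewrite ReD; exact: measurable_funD.
by under eq_fun do rewrite ImD; exact: measurable_funD.
Qed.

Lemma cmeasurableM f g : cmeasurable f -> cmeasurable g ->
  cmeasurable (fun x => f x * g x).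
Proof.
move=> [f1 f2] [g1 g2]; split.
  by under eq_fun do rewrite ReM; apply: measurable_funB; exact: measurable_funM.
by under eq_fun do rewrite ImM; apply: measurable_funD; exact: measurable_funM.
Qed.

Lemma cmeasurableJ f : cmeasurable f -> cmeasurable (fun x => conjc (f x)).
Proof.
move=> [f1 f2]; split; first by under eq_fun do rewrite ReJ.
by under eq_fun do rewrite ImJ; exact: measurableT_comp.
Qed.

Lemma cmeasurableN f : cmeasurable f -> cmeasurable (fun x => - f x).
Proof.
move=> [f1 f2]; split; first by under eq_fun do rewrite ReN; exact: measurableT_comp.
by under eq_fun do rewrite ImN; exact: measurableT_comp.
Qed.

Lemma cmeasurable_cst (c : C) : cmeasurable (fun=> c).
Proof. by split; exact: measurable_cst. Qed.

Lemma cmeasurable_cabs2 f : cmeasurable f ->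
  measurable_fun setT (fun x => cabs2 (f x)).
Proof.
by move=> [f1 f2]; rewrite /cabs2; apply: measurable_funD; exact: measurable_funX.
Qed.

Lemma cmeasurable_comp d' (S : measurableType d') (f : T -> C) (h : S -> T) :
  cmeasurable f -> measurable_fun setT h ->
  measurable_fun setT (fun x => complex.Re (f (h x))) /\
  measurable_fun setT (fun x => complex.Im (f (h x))).
Proof.
move=> [f1 f2] mh; split.
  by apply: (measurableT_comp (f := fun x => complex.Re (f x))).
by apply: (measurableT_comp (f := fun x => complex.Im (f x))).
Qed.

Lemma cintegrable_cmeasurable f : cintegrable f -> cmeasurable f.
Proof.
by move=> [/measurable_int f1 /measurable_int f2]; split;
  apply/measurable_EFinP.
Qed.

End ComplexIntegral.

(** * The space L2 *)

Arguments Defs.inner : simpl never.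
Arguments cintegral : simpl never.

Section L2Theory.
Context (R : realType) d (T : measurableType d).
Variable mu : probability T R.
Local Notation C := R[i].
Local Notation L2 := (@L2 R d T mu).
Local Notation inner := (inner mu).
Implicit Types f g h : T -> C.

Lemma integrable_le (f g : T -> R) : measurable_fun setT f ->
  (forall x, `|f x| <= g x) -> mu.-integrable setT (EFin \o g) ->
  mu.-integrable setT (EFin \o f).
Proof.
move=> mf fg; apply: le_integrable => //; first exact/measurable_EFinP.
by move=> x _; rewrite /= lee_fin (le_trans (fg x))// ler_norm.
Qed.

(** Trades the finiteness of the $L^2$ norm, defined through real powers, for the integrability of
    the square, which domination arguments can handle. *)
Lemma Lfun2P (f : T -> R) : f \in Lfun mu 2%:E <->
  measurable_fun setT f /\ mu.-integrable setT (EFin \o (fun x => f x ^+ 2)).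
Proof.
split=> [lf|[mf lf]].
  split; last exact: Lfun2_integrable_sqr.
  by move: lf; rewrite inE => /andP[]; rewrite inE.
rewrite inE; apply/andP; split; rewrite inE//=.
rewrite /finite_norm unlock poweR_lty//.
move/integrableP : lf => [_]; apply: le_lt_trans.
rewrite le_eqVlt; apply/orP; left; apply/eqP; apply: eq_integral => x _ /=.
by rewrite normrX powR_mulrn.
Qed.

Lemma L2P f : L2 f <->
  cmeasurable f /\ mu.-integrable setT (EFin \o (fun x => cabs2 (f x))).
Proof.
split=> [[/Lfun2P[m1 i1] /Lfun2P[m2 i2]]|[[m1 m2] i]].
  by split; [split|exact: integrableDr].
split; apply/Lfun2P; split=> //; apply: integrable_le i.
- exact: measurable_funX.
- by move=> x; rewrite ger0_norm ?sqr_ge0// /cabs2 lerDl sqr_ge0.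
- exact: measurable_funX.
- by move=> x; rewrite ger0_norm ?sqr_ge0// /cabs2 lerDr sqr_ge0.
Qed.

Lemma L2_cmeasurable f : L2 f -> cmeasurable f.
Proof. by move=> /L2P[]. Qed.

Lemma L2_integrable f : L2 f -> mu.-integrable setT (EFin \o (fun x => cabs2 (f x))).
Proof. by move=> /L2P[]. Qed.

Lemma L2_le f g : cmeasurable f -> (forall x, cabs2 (f x) <= cabs2 (g x)) ->
  L2 g -> L2 f.
Proof.
move=> mf fg /L2P[mg ig]; apply/L2P; split => //.
apply: integrable_le ig; first exact: cmeasurable_cabs2.
by move=> x; rewrite ger0_norm ?cabs2_ge0.
Qed.

Lemma L2D f g : L2 f -> L2 g -> L2 (fun x => f x + g x).
Proof.
move=> /L2P[mf fi] /L2P[mg gi]; apply/L2P; split; first exact: cmeasurableD.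
apply: (@integrable_le _ (fun x => 2 * (cabs2 (f x) + cabs2 (g x)))).
- exact/cmeasurable_cabs2/cmeasurableD.
- by move=> x; rewrite ger0_norm ?cabs2_ge0// cabs2D_le.
- by apply: integrableZr; exact: integrableDr.
Qed.

Lemma L2_bounded_mul (c : R) f g : cmeasurable f ->
  (forall x, cabs2 (f x) <= c) -> L2 g -> L2 (fun x => f x * g x).
Proof.
move=> mf fc /L2P[mg gi]; apply/L2P; split; first exact: cmeasurableM.
apply: (@integrable_le _ (fun x => c * cabs2 (g x))).
- exact/cmeasurable_cabs2/cmeasurableM.
- by move=> x; rewrite ger0_norm ?cabs2_ge0// cabs2M ler_wpM2r ?cabs2_ge0.
- exact: integrableZr.
Qed.

Lemma L2Z (c : C) f : L2 f -> L2 (fun x => c * f x).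
Proof.
by apply: (@L2_bounded_mul (cabs2 c) (fun=> c)) => //; exact: cmeasurable_cst.
Qed.

Lemma L2N f : L2 f -> L2 (fun x => - f x).
Proof. by move=> /(L2Z (-1)); under eq_fun do rewrite mulN1r. Qed.

Lemma L2B f g : L2 f -> L2 g -> L2 (fun x => f x - g x).
Proof. by move=> lf lg; apply: L2D => //; exact: L2N. Qed.

Lemma L2_bounded (c : R) f : cmeasurable f -> (forall x, cabs2 (f x) <= c) -> L2 f.
Proof.
move=> mf fc; apply/L2P; split => //.
apply: (@integrable_le _ (fun=> c)); first exact: cmeasurable_cabs2.
- by move=> x; rewrite ger0_norm ?cabs2_ge0.
- exact: finite_measure_integrable_cst.
Qed.

Lemma L2_cst (c : C) : L2 (fun=> c).
Proof. by apply: (@L2_bounded (cabs2 c)) => //; exact: cmeasurable_cst. Qed.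

Lemma L2J f : L2 f -> L2 (fun x => conjc (f x)).
Proof.
move=> /[dup] lf /L2P[mf _]; apply: L2_le lf; first exact: cmeasurableJ.
by move=> x; rewrite cabs2J.
Qed.

Lemma L2_mul_cintegrable f g : L2 f -> L2 g -> cintegrable mu (fun x => f x * g x).
Proof.
move=> [f1 f2] [g1 g2].
have P (u v : T -> R) : u \in Lfun mu 2%:E -> v \in Lfun mu 2%:E ->
    mu.-integrable setT (EFin \o (fun x => u x * v x)).
  by move=> lu lv; exact: (Lfun1_integrable mu _).1 (Lfun2_mul_Lfun1 lu lv).
split; first by under eq_fun do rewrite ReM; apply: integrableBr; exact: P.
by under eq_fun do rewrite ImM; apply: integrableDr; exact: P.
Qed.

Lemma L2_cintegrable f : L2 f -> cintegrable mu f.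
Proof.
move=> lf; have := L2_mul_cintegrable lf (L2_cst 1).
by under eq_fun do rewrite mulr1.
Qed.

Lemma inner_cintegrable f g : L2 f -> L2 g ->
  cintegrable mu (fun x => f x * conjc (g x)).
Proof. by move=> lf lg; apply: L2_mul_cintegrable => //; exact: L2J. Qed.

Lemma innerDl f g h : L2 f -> L2 g -> L2 h ->
  inner (fun x => f x + g x) h = inner f h + inner g h.
Proof.
move=> lf lg lh; rewrite /Defs.inner -cintegralD; [|exact: inner_cintegrable..].
by apply: eq_cintegral => x; rewrite mulrDl.
Qed.

Lemma innerZl c f h : L2 f -> L2 h ->
  inner (fun x => c * f x) h = c * inner f h.
Proof.
move=> lf lh; rewrite /Defs.inner -cintegralZ; last exact: inner_cintegrable.
by apply: eq_cintegral => x; rewrite mulrA.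
Qed.

Lemma innerC f g : L2 f -> L2 g -> inner g f = conjc (inner f g).
Proof.
move=> lf lg; rewrite /Defs.inner -cintegralJ; last exact: inner_cintegrable.
by apply: eq_cintegral => x; rewrite conjcM conjcK mulrC.
Qed.

Lemma innerNl f h : L2 f -> L2 h -> inner (fun x => - f x) h = - inner f h.
Proof.
move=> lf lh; rewrite -mulN1r -innerZl//; congr Defs.inner.
by apply/funext => x; rewrite mulN1r.
Qed.

Lemma innerBl f g h : L2 f -> L2 g -> L2 h ->
  inner (fun x => f x - g x) h = inner f h - inner g h.
Proof. by move=> lf lg lh; rewrite innerDl ?innerNl//; exact: L2N. Qed.

Lemma innerDr f g h : L2 f -> L2 g -> L2 h ->
  inner h (fun x => f x + g x) = inner h f + inner h g.
Proof.
move=> lf lg lh; rewrite innerC ?innerDl//; last exact: L2D.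
by rewrite conjcD -!innerC.
Qed.

Lemma innerZr c f h : L2 f -> L2 h ->
  inner h (fun x => c * f x) = conjc c * inner h f.
Proof.
by move=> lf lh; rewrite innerC ?innerZl ?conjcM -?innerC//; exact: L2Z.
Qed.

Lemma innerBr f g h : L2 f -> L2 g -> L2 h ->
  inner h (fun x => f x - g x) = inner h f - inner h g.
Proof.
move=> lf lg lh; rewrite innerC ?innerBl//; last exact: L2B.
by rewrite conjcB -!innerC.
Qed.

Lemma inner0l h : L2 h -> inner (fun=> 0) h = 0.
Proof.
move=> lh; have -> : (fun=> 0) = (fun x : T => 0 * h x).
  by apply/funext => x; rewrite mul0r.
by rewrite innerZl// mul0r.
Qed.

Lemma ae_eq_inner f f' g g' : cmeasurable f -> cmeasurable f' ->
  cmeasurable g -> cmeasurable g' ->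
  {ae mu, forall x, f x = f' x} -> {ae mu, forall x, g x = g' x} ->
  inner f g = inner f' g'.
Proof.
move=> mf mf' mg mg' ff gg; apply: ae_eq_cintegral.
- by apply: cmeasurableM => //; exact: cmeasurableJ.
- by apply: cmeasurableM => //; exact: cmeasurableJ.
- by apply: filterS2 ff gg => x -> ->.
Qed.

Definition nsq f : R := complex.Re (inner f f).

Lemma inner_real f : inner f f = (nsq f)%:C%C.
Proof.
apply: cplx_ext => //=; rewrite /Defs.inner /cintegral /=.
rewrite -[LHS](_ : \int[mu]_(x in setT) (0 : R) = _).
  by rewrite Rintegral_cst// mul0r.
by apply: eq_Rintegral => x _; rewrite mulJ_cabs2.
Qed.

Lemma nsqE f : nsq f = \int[mu]_x cabs2 (f x).
Proof.
rewrite /nsq /Defs.inner /cintegral /=.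
by apply: eq_Rintegral => x _; rewrite mulJ_cabs2. Qed.

Lemma nsq_ge0 f : 0 <= nsq f.
Proof. by rewrite nsqE; apply: Rintegral_ge0 => x _; exact: cabs2_ge0. Qed.

Lemma nsqE_int f : L2 f -> (nsq f)%:E = (\int[mu]_x (cabs2 (f x))%:E)%E.
Proof.
move=> lf; rewrite nsqE fineK//; apply: integrable_fin_num => //.
exact: L2_integrable.
Qed.

Lemma nsq0_ae f : L2 f -> nsq f = 0 -> {ae mu, forall x, f x = 0}.
Proof.
move=> lf f0; have [mf _] := (L2P f).1 lf.
have mc : measurable_fun setT (EFin \o (fun x => cabs2 (f x))).
  exact/measurable_EFinP/cmeasurable_cabs2.
have : (\int[mu]_x `|(cabs2 (f x))%:E| = 0)%E.
  under eq_integral do rewrite gee0_abs ?lee_fin ?cabs2_ge0//.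
  by rewrite -nsqE_int// f0.
move/(ae_eq_integral_abs mu measurableT mc).1.
by apply: filterS => x /(_ I) [] /cabs2_eq0.
Qed.

Lemma nsqZ c f : L2 f -> nsq (fun x => c * f x) = cabs2 c * nsq f.
Proof.
move=> lf; rewrite !nsqE -RintegralZl//; last exact: L2_integrable.
by apply: eq_Rintegral => x _; rewrite cabs2M.
Qed.

Lemma nsqN f : nsq (fun x => - f x) = nsq f.
Proof. by rewrite !nsqE; apply: eq_Rintegral => x _; rewrite cabs2N. Qed.

Lemma nsqBC f g : nsq (fun x => f x - g x) = nsq (fun x => g x - f x).
Proof.
by rewrite -nsqN; congr nsq; apply/funext => x; rewrite opprB.
Qed.

Lemma nsqD f g : L2 f -> L2 g ->
  nsq (fun x => f x + g x) = nsq f + 2 * complex.Re (inner f g) + nsq g.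
Proof.
move=> lf lg; rewrite /nsq innerDl ?innerDr ?cplxE; [|done..|exact: L2D].
by rewrite (innerC lf lg) cplxE; lra.
Qed.

Lemma nsqB f g : L2 f -> L2 g ->
  nsq (fun x => f x - g x) = nsq f - 2 * complex.Re (inner f g) + nsq g.
Proof.
move=> lf lg; rewrite nsqD ?nsqN//; last exact: L2N.
have -> : inner f (fun x => - g x) = - inner f g.
  by rewrite (innerC (L2N lg) lf) innerNl// (innerC lf lg) conjcN conjcK.
by rewrite cplxE mulrN.
Qed.

(** The squared norm of [f - t g] is nonnegative for every real [t]. Only real multiples are
    subtracted, so only the real part is bounded; rotating [f] by $-i$ later gives the imaginary
    part. *)
Lemma cauchy_schwarz_Re f g : L2 f -> L2 g ->
  complex.Re (inner f g) ^+ 2 <= nsq f * nsq g.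
Proof.
move=> lf lg; apply: discriminant_le; first exact: nsq_ge0.
move=> t; have := nsq_ge0 (fun x => f x - t%:C%C * g x).
rewrite nsqB ?nsqZ//; last exact: L2Z.
by rewrite innerZr// /cabs2 !cplxE /=; lra.
Qed.

Definition l2n f : R := Num.sqrt (nsq f).

Lemma l2normE f : l2norm mu f = l2n f. Proof. by []. Qed.

Lemma l2n_ge0 f : 0 <= l2n f. Proof. exact: sqrtr_ge0. Qed.

Lemma sqr_l2n f : l2n f ^+ 2 = nsq f.
Proof. by rewrite sqr_sqrtr// nsq_ge0. Qed.

Lemma Re_inner_le f g : L2 f -> L2 g -> `|complex.Re (inner f g)| <= l2n f * l2n g.
Proof.
move=> lf lg; rewrite -sqrtrM ?nsq_ge0// -sqrtr_sqr ler_sqrt.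
  exact: cauchy_schwarz_Re.
by rewrite mulr_ge0// nsq_ge0.
Qed.

Lemma ReNi (z : C) : complex.Im z = complex.Re ((0 -i* 1)%C * z).
Proof. by case: z => a b /=; rewrite mul0r sub0r mulN1r opprK. Qed.

Lemma Im_inner_le f g : L2 f -> L2 g -> `|complex.Im (inner f g)| <= l2n f * l2n g.
Proof.
move=> lf lg; rewrite ReNi -innerZl//.
apply: le_trans (Re_inner_le _ lg) _; first exact: L2Z.
by rewrite {1}/l2n nsqZ// /cabs2 /= expr0n sqrrN expr1n add0r mul1r.
Qed.

Lemma l2nD f g : L2 f -> L2 g -> l2n (fun x => f x + g x) <= l2n f + l2n g.
Proof.
move=> lf lg; rewrite -[leRHS]ger0_norm ?addr_ge0 ?l2n_ge0// -sqrtr_sqr ler_sqrt.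
  rewrite nsqD// sqrrD !sqr_l2n.
  by have := le_trans (ler_norm _) (Re_inner_le lf lg); lra.
by rewrite sqr_ge0.
Qed.

Lemma l2nBC f g : l2n (fun x => f x - g x) = l2n (fun x => g x - f x).
Proof. by rewrite /l2n nsqBC. Qed.

Lemma l2n_triangle f g h : L2 f -> L2 g -> L2 h ->
  l2n (fun x => f x - h x) <= l2n (fun x => f x - g x) + l2n (fun x => g x - h x).
Proof.
move=> lf lg lh; rewrite -[leLHS]/(l2n _).
have -> : (fun x => f x - h x) = (fun x => (f x - g x) + (g x - h x)).
  by apply/funext => x; rewrite addrA subrK.
by apply: l2nD; exact: L2B.
Qed.

Lemma ae_eq_nsq f g : cmeasurable f -> cmeasurable g ->
  {ae mu, forall x, f x = g x} -> nsq f = nsq g.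
Proof. by move=> mf mg fg; rewrite /nsq (ae_eq_inner mf mg mf mg). Qed.

Lemma ae_eq_l2n f g : cmeasurable f -> cmeasurable g ->
  {ae mu, forall x, f x = g x} -> l2n f = l2n g.
Proof. by move=> mf mg fg; rewrite /l2n (ae_eq_nsq mf mg). Qed.

Lemma l2n0_ae f : L2 f -> l2n f = 0 -> {ae mu, forall x, f x = 0}.
Proof.
by move=> lf f0; apply: nsq0_ae => //; rewrite -sqr_l2n f0 expr0n.
Qed.

Lemma ae_eq_L2 f g : cmeasurable g -> {ae mu, forall x, f x = g x} -> L2 f -> L2 g.
Proof.
move=> mg fg /L2P[mf /integrableP[_ fi]]; apply/L2P; split=> //.
apply/integrableP; split; first exact/measurable_EFinP/cmeasurable_cabs2.
rewrite -(ge0_ae_eq_integral (f := fun x => `|(cabs2 (f x))%:E|%E))//.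
- by apply: measurableT_comp => //; exact/measurable_EFinP/cmeasurable_cabs2.
- by apply: measurableT_comp => //; exact/measurable_EFinP/cmeasurable_cabs2.
- by apply: filterS fg => x -> _.
Qed.

End L2Theory.

(** * Completeness of $L_2$ *)

Section Limits.
Context (R : realType).
Local Notation C := R[i].

Lemma limn_einf_le_cst (u : (\bar R)^nat) (c : \bar R) :
  (forall n, (u n <= c)%E) -> (limn_einf u <= c)%E.
Proof.
move=> uc; rewrite limn_einf_lim; apply: lime_le; first exact: is_cvg_einfs.
apply: nearW => n; apply: le_trans (uc n).
by apply: ereal_inf_lbound; exists n => //=.
Qed.

Lemma geometric_step_cvg (u : R^nat) (M q : R) : 0 <= M -> 0 < q -> q < 1 ->
  (forall n, `|u n.+1 - u n| <= M * q ^+ n) -> cvgn u.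
Proof.
move=> M0 q0 q1 H.
have -> : u = (fun n => u 0%N + series (telescope u) n).
  by apply/funext => n; exact: eq_sum_telescope.
apply: is_cvgD; first exact: is_cvg_cst.
apply: normed_cvg; apply: (@series_le_cvg _ _ (geometric M q)) => //.
- by move=> n /=; exact: normr_ge0.
- by move=> n; rewrite /geometric /= mulr_ge0// exprn_ge0// ltW.
- by apply: is_cvg_geometric_series; rewrite ger0_norm ?ltW.
Qed.

Lemma cvg_ereal_fine_limsup (u : R^nat) (l : R) :
  u @ \oo --> l -> fine (limn_esup (EFin \o u)) = l.
Proof.
move=> ul; have : (EFin \o u) @ \oo --> l%:E by apply: cvg_EFin => //; exact: nearW.
by move=> /cvg_limn_einf_sup [_ ->].
Qed.

End Limits.

Section Completeness.
Context (R : realType) d (T : measurableType d).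
Local Notation C := R[i].

(** Defined at every point through upper limits, so that its measurability requires no convergence;
    it is the limit at the points where the sequence converges. *)
Definition clim (u : nat -> T -> C) (x : T) : C :=
  Complex (fine (limn_esup (fun n => (complex.Re (u n x))%:E)))
          (fine (limn_esup (fun n => (complex.Im (u n x))%:E))).

Lemma cmeasurable_clim u : (forall n, cmeasurable (u n)) -> cmeasurable (clim u).
Proof.
move=> mu; split; rewrite /=.
  apply: (measurableT_comp (fine_measurable measurableT)).
  apply: measurable_fun_limn_esup => n; apply/measurable_EFinP.
  by have [] := mu n.
apply: (measurableT_comp (fine_measurable measurableT)).
apply: measurable_fun_limn_esup => n; apply/measurable_EFinP.
by have [] := mu n.
Qed.

Definition ccvg_at (u : nat -> C) := cvgn (fun n => complex.Re (u n)) /\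
  cvgn (fun n => complex.Im (u n)).

Lemma clim_Re u x : ccvg_at (u ^~ x) ->
  (fun n => complex.Re (u n x)) @ \oo --> complex.Re (clim u x).
Proof. by case=> cr _; rewrite /= (cvg_ereal_fine_limsup cr). Qed.

Lemma clim_Im u x : ccvg_at (u ^~ x) ->
  (fun n => complex.Im (u n x)) @ \oo --> complex.Im (clim u x).
Proof. by case=> _ ci; rewrite /= (cvg_ereal_fine_limsup ci). Qed.

Variable mu : probability T R.
Local Notation L2 := (@L2 R d T mu).
Local Notation l2n := (l2n mu).
Local Notation nsq := (nsq mu).

Section FastCauchy.
Variable u : nat -> T -> C.
Hypothesis L2u : forall n, L2 (u n).
Hypothesis fast : forall n, l2n (fun x => u n.+1 x - u n x) <= (4 ^- n : R).

Let L2d n : L2 (fun x => u n.+1 x - u n x). Proof. exact: L2B. Qed.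

(** The series of [4 ^+ n] times the squared increments has an integral bounded by the sum of
    [4 ^+ n * (4 ^- n) ^+ 2], so it is finite almost everywhere. At such a point the increments are
    $O(2^{-n})$. *)
Lemma fast_cauchy_ae : {ae mu, forall x, ccvg_at (u ^~ x)}.
Proof.
pose g n x : R := 4 ^+ n * cabs2 (u n.+1 x - u n x).
have g0 n x : 0 <= g n x by rewrite mulr_ge0 ?exprn_ge0// cabs2_ge0.
have mg n : measurable_fun setT (fun x => (g n x)%:E).
  apply/measurable_EFinP/measurable_funM; first exact: measurable_cst.
  by have [+ _] := (L2P _ _).1 (L2d n) => /cmeasurable_cabs2.
pose G x := (\sum_(0 <= n <oo) (g n x)%:E)%E.
have G0 x : (0 <= G x)%E by apply: nneseries_ge0 => n _ _; rewrite lee_fin.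
have iG : mu.-integrable setT G.
  apply/integrableP; split.
    by apply: (@ge0_emeasurable_sum _ _ _ _ (fun n x => (g n x)%:E) xpredT) => // n x _ _; rewrite lee_fin.
  under eq_integral do rewrite gee0_abs//.
  rewrite integral_nneseries//; last by move=> n x _; rewrite lee_fin.
  apply: (@le_lt_trans _ _ 2%:E); last exact: ltry.
  apply: lime_le.
    by apply: is_cvg_nneseries => n _ _; apply: integral_ge0 => x _; rewrite lee_fin.
  (* Not the exact partial sum of [4 ^- i], but an upper bound that passes from [n] to [n.+1]. *)
  apply: nearW => n; apply: (@le_trans _ _ (2 - 2 * 4 ^- n : R)%:E); last first.
    by rewrite lee_fin gerBl mulr_ge0// invr_ge0 exprn_ge0.
  elim: n => [|n IH]; first by rewrite big_nil lee_fin expr0 invr1; lra.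
  rewrite big_nat_recr//=.
  have : (\int[mu]_x (g n x)%:E <= (4 ^- n : R)%:E)%E.
    rewrite /g; under eq_integral do rewrite EFinM.
    rewrite integralZl//; last exact: L2_integrable.
    rewrite -nsqE_int// -EFinM lee_fin -sqr_l2n.
    apply: (@le_trans _ _ (4 ^+ n * (4 ^- n) ^+ 2)).
      by rewrite ler_wpM2l ?exprn_ge0// ler_sqr ?nnegrE ?l2n_ge0// invr_ge0 exprn_ge0.
    by rewrite expr2 mulrA divff ?mul1r// expf_neq0.
  move=> /(leeD IH) /le_trans; apply.
  rewrite -EFinD lee_fin exprS invfM.
  have : 0 <= (4 ^- n : R) by rewrite invr_ge0 exprn_ge0.
  by move: (4 ^- n) => q; lra.
have := integrable_ae measurableT iG; apply: filterS => x /(_ I) Gx.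
pose M := fine (G x).
have gM n : g n x <= M.
  rewrite -lee_fin fineK//.
  apply: le_trans (nneseries_lim_ge n.+1 _); last by move=> k _ _; rewrite lee_fin.
  rewrite big_nat_recr//= leeDr// sume_ge0// => i _; by rewrite lee_fin.
have M0 : 0 <= M by apply: le_trans (gM 0%N).
have bound (r : R) n : r ^+ 2 <= cabs2 (u n.+1 x - u n x) ->
    `|r| <= Num.sqrt M * 2^-1 ^+ n.
  move=> rn; rewrite -(ler_pXn2r (n := 2)) ?nnegrE ?mulr_ge0 ?sqrtr_ge0 ?exprn_ge0//.
  rewrite real_normK ?num_real// exprMn sqr_sqrtr// -exprM mulnC exprM.
  rewrite (_ : 2^-1 ^+ 2 = 4^-1 :> R); last by field.
  rewrite exprVn ler_pdivlMr ?exprn_gt0// mulrC; apply: le_trans (gM n).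
  by rewrite ler_wpM2l// exprn_ge0.
split; apply: (@geometric_step_cvg _ _ (Num.sqrt M) 2^-1); rewrite ?sqrtr_ge0//;
  rewrite ?invr_gt0 ?invf_lt1 ?ltr1n// => n; apply: bound.
- by rewrite /cabs2 !cplxE lerDl sqr_ge0.
- by rewrite /cabs2 !cplxE lerDr sqr_ge0.
Qed.

Let fast_tail n j : l2n (fun x => u (n + j)%N x - u n x) <= 2 * (4 ^- n - 4 ^- (n + j)).
Proof.
elim: j => [|j IH].
  rewrite addn0 subrr mulr0 /Defs.l2norm /l2n.
  rewrite (_ : (fun x => u n x - u n x) = fun x => 0 * u n x).
    by rewrite nsqZ// /cabs2 /= expr0n addr0 mul0r sqrtr0.
  by apply/funext => x; rewrite subrr mul0r.
apply: le_trans (l2n_triangle (L2u (n + j.+1)) (L2u (n + j)) (L2u n)) _.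
rewrite addnS; apply: le_trans (lerD (fast _) IH) _.
rewrite exprS invfM; set q := 4 ^- (n + j) : R; set A := 4 ^- n : R.
have : 0 <= q by rewrite invr_ge0 exprn_ge0.
by move: (A) (q) => a b; lra.
Qed.

(** Fatou's lemma for $|u_{n+m}-u_n|^2$ as $m\to\infty$: almost everywhere these converge to
    [cabs2 (u n x - clim u x)], and their integrals are controlled by [fast_tail]. *)
Lemma fast_cauchy_L2 :
  L2 (clim u) /\ forall n, l2n (fun x => u n x - clim u x) <= 2 * 4 ^- n.
Proof.
have mF : cmeasurable (clim u).
  by apply: cmeasurable_clim => n; have [] := (L2P _ _).1 (L2u n).
have key n : (\int[mu]_x (cabs2 (u n x - clim u x))%:E <= ((2 * 4 ^- n) ^+ 2)%:E)%E.
  pose f m x := (cabs2 (u (n + m)%N x - u n x))%:E.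
  have mf m : measurable_fun setT (f m).
    apply/measurable_EFinP; apply: cmeasurable_cabs2.
    by have [] := (L2P _ _).1 (L2B (L2u (n + m)) (L2u n)).
  have mL : measurable_fun setT (fun x => limn_einf (f^~ x)).
    have := measurable_fun_limn_esup (fun m => measurableT_comp (@oppe_measurable R setT) (mf m)).
    rewrite (_ : (fun x => limn_einf (f^~ x)) =
      (fun x => (- limn_esup (fun m => (- f m x)%E))%E)).
      by move=> H; exact: measurableT_comp.
    by apply/funext => x /=; rewrite -[fun m => (- f m x)%E]/(-%E \o (f^~ x)) limn_esupN oppeK.
  rewrite (ge0_ae_eq_integral (g := fun x => limn_einf (f^~ x)))//; first last.
  - apply: filterS fast_cauchy_ae => x cx _.
    have : f^~ x @ \oo --> (cabs2 (u n x - clim u x))%:E.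
      have shift (v : R^nat) (l : R) : v @ \oo --> l -> (fun m => v (n + m)%N) @ \oo --> l.
        move=> vl; rewrite (_ : (fun m => v (n + m)%N) = (fun m => v (m + n)%N)).
          by rewrite cvg_shiftn.
        by apply/funext => m; rewrite addnC.
      have -> : cabs2 (u n x - clim u x) = cabs2 (clim u x - u n x).
        by rewrite -cabs2N opprB.
      apply: cvg_EFin; first exact: nearW.
      rewrite (_ : fine \o _ = fun m => (complex.Re (u (n + m)%N x) - complex.Re (u n x)) ^+ 2
        + (complex.Im (u (n + m)%N x) - complex.Im (u n x)) ^+ 2); last first.
        by apply/funext => m; rewrite /f /cabs2 /= !cplxE.
      rewrite /cabs2 !cplxE.
      have hr := shift _ _ (clim_Re cx); have hi := shift _ _ (clim_Im cx).
      have er : (fun m => complex.Re (u (n + m)%N x) - complex.Re (u n x)) @ \oo -->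
          complex.Re (clim u x) - complex.Re (u n x).
        by apply: cvgB => //; exact: cvg_cst.
      have ei : (fun m => complex.Im (u (n + m)%N x) - complex.Im (u n x)) @ \oo -->
          complex.Im (clim u x) - complex.Im (u n x).
        by apply: cvgB => //; exact: cvg_cst.
      exact: cvgD (cvgM er er) (cvgM ei ei).
    by move=> /cvg_limn_einf_sup [-> _].
  - move=> x _; rewrite limn_einf_lim; apply: lime_ge; first exact: is_cvg_einfs.
    apply: nearW => m; apply: le_ereal_inf_tmp => _ [k _ <-].
    by rewrite lee_fin cabs2_ge0.
  - by move=> x _; rewrite lee_fin cabs2_ge0.
  - apply/measurable_EFinP/cmeasurable_cabs2/cmeasurableD; last exact: cmeasurableN.
    by have [] := (L2P _ _).1 (L2u n).
  apply: le_trans (fatou mu measurableT mf _) _.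
    by move=> m x _; rewrite lee_fin cabs2_ge0.
  apply: limn_einf_le_cst => m.
  rewrite -nsqE_int; last exact: L2B.
  rewrite -sqr_l2n lee_fin ler_sqr ?nnegrE ?l2n_ge0 ?mulr_ge0 ?invr_ge0 ?exprn_ge0//.
  apply: le_trans (fast_tail n m) _.
  by rewrite ler_wpM2l// gerBl invr_ge0 exprn_ge0.
have lF : L2 (clim u).
  (* The limit is recovered as [u 0] minus this difference, whose square is integrable by [key]. *)
  have lB : L2 (fun x => u 0%N x - clim u x).
    apply/L2P; split.
      apply: cmeasurableD; last exact: cmeasurableN.
      by have [] := (L2P _ _).1 (L2u 0).
    apply/integrableP; split.
      apply/measurable_EFinP/cmeasurable_cabs2/cmeasurableD; last exact: cmeasurableN.
      by have [] := (L2P _ _).1 (L2u 0).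
    under eq_integral do rewrite /= ger0_norm ?cabs2_ge0//.
    by apply: le_lt_trans (key 0%N) _; rewrite ltry.
  have := L2B (L2u 0) lB; congr L2.
  by apply/funext => x; rewrite opprB addrC subrK.
split=> // n; rewrite -(ler_pXn2r (n := 2)) ?nnegrE ?l2n_ge0//.
  by rewrite sqr_l2n -lee_fin nsqE_int//; exact: L2B.
Qed.

End FastCauchy.

End Completeness.

(** The form in which approximations yield equalities below: an arbitrarily small error multiplied
    by a norm that is fixed in advance. *)
Lemma small_eq0 (R : realType) (a b : R) :
  (forall eps : R, 0 < eps -> `|a| <= b * eps) -> a = 0.
Proof.
move=> H; apply/eqP; rewrite -normr_le0; apply/ler_addgt0Pl => eps e0.
have b0 : 0 <= b by have := le_trans (normr_ge0 a) (H 1 ltr01); rewrite mulr1.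
have b1 : 0 < b + 1 by lra.
apply: le_trans (H (eps / (b + 1)) _) _; first by rewrite divr_gt0.
rewrite addr0 mulrCA -[leRHS]mulr1 ler_wpM2l ?(ltW e0)// ler_pdivrMr// mul1r.
by rewrite lerDl.
Qed.

(** * Closed spans and orthogonal projection *)

Section LinearSpan.
Context (R : realType) d (T : measurableType d).
Local Notation C := R[i].

Definition lincomb (I : Type) (s : seq (I * C)) (e : I -> T -> C) (x : T) : C :=
  \sum_(p <- s) p.2 * e p.1 x.

Variable mu : probability T R.
Local Notation L2 := (@L2 R d T mu).
Local Notation inner := (inner mu).
Local Notation l2n := (l2n mu).
Local Notation nsq := (nsq mu).

Section Family.
Variables (I : Type) (e : I -> T -> C).
Hypothesis L2e : forall i, L2 (e i).

Lemma L2_lincomb s : L2 (lincomb s e).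
Proof.
elim: s => [|p s IH].
  rewrite (_ : lincomb _ _ = fun=> 0); first exact: L2_cst.
  by apply/funext => x; rewrite /lincomb big_nil.
rewrite (_ : lincomb _ _ = fun x => p.2 * e p.1 x + lincomb s e x).
  by apply: L2D => //; exact: L2Z.
by apply/funext => x; rewrite /lincomb big_cons.
Qed.

Lemma inner_lincombl s h : L2 h ->
  inner (lincomb s e) h = \sum_(p <- s) p.2 * inner (e p.1) h.
Proof.
move=> lh; elim: s => [|p s IH].
  rewrite big_nil -(inner0l lh); congr Defs.inner.
  by apply/funext => x; rewrite /lincomb big_nil.
rewrite big_cons -IH -innerZl// -innerDl//; [|exact: L2Z|exact: L2_lincomb].
by congr Defs.inner; apply/funext => x; rewrite /lincomb big_cons.
Qed.

Lemma lincomb_cat s s' : lincomb (s ++ s') e = fun x => lincomb s e x + lincomb s' e x.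
Proof. by apply/funext => x; rewrite /lincomb big_cat. Qed.

Lemma lincomb_scale c s :
  lincomb [seq (p.1, c * p.2) | p <- s] e = fun x => c * lincomb s e x.
Proof.
apply/funext => x; rewrite /lincomb big_map big_distrr /=.
by apply: eq_bigr => p _; rewrite mulrA.
Qed.

Lemma lincomb_opp s :
  lincomb [seq (p.1, -1 * p.2) | p <- s] e = fun x => - lincomb s e x.
Proof. by rewrite lincomb_scale; apply/funext => x; rewrite mulN1r. Qed.

Lemma lincomb_seq1 i c : lincomb [:: (i, c)] e = fun x => c * e i x.
Proof. by apply/funext => x; rewrite /lincomb big_seq1. Qed.

Lemma closed_spanP f : closed_span mu e f <->
  L2 f /\ forall eps : R, 0 < eps -> exists s, l2n (fun x => f x - lincomb s e x) < eps.
Proof. by []. Qed.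

(** Approximating within [8^-1 * 4 ^- n] makes consecutive approximations differ by at most
    [4 ^- n], which is the rate that [fast_cauchy_L2] asks for. *)
Lemma closed_span_fast f : closed_span mu e f ->
  exists s : nat -> seq (I * C),
    (forall n, l2n (fun x => f x - lincomb (s n) e x) <= 8^-1 * 4 ^- n) /\
    (forall n, l2n (fun x => lincomb (s n.+1) e x - lincomb (s n) e x) <= 4 ^- n).
Proof.
move=> [lf H].
have pos n : 0 < 8^-1 * 4 ^- n :> R by rewrite mulr_gt0 ?invr_gt0 ?exprn_gt0.
have [s sP] := choice (fun n => H _ (pos n)).
exists s; split=> n; first exact/ltW/sP.
apply: le_trans (l2n_triangle (L2_lincomb _) lf (L2_lincomb _)) _.
rewrite l2nBC; apply: le_trans (lerD (ltW (sP n.+1)) (ltW (sP n))) _.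
rewrite exprS invfM; have : 0 <= (4 ^- n : R) by rewrite invr_ge0 exprn_ge0.
by move: (4 ^- n) => q; lra.
Qed.

Lemma inner_cvg_eq0 f g : L2 f -> L2 g ->
  (forall eps : R, 0 < eps -> exists2 h, L2 h & l2n (fun x => f x - h x) < eps /\ inner h g = 0) ->
  inner f g = 0.
Proof.
move=> lf lg H.
have key (eps : R) : 0 < eps -> `|complex.Re (inner f g)| <= l2n g * eps /\
    `|complex.Im (inner f g)| <= l2n g * eps.
  move=> /H [h lh [fh hg]].
  have -> : inner f g = inner (fun x => f x - h x) g by rewrite innerBl// hg subr0.
  have lb := L2B lf lh; rewrite mulrC; split.
    by apply: le_trans (Re_inner_le lb lg) _; rewrite ler_wpM2r ?l2n_ge0// ltW.
  by apply: le_trans (Im_inner_le lb lg) _; rewrite ler_wpM2r ?l2n_ge0// ltW.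
by apply: cplx_ext; apply: (@small_eq0 _ _ (l2n g)) => eps /key [].
Qed.

Lemma inner_closed_span0 f g : closed_span mu e f -> L2 g ->
  (forall i, inner (e i) g = 0) -> inner f g = 0.
Proof.
move=> [lf H] lg eg; apply: inner_cvg_eq0 => // eps /H [s sP].
exists (lincomb s e); first exact: L2_lincomb.
by split=> //; rewrite inner_lincombl// big1// => p _; rewrite eg mulr0.
Qed.

(** A minimising sequence for the distance to the span. The residual of a near-minimiser pairs with
    any [h] of the span by at most the square root of [dl n * nsq h]; this one estimate gives both
    the Cauchy property of the sequence and the orthogonality of the limiting residual. *)
Theorem projection f : L2 f ->
  exists2 g, closed_span mu e g & forall i, inner (fun x => f x - g x) (e i) = 0.
Proof.
move=> lf.
pose D := [set r : R | exists s, r = nsq (fun x => f x - lincomb s e x)].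
have lfs s : L2 (fun x => f x - lincomb s e x) by apply: L2B => //; exact: L2_lincomb.
have D0 : has_inf D.
  split; first by exists (nsq (fun x => f x - lincomb [::] e x)); exists [::].
  by exists 0 => _ [s ->]; exact: nsq_ge0.
pose m := inf D.
have mD s : m <= nsq (fun x => f x - lincomb s e x).
  by apply: ge_inf; [exact: D0.2|exists s].
(* The squared norms of the increments will be at most [4 * dl n], hence their norms at most
   [4 ^- n]. *)
pose dl n : R := 16^-1 * (16 ^- n).
have dl0 n : 0 < dl n by rewrite mulr_gt0 ?invr_gt0 ?exprn_gt0.
have ex n : exists s, nsq (fun x => f x - lincomb s e x) < m + dl n.
  have [_ [s ->] h] := inf_adherent (dl0 n) D0; by exists s.
have [s sP] := choice ex.
(* Every small perturbation of a near-minimiser is at distance at least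
   [inf D], so the residuals are almost orthogonal to the span. *)
have orth n h : (exists t, h = lincomb t e) ->
    complex.Re (inner (fun x => f x - lincomb (s n) e x) h) ^+ 2 <= dl n * nsq h.
  case=> t ->; apply: discriminant_le; first exact: nsq_ge0.
  move=> r; have := mD (s n ++ [seq (p.1, r%:C%C * p.2) | p <- t]).
  rewrite lincomb_cat lincomb_scale.
  rewrite (_ : (fun x => f x - _) = fun x => (f x - lincomb (s n) e x)
    - r%:C%C * lincomb t e x); last by apply/funext => x; rewrite opprD addrA.
  have lt := L2_lincomb t.
  rewrite nsqB//; last exact: L2Z.
  rewrite nsqZ// innerZr// conjc_real ReM /= mul0r subr0 /cabs2 /= expr0n addr0.
  by have := sP n; lra.
have fast n : l2n (fun x => lincomb (s n.+1) e x - lincomb (s n) e x) <= 4 ^- n.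
  set h := (fun x => _); have lh : L2 h by apply: L2B; exact: L2_lincomb.
  have [t ht] : exists t, h = lincomb t e.
    exists (s n.+1 ++ [seq (p.1, -1 * p.2) | p <- s n]).
    by rewrite lincomb_cat lincomb_opp.
  have o1 := orth n h (ex_intro _ t ht); have o2 := orth n.+1 h (ex_intro _ t ht).
  have E : nsq h = complex.Re (inner (fun x => f x - lincomb (s n) e x) h) -
      complex.Re (inner (fun x => f x - lincomb (s n.+1) e x) h).
    rewrite -ReN -ReD -innerBl//; congr complex.Re; congr Defs.inner.
    by apply/funext => x; rewrite /h; ring.
  rewrite -(ler_pXn2r (n := 2)) ?nnegrE ?l2n_ge0 ?invr_ge0 ?exprn_ge0// sqr_l2n.
  have := nsq_ge0 mu h.
  have dle : dl n.+1 <= dl n.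
    rewrite /dl ler_wpM2l// exprS invfM ler_piMl ?invr_ge0 ?exprn_ge0//.
    by rewrite invf_le1// ler1n.
  rewrite -exprVn -exprM mulnC exprM (_ : 4^-1 ^+ 2 = 16^-1 :> R); last by field.
  rewrite exprVn.
  have dE : dl n = 16^-1 * 16 ^- n by [].
  have q0 : 0 < 16 ^- n :> R by rewrite invr_gt0 exprn_gt0.
  move: o1 o2 E dE q0 dle (dl0 n.+1) (dl0 n).
  move: (complex.Re _) (complex.Re _) (nsq h) (dl n) (dl n.+1) (16 ^- n).
  move=> a b c p p' q o1 o2 E dE q0 dle p0' p0 c0.
  have [->|cn] := eqVneq c 0; first by apply: ltW.
  have cp : 0 < c by rewrite lt_neqAle eq_sym cn.
  (* Here [c] is the squared norm of the increment, and [c = a - b] with [a] and [b] its pairings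
     with the two residuals. Dividing by [c] bounds it by [4 * p]. *)
  have : c ^+ 2 <= 4 * p * c.
    rewrite {1}E; have : (a - b) ^+ 2 <= 2 * (a ^+ 2 + b ^+ 2).
      by have := sqr_ge0 (a + b); lra.
    have : p' * c <= p * c by rewrite ler_wpM2r// ltW.
    by lra.
  rewrite expr2 ler_pM2r// => cc; lra.
have L2s n := L2_lincomb (s n).
have [lg gP] := fast_cauchy_L2 L2s fast.
set g := clim _ in lg gP.
have approx eps : 0 < eps -> exists n, l2n (fun x => lincomb (s n) e x - g x) < eps /\ dl n < eps.
  move=> e0; have : (fun n => geometric (2 : R) 4^-1 n) @ \oo --> (0 : R).
    by apply: cvg_geometric; rewrite ger0_norm// invf_lt1// ltr1n.
  move=> /cvgrPdist_lt /(_ _ e0) [N _ /(_ N (leqnn N))].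
  rewrite /= sub0r normrN ger0_norm ?mulr_ge0 ?exprn_ge0// exprVn => h.
  exists N; split; first exact: le_lt_trans (gP N) h.
  apply: le_lt_trans h; rewrite /dl; apply: ler_pM; rewrite ?invr_ge0 ?exprn_ge0//.
    by rewrite (@le_trans _ _ 1) ?invf_le1 ?ler1n.
  by rewrite lef_pV2 ?posrE ?exprn_gt0// lerXn2r ?nnegrE// ler_nat.
exists g.
  by split=> // eps /approx [n [h _]]; exists (s n); rewrite l2normE l2nBC.
have lfg := L2B lf lg.
have re i c : complex.Re (inner (fun x => f x - g x) (fun x => c * e i x)) = 0.
  have lce : L2 (fun x => c * e i x) by exact: L2Z.
  set h := (fun x => c * e i x); rewrite -/h in lce.
  apply: (@small_eq0 _ _ (l2n h + 1 + nsq h)) => eps e0.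
  (* The pairing with the residual is bounded by a square root of [dl n], so [dl n] has to be below
     [eps ^+ 2]; the distance to the limit only has to be below [eps]. *)
  have m0 : 0 < Num.min eps (eps ^+ 2) by rewrite lt_min e0 exprn_gt0.
  have [n []] := approx _ m0.
  rewrite !lt_min => /andP[ge _] /andP[_ de2].
  have -> : inner (fun x => f x - g x) h =
      inner (fun x => f x - lincomb (s n) e x) h + inner (fun x => lincomb (s n) e x - g x) h.
    rewrite -innerDl//; last exact: L2B.
    by congr Defs.inner; apply/funext => x; ring.
  rewrite ReD; apply: le_trans (ler_normD _ _) _.
  rewrite [leRHS](_ : _ = (1 + nsq h) * eps + l2n h * eps); last by ring.
  apply: lerD; last first.
    apply: le_trans (Re_inner_le _ lce) _; first exact: L2B.
    by rewrite mulrC ler_wpM2l ?l2n_ge0// ltW.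
  have := orth n h; rewrite {1}/h => /(_ (ex_intro _ [:: (i, c)] (esym (lincomb_seq1 _ _)))).
  have z0 := nsq_ge0 mu h; have e1 := ltW e0.
  move=> o; rewrite -(ler_pXn2r (n := 2)) ?nnegrE ?normr_ge0//; last first.
    by rewrite mulr_ge0 ?addr_ge0.
  rewrite real_normK ?num_real//; apply: le_trans o _.
  apply: (@le_trans _ _ (eps ^+ 2 * nsq h)); first by rewrite ler_wpM2r// ltW.
  rewrite exprMn mulrC ler_wpM2r ?sqr_ge0//.
  by move: z0; move: (nsq h) => z z0; nra.
move=> i; apply: cplx_ext.
  apply: etrans (re i 1); congr (complex.Re (Defs.inner _ _ _)).
  by apply/funext => x; rewrite mul1r.
by rewrite ReNi; apply: etrans (re i (0 +i* 1)%C); rewrite innerZr.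
Qed.

Definition total := forall f, L2 f -> (forall i, inner f (e i) = 0) -> {ae mu, forall x, f x = 0}.

(** The difference between [f] and its projection is orthogonal to the whole family, hence zero
    almost everywhere. *)
Lemma total_closed_span : total -> forall f, L2 f -> closed_span mu e f.
Proof.
move=> te f lf; have [g cg gP] := projection lf.
have lg := cg.1.
have fg : {ae mu, forall x, f x - g x = 0} by apply: te => //; exact: L2B.
split=> // eps /cg.2 [s sP]; exists s.
have ls := L2_lincomb s.
rewrite -[l2norm _ _]/(l2norm mu (fun x => f x - lincomb s e x)) l2normE.
rewrite (ae_eq_l2n (g := fun x => g x - lincomb s e x))//.
- exact: L2_cmeasurable (L2B lf ls).
- exact: L2_cmeasurable (L2B lg ls).
- by apply: filterS fg => x /eqP; rewrite subr_eq0 => /eqP ->.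
Qed.

End Family.

End LinearSpan.

(** * Transport between two spaces with a common Gram matrix *)

Section Transport.
Context (R : realType).
Local Notation C := R[i].

Section Corr.
Context d (T : measurableType d) d' (S : measurableType d').
Variables (mu : probability T R) (M : probability S R).
Variables (I : Type) (e : I -> T -> C) (f : I -> S -> C).

Definition same_gram := forall i j, inner mu (e i) (e j) = inner M (f i) (f j).

(* [corr F phi]: the functions F and phi represent the same vector of the
   Hilbert space generated by the common Gram matrix of e and f. *)
Definition corr (F : T -> C) (phi : S -> C) :=
  [/\ L2 mu F, L2 M phi & forall i, inner mu F (e i) = inner M phi (f i)].

Hypotheses (L2e : forall i, L2 mu (e i)) (L2f : forall i, L2 M (f i)).
Hypothesis gram : same_gram.

Lemma lincomb_inner s j : inner mu (lincomb s e) (e j) = inner M (lincomb s f) (f j).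
Proof.
by rewrite !inner_lincombl//; apply: eq_bigr => p _; rewrite gram.
Qed.

Lemma corr_lincomb s : corr (lincomb s e) (lincomb s f).
Proof.
by split; [exact: L2_lincomb|exact: L2_lincomb|move=> i; exact: lincomb_inner].
Qed.

Lemma corr_lincomb_inner s F phi : corr F phi ->
  inner mu (lincomb s e) F = inner M (lincomb s f) phi.
Proof.
move=> [lF lp c]; rewrite !inner_lincombl//; apply: eq_bigr => p _; congr (_ * _).
by rewrite (innerC lF (L2e _)) c -innerC.
Qed.

Lemma l2n_lincomb s : l2n mu (lincomb s e) = l2n M (lincomb s f).
Proof.
by rewrite /l2n /nsq (corr_lincomb_inner s (corr_lincomb s)).
Qed.

Lemma l2n_lincombB s t : l2n mu (fun x => lincomb s e x - lincomb t e x) =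
  l2n M (fun x => lincomb s f x - lincomb t f x).
Proof.
have E d0 (J : measurableType d0) (g : I -> J -> C) : (fun x => lincomb s g x - lincomb t g x) =
    lincomb (s ++ [seq (p.1, -1 * p.2) | p <- t]) g.
  apply/funext => x; rewrite /lincomb big_cat big_map /=; congr (_ + _).
  by rewrite -sumrN; apply: eq_bigr => p _; rewrite mulN1r mulNr.
by rewrite !E l2n_lincomb.
Qed.

(** One list of coefficients approximates on both sides at once. For total families this is
    equivalent to [corr]: it is easier to use, while [corr] is easier to check. *)
Definition joint_approx F phi := [/\ L2 mu F, L2 M phi &
  forall eps : R, 0 < eps -> exists s,
    l2n mu (fun x => F x - lincomb s e x) < eps /\
    l2n M (fun x => phi x - lincomb s f x) < eps].

(** Equal Gram matrices give equal norms of increments, so a fast Cauchy sequence of combinations on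
    one side is one on the other side, and it converges there by completeness. *)
Lemma joint_approx_exists phi : closed_span M f phi -> exists F, joint_approx F phi.
Proof.
move=> cphi; have [s [sP sF]] := closed_span_fast L2f cphi.
have L2s n := L2_lincomb L2e (s n).
have fast n : l2n mu (fun x => lincomb (s n.+1) e x - lincomb (s n) e x) <= 4 ^- n.
  by rewrite l2n_lincombB.
have [lF FP] := fast_cauchy_L2 L2s fast.
exists (clim (fun n => lincomb (s n) e)); split=> //; first exact: cphi.1.
move=> eps e0; have : (fun n => geometric (2 : R) 4^-1 n) @ \oo --> (0 : R).
  by apply: cvg_geometric; rewrite ger0_norm// invf_lt1// ltr1n.
move=> /cvgrPdist_lt /(_ _ e0) [N _ /(_ N (leqnn N))].
rewrite /= sub0r normrN ger0_norm ?mulr_ge0 ?exprn_ge0// exprVn => h.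
exists (s N); split; first by rewrite l2nBC; exact: le_lt_trans (FP N) h.
apply: le_lt_trans (sP N) _; apply: le_lt_trans h.
by rewrite ler_wpM2r ?invr_ge0 ?exprn_ge0// (@le_trans _ _ 1) ?invf_le1 ?ler1n.
Qed.

Lemma joint_approx_inner F phi F' phi' : joint_approx F phi -> corr F' phi' ->
  inner mu F F' = inner M phi phi'.
Proof.
move=> [lF lp H] c; have [lF' lp' _] := c.
have key (eps : R) : 0 < eps ->
    `|complex.Re (inner mu F F' - inner M phi phi')| <= (l2n mu F' + l2n M phi') * eps /\
    `|complex.Im (inner mu F F' - inner M phi phi')| <= (l2n mu F' + l2n M phi') * eps.
  move=> /H [s [s1 s2]].
  have ls := L2_lincomb L2e s; have ls' := L2_lincomb L2f s.
  have b1 := L2B lF ls; have b2 := L2B lp ls'.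
  have -> : inner mu F F' - inner M phi phi' =
      inner mu (fun x => F x - lincomb s e x) F' -
      inner M (fun x => phi x - lincomb s f x) phi'.
    by rewrite !innerBl// (corr_lincomb_inner s c); ring.
  rewrite mulrDl !cplxE; split; apply: le_trans (ler_normB _ _) _; apply: lerD.
  - apply: le_trans (Re_inner_le b1 lF') _; rewrite mulrC ler_wpM2l ?l2n_ge0//; exact: ltW.
  - apply: le_trans (Re_inner_le b2 lp') _; rewrite mulrC ler_wpM2l ?l2n_ge0//; exact: ltW.
  - apply: le_trans (Im_inner_le b1 lF') _; rewrite mulrC ler_wpM2l ?l2n_ge0//; exact: ltW.
  - apply: le_trans (Im_inner_le b2 lp') _; rewrite mulrC ler_wpM2l ?l2n_ge0//; exact: ltW.
apply/eqP; rewrite -subr_eq0; apply/eqP.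
by apply: cplx_ext; apply: (@small_eq0 _ _ (l2n mu F' + l2n M phi')) => eps /key [].
Qed.

Lemma joint_approx_corr F phi : joint_approx F phi -> corr F phi.
Proof.
move=> h; have [lF lp _] := h; split=> // i; apply: (joint_approx_inner h).
by split=> // j; exact: gram.
Qed.

Hypotheses (tote : total mu e) (totf : total M f).

Lemma corr_joint_approx F phi : corr F phi -> joint_approx F phi.
Proof.
move=> [lF lp c].
have [G jG] := joint_approx_exists (total_closed_span L2f totf lp).
have [_ _ cG] := joint_approx_corr jG; have [lG _ H] := jG.
have FG : {ae mu, forall x, F x - G x = 0}.
  by apply: tote => [|i]; [exact: L2B|rewrite innerBl// c cG subrr].
split=> // eps /H [s [s1 s2]]; exists s; split=> //.
have ls := L2_lincomb L2e s.
rewrite (ae_eq_l2n (g := fun x => G x - lincomb s e x))//.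
- exact: L2_cmeasurable (L2B lF ls).
- exact: L2_cmeasurable (L2B lG ls).
- by apply: filterS FG => x /eqP; rewrite subr_eq0 => /eqP ->.
Qed.

(** The correspondence is isometric; this takes the place of a unitary operator. *)
Lemma corr_inner F phi F' phi' : corr F phi -> corr F' phi' ->
  inner mu F F' = inner M phi phi'.
Proof. by move=> /corr_joint_approx; exact: joint_approx_inner. Qed.

Lemma corr_exists_l phi : L2 M phi -> exists F, corr F phi.
Proof.
move=> /(total_closed_span L2f totf) /joint_approx_exists [F /joint_approx_corr].
by exists F.
Qed.

Lemma corrZ (a : C) F phi : corr F phi -> corr (fun x => a * F x) (fun x => a * phi x).
Proof.
move=> [lF lp c]; split=> [||i]; [exact: L2Z..|].
by rewrite !innerZl// c.
Qed.

Lemma corrB F phi F' phi' : corr F phi -> corr F' phi' ->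
  corr (fun x => F x - F' x) (fun x => phi x - phi' x).
Proof.
move=> [lF lp c] [lF' lp' c']; split=> [||i]; [exact: L2B..|].
by rewrite !innerBl// c c'.
Qed.

Lemma corr_uniq F F' phi : corr F phi -> corr F' phi -> {ae mu, forall x, F x = F' x}.
Proof.
move=> [lF lp c] [lF' _ c'].
have : {ae mu, forall x, F x - F' x = 0}.
  by apply: tote => [|i]; [exact: L2B|rewrite innerBl// c c' subrr].
by apply: filterS => x /eqP; rewrite subr_eq0 => /eqP.
Qed.

End Corr.

Lemma corr_sym d (T : measurableType d) d' (S : measurableType d')
    (mu : probability T R) (M : probability S R)
    (I : Type) (e : I -> T -> C) (f : I -> S -> C) F phi :
  corr mu M e f F phi -> corr M mu f e phi F.
Proof. by case=> lF lp c; split. Qed.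

End Transport.

(** * The torus and Fourier uniqueness *)

Section Torus.
Variable R : realType.
Implicit Types (x y : (R * R)%type) (z w : int * int).

Definition frac (t : R) : R := t - (Num.floor t)%:~R.

Lemma frac_itv t : 0 <= frac t < 1.
Proof.
have /andP[h1 h2] := floor_itv t; rewrite /frac subr_ge0 h1 /=.
by rewrite ltrBlDr; move: h2; rewrite intrD addrC.
Qed.

Lemma frac_id t : 0 <= t < 1 -> frac t = t.
Proof.
move=> /andP[t0 t1]; rewrite /frac (_ : Num.floor t = 0) ?subr0//.
by apply: floor_def; rewrite t0 /= add0r.
Qed.

Lemma measurable_frac : measurable_fun setT frac.
Proof.
apply: measurable_funB => //; apply: nondecreasing_measurable => // s t st.
by rewrite ler_int le_floor.
Qed.

Definition frac2 x : (R * R)%type := (frac x.1, frac x.2).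

Lemma torus_frac2 x : @torus R (frac2 x).
Proof. by split; exact: frac_itv. Qed.

Lemma frac2_id x : @torus R x -> frac2 x = x.
Proof. by case: x => a b [/= h1 h2]; rewrite /frac2 !frac_id. Qed.

Lemma measurable_frac2 : measurable_fun setT frac2.
Proof.
by apply: measurable_fun_pair; apply: measurableT_comp => //; exact: measurable_frac.
Qed.

Definition tadd x y := frac2 (x.1 + y.1, x.2 + y.2).

Lemma taddC x y : tadd x y = tadd y x.
Proof. by rewrite /tadd addrC [x.2 + _]addrC. Qed.

Lemma torus_tadd x y : @torus R (tadd x y). Proof. exact: torus_frac2. Qed.

Lemma measurable_tadd d (T : measurableType d) (f g : T -> (R * R)%type) :
  measurable_fun setT f -> measurable_fun setT g ->
  measurable_fun setT (fun u => tadd (f u) (g u)).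
Proof.
move=> mf mg; apply: (measurableT_comp measurable_frac2).
by apply: measurable_fun_pair; apply: measurable_funD; exact: measurableT_comp.
Qed.

Lemma torus_measurable : measurable (@torus R).
Proof.
rewrite (_ : @torus R = (fst @^-1` `[0, 1[) `&` (snd @^-1` `[0, 1[)).
  apply: measurableI; rewrite -[X in measurable X]setTI.
    exact: (measurable_fst measurableT).
  exact: (measurable_snd measurableT).
by apply/seteqP; split => -[a b] [/= h1 h2]; split; rewrite /= ?in_itv//=;
  move: h1 h2; rewrite /= ?in_itv.
Qed.

Lemma cos_sin_periodic_int (t : R) (n : int) :
  cos (t + 2 * pi * n%:~R) = cos t /\ sin (t + 2 * pi * n%:~R) = sin t.
Proof.
have nat_case (m : nat) (u : R) : cos (u + 2 * pi * m%:R) = cos u /\ sin (u + 2 * pi * m%:R) = sin u.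
  elim: m => [|m [IHc IHs]]; first by rewrite mulr0 addr0.
  have -> : u + 2 * pi * m.+1%:R = (u + 2 * pi * m%:R) + pi *+ 2.
    by rewrite -[m.+1%:R]natr1 -mulr_natl; ring.
  by rewrite (cosD _ (pi *+ 2)) (sinD _ (pi *+ 2)) cos2pi sin2pi !mulr1 !mulr0
    subr0 addr0 IHc IHs.
case: n => m; first exact: nat_case.
rewrite NegzE; have [c s] := nat_case m.+1 (t + 2 * pi * (- m.+1%:Z)%:~R).
by rewrite -c -s rmorphN /= mulrN subrK.
Qed.

Lemma characterD z w x : character (z + w) x = character z x * character w x.
Proof.
rewrite /character /=; set a := z.1%:~R * _ + _; set b := w.1%:~R * x.1 + _.
have -> : (z.1 + w.1)%:~R * x.1 + (z.2 + w.2)%:~R * x.2 = a + b.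
  by rewrite !intrD /a /b; ring.
by rewrite mulrDr; apply: cplx_ext; rewrite !cplxE /= ?cosD ?sinD 1?addrC// [in RHS]mulrC; ring.
Qed.

Lemma character0 x : character 0 x = 1.
Proof. by rewrite /character /= !mul0r addr0 mulr0 cos0 sin0. Qed.

Lemma characterN z x : character (- z) x = conjc (character z x).
Proof.
rewrite /character /=; have -> : (- z.1)%:~R * x.1 + (- z.2)%:~R * x.2 =
  - (z.1%:~R * x.1 + z.2%:~R * x.2) by rewrite !rmorphN /=; ring.
by rewrite mulrN cosN sinN.
Qed.

Lemma characterB z w x : character (z - w) x = character z x * conjc (character w x).
Proof. by rewrite characterD characterN. Qed.

Lemma cabs2_character z x : cabs2 (character z x) = 1.
Proof. by rewrite /cabs2 /= cos2Dsin2. Qed.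

Lemma character_shift z x (m n : int) :
  character z (x.1 + m%:~R, x.2 + n%:~R) = character z x.
Proof.
rewrite /character /=.
have -> : 2 * pi * (z.1%:~R * (x.1 + m%:~R) + z.2%:~R * (x.2 + n%:~R)) =
  2 * pi * (z.1%:~R * x.1 + z.2%:~R * x.2) + 2 * pi * (z.1 * m + z.2 * n)%:~R :> R.
  by rewrite intrD !intrM; ring.
by have [-> ->] := cos_sin_periodic_int (2 * pi * (z.1%:~R * x.1 + z.2%:~R * x.2)) (z.1 * m + z.2 * n).
Qed.

Lemma character_frac2 z x : character z (frac2 x) = character z x.
Proof.
rewrite -[in RHS](character_shift z x (- Num.floor x.1) (- Num.floor x.2)).
by rewrite !rmorphN.
Qed.

Lemma character_tadd z x y : character z (tadd x y) = character z x * character z y.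
Proof.
rewrite character_frac2 /character /=; move: (2 * pi) => p.
have -> : p * (z.1%:~R * (x.1 + y.1) + z.2%:~R * (x.2 + y.2)) =
  p * (z.1%:~R * x.1 + z.2%:~R * x.2) + p * (z.1%:~R * y.1 + z.2%:~R * y.2) by ring.
by apply: cplx_ext; rewrite !cplxE /= ?cosD ?sinD; ring.
Qed.

Lemma measurable_cos : measurable_fun setT (@cos R).
Proof. by apply: continuous_measurable_fun; exact: continuous_cos. Qed.

Lemma measurable_sin : measurable_fun setT (@sin R).
Proof. by apply: continuous_measurable_fun; exact: continuous_sin. Qed.

Lemma cmeasurable_character z : @cmeasurable R _ (R * R)%type (character z).
Proof.
have m : measurable_fun setT (fun x : (R * R)%type => 2 * pi * (z.1%:~R * x.1 + z.2%:~R * x.2)).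
  by apply: measurable_funM => //; apply: measurable_funD; apply: measurable_funM.
by split; [exact: (measurableT_comp measurable_cos)|exact: (measurableT_comp measurable_sin)].
Qed.

Lemma cmeasurable_character_comp d (T : measurableType d) (s : T -> (R * R)%type) z :
  measurable_fun setT s -> cmeasurable (fun t => character z (s t)).
Proof. by move=> ms; exact: (cmeasurable_comp (cmeasurable_character z)). Qed.

Lemma twopi_itv (t : R) : 0 <= t <= 2^-1 -> 0 <= 2 * pi * t <= pi.
Proof.
have p0 := pi_ge0 R; move=> /andP[t0 t1]; rewrite mulr_ge0 ?mulr_ge0//=.
by rewrite mulrAC -[leRHS]mul1r ler_wpM2r//; lra.
Qed.

Lemma cos_lt_iff (t c : R) : 0 <= t <= 2^-1 -> 0 <= c <= 2^-1 ->
  (t < c) = (cos (2 * pi * c) < cos (2 * pi * t)).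
Proof.
move=> ht hc; rewrite ltr_cos ?in_itv/= ?twopi_itv//.
by rewrite ltr_pM2l// mulr_gt0// pi_gt0.
Qed.

Lemma cos_reflect (t : R) : cos (2 * pi * (1 - t)) = cos (2 * pi * t).
Proof.
rewrite -[RHS]cosN -(cos_sin_periodic_int (- (2 * pi * t)) 1).1.
by congr cos; ring.
Qed.

Lemma sin_half (t : R) : 0 <= t < 1 -> (0 <= sin (2 * pi * t)) = (t <= 2^-1).
Proof.
have p0 := pi_gt0 R; move=> /andP[t0 t1].
have [th|th] := leP t 2^-1.
  by apply: sin_ge0_pi; apply: twopi_itv; rewrite t0.
apply/negbTE; rewrite -ltNge -oppr_gt0 -sinN.
rewrite -(cos_sin_periodic_int (- (2 * pi * t)) 1).2.
rewrite (_ : - _ + _ = (2 * (1 - t)) * pi); last by ring.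
apply: sin_gt0_pi; rewrite mulr_gt0//=; last by lra.
by rewrite -[ltRHS]mul1r ltr_pM2r//; lra.
Qed.

(** The upper half circle is [t <= 2^-1]; the cosine decreases there and increases on the lower
    half. Initial intervals of $[0,1)$ thus become sets cut out by inequalities between sines and
    cosines, hence between parts of characters. *)
Lemma lt_cos_sin (t c : R) : 0 <= t < 1 -> 0 < c <= 1 ->
  (t < c) = if c <= 2^-1 then (0 <= sin (2 * pi * t)) && (cos (2 * pi * c) < cos (2 * pi * t))
            else (0 <= sin (2 * pi * t)) || (cos (2 * pi * t) < cos (2 * pi * c)).
Proof.
move=> ht /andP[c0 c1]; rewrite sin_half//; move: ht => /andP[t0 t1].
have [ch|ch] := leP c 2^-1.
  have [th|th] /= := leP t 2^-1; first by apply: cos_lt_iff; rewrite ?t0 ?th ?(ltW c0) ?ch.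
  by apply/negbTE; rewrite -leNgt; lra.
have [th|th] /= := leP t 2^-1; first by apply: le_lt_trans ch.
by rewrite -(cos_reflect t) -(cos_reflect c) -cos_lt_iff; [lra|apply/andP; split; lra..].
Qed.

End Torus.

(** * Polynomial approximation of absolute values and indicators *)

Section PolynomialApproximation.
Variable R : realType.

(** The iteration for $|t|$ known from the proof of the Stone-Weierstrass theorem. It uses
    constants, sums and products only, under which multipliers are stable. *)
Fixpoint abs_iter (t : R) (n : nat) : R :=
  if n is m.+1 then abs_iter t m + 2^-1 * (t * t - abs_iter t m * abs_iter t m) else 0.

(** With $a=|t|$, one step multiplies the error $a-p$ by $1-(a+p)/2$, which lies between 0 and
    $1-a/2$ as long as $0\le p\le a\le 1$. *)
Lemma abs_iter_bound (t : R) n : `|t| <= 1 ->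
  0 <= abs_iter t n <= `|t| /\ `|t| - abs_iter t n <= `|t| * (1 - `|t| / 2) ^+ n.
Proof.
move=> t1; have t0 := normr_ge0 t.
have tt : t * t = `|t| * `|t| by rewrite -normrM ger0_norm// -expr2 sqr_ge0.
elim: n => [|n [/andP[p0 pt] IH]] /=; first by rewrite lexx t0 subr0 expr0 mulr1.
rewrite tt; move: IH p0 pt; set p := abs_iter t n; set a := `|t| in t0 t1 *.
set q := (1 - a / 2) ^+ n => IH p0 pt.
have q0 : 0 <= q by apply: exprn_ge0; lra.
split; first by apply/andP; split; nra.
rewrite exprS -/q.
have h1 : a - (p + 2^-1 * (a * a - p * p)) = (a - p) * (1 - (a + p) / 2) by field.
rewrite h1; apply: (@le_trans _ _ ((a - p) * (1 - a / 2))); first by nra.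
rewrite mulrCA mulrC; apply: ler_wpM2l => //; lra.
Qed.

Lemma abs_iter_cvg (t : R) : `|t| <= 1 -> abs_iter t @ \oo --> `|t|.
Proof.
move=> t1; have [->|t0] := eqVneq t 0.
  rewrite normr0 (_ : abs_iter 0 = fun=> 0); first exact: cvg_cst.
  by apply/funext; elim => //= n ->; rewrite !mul0r subrr mulr0 addr0.
have tp : 0 < `|t| by rewrite normr_gt0.
apply: (@squeeze_cvgr _ _ _ _ (fun n => `|t| - geometric `|t| (1 - `|t| / 2) n) (fun=> `|t|)).
- apply: nearW => n; have [/andP[h1 h2] h3] := abs_iter_bound n t1.
  by rewrite h2 andbT /=; move: h3; rewrite !lerBlDr addrC.
- rewrite -[X in _ --> X]subr0; apply: cvgB; first exact: cvg_cst.
  by apply: cvg_geometric; rewrite ger0_norm; lra.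
- exact: cvg_cst.
Qed.

Lemma pos_indic_cvg (v : R) : 0 <= v <= 1 ->
  (fun n => 1 - (1 - v) ^+ n) @ \oo --> ((0 < v)%R%:R : R).
Proof.
move=> /andP[v0 v1]; have [vp|] := ltP 0 v.
  rewrite -[X in _ --> X]subr0; apply: cvgB; first exact: cvg_cst.
  by apply: cvg_expr; rewrite ger0_norm; lra.
move=> vn; have -> : v = 0 by apply/eqP; rewrite eq_le v0 vn.
by under eq_fun do rewrite subr0 expr1n subrr; exact: cvg_cst.
Qed.

End PolynomialApproximation.

(** * Uniqueness of Fourier coefficients *)

Section FourierUniqueness.
Context (R : realType) d (E : measurableType d).
Variables (m : probability E R) (s : E -> (R * R)%type).
Hypothesis ms : measurable_fun setT s.
Hypothesis ts : forall x, @torus R (s x).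
Local Notation C := R[i].

Lemma cintegrable_bounded_mul (g f : E -> C) : cmeasurable g ->
  (forall x, cabs2 (g x) <= 1) -> cintegrable m f -> cintegrable m (fun x => g x * f x).
Proof.
move=> mg g1 cf; have mf := cintegrable_cmeasurable cf; case: (cf) => f1 f2.
have gb x : `|complex.Re (g x)| <= 1 /\ `|complex.Im (g x)| <= 1.
  have := g1 x; rewrite /cabs2 => h.
  split; rewrite -(ler_pXn2r (n := 2)) ?nnegrE// expr1n real_normK ?num_real//;
    apply: le_trans h; by rewrite ?lerDl ?lerDr sqr_ge0.
have ib (u v : E -> R) : measurable_fun setT u -> (forall x, `|u x| <= 1) ->
    m.-integrable setT (EFin \o v) -> measurable_fun setT v ->
    m.-integrable setT (EFin \o (fun x => u x * v x)).
  move=> mu u1 iv mv; apply: (@integrable_le _ _ _ m (fun x => u x * v x) (fun x => `|v x|)).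
  - exact: measurable_funM.
  - by move=> x; rewrite normrM ler_piMl.
  - by have := integrable_abse iv; under [EFin \o _]funext do [].
case: mg mf => g1' g2' [f1' f2'].
split.
  by under eq_fun do rewrite ReM; apply: integrableBr; apply: ib => // x; have [] := gb x.
by under eq_fun do rewrite ImM; apply: integrableDr; apply: ib => // x; have [] := gb x.
Qed.

Definition annih (F : E -> C) := cintegrable m F /\
  forall z, cintegral m (fun x => character z (s x) * F x) = 0.

(** Asking that multiplication preserves [annih], rather than that the integral against [F]
    vanishes, makes the class stable under products. It contains the parts of the characters, and
    limits then lead to the indicators of all Borel sets. *)
Definition multiplier (psi : (R * R)%type -> R) :=
  [/\ measurable_fun setT psi, exists c : R, forall y, `|psi y| <= c &
    forall F, annih F -> annih (fun x => (psi (s x))%:C%C * F x)].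

Lemma multiplier_ext (psi psi' : (R * R)%type -> R) : measurable_fun setT psi' ->
  (forall y, @torus R y -> psi y = psi' y) -> (exists c : R, forall y, `|psi' y| <= c) ->
  multiplier psi -> multiplier psi'.
Proof.
move=> mp' pp b [_ _ H]; split=> // F aF; have := H F aF.
by congr annih; apply/funext => x; rewrite pp.
Qed.

Lemma annihD F G : annih F -> annih G -> annih (fun x => F x + G x).
Proof.
move=> [cF zF] [cG zG]; split=> [|z]; first exact: cintegrableD.
have cz H : cintegrable m H -> cintegrable m (fun x => character z (s x) * H x).
  apply: cintegrable_bounded_mul => [|x]; last by rewrite cabs2_character.
  exact: cmeasurable_character_comp.
rewrite (eq_cintegral m (g := fun x => character z (s x) * F x + character z (s x) * G x)).
  by rewrite cintegralD ?zF ?zG ?addr0//; exact: cz.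
by move=> x; rewrite mulrDr.
Qed.

Lemma annihZ (c : C) F : annih F -> annih (fun x => c * F x).
Proof.
move=> [cF zF]; split=> [|z]; first exact: cintegrableZ.
rewrite (eq_cintegral m (g := fun x => c * (character z (s x) * F x))).
  rewrite cintegralZ ?zF ?mulr0//.
  apply: cintegrable_bounded_mul => // [|x]; last by rewrite cabs2_character.
  exact: cmeasurable_character_comp.
by move=> x; rewrite mulrCA.
Qed.

Lemma annih_character w F : annih F -> annih (fun x => character w (s x) * F x).
Proof.
move=> [cF zF]; split=> [|z].
  apply: cintegrable_bounded_mul => // [|x]; last by rewrite cabs2_character.
  exact: cmeasurable_character_comp.
by rewrite -(zF (z + w)); apply: eq_cintegral => x; rewrite characterD mulrA.
Qed.

Lemma multiplier_cst (c : R) : multiplier (fun=> c).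
Proof.
split; [exact: measurable_cst|by exists (`|c|)|].
by move=> F; exact: annihZ.
Qed.

Lemma multiplierD psi psi' : multiplier psi -> multiplier psi' ->
  multiplier (fun y => psi y + psi' y).
Proof.
move=> [m1 [c1 b1] H1] [m2 [c2 b2] H2]; split; first exact: measurable_funD.
  by exists (c1 + c2) => y; apply: le_trans (ler_normD _ _) _; exact: lerD.
move=> F aF; have := annihD (H1 F aF) (H2 F aF); congr annih.
by apply/funext => x; rewrite -mulrDl -rmorphD.
Qed.

Lemma multiplierM psi psi' : multiplier psi -> multiplier psi' ->
  multiplier (fun y => psi y * psi' y).
Proof.
move=> [m1 [c1 b1] H1] [m2 [c2 b2] H2]; split; first exact: measurable_funM.
  by exists (c1 * c2) => y; rewrite normrM; exact: ler_pM.
move=> F aF; have := H1 _ (H2 F aF); congr annih.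
by apply/funext => x; rewrite mulrA -rmorphM.
Qed.

Lemma multiplierZ (c : R) psi : multiplier psi -> multiplier (fun y => c * psi y).
Proof. by move=> h; exact: multiplierM (multiplier_cst c) h. Qed.

Lemma multiplierB psi psi' : multiplier psi -> multiplier psi' ->
  multiplier (fun y => psi y - psi' y).
Proof.
move=> h h'; have := multiplierD h (multiplierZ (-1) h'); congr multiplier.
by apply/funext => y; rewrite mulN1r.
Qed.

Lemma multiplierX psi n : multiplier psi -> multiplier (fun y => psi y ^+ n).
Proof.
move=> h; elim: n => [|n IH]; first exact: multiplier_cst.
by under eq_fun do rewrite exprS; exact: multiplierM.
Qed.

(** Dominated convergence, applied to real and imaginary parts separately. Convergence is asked on
    the torus only, where [s] takes its values. *)
Lemma multiplier_lim (psi : nat -> (R * R)%type -> R) (phi : (R * R)%type -> R) (c : R) :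
  (forall n, multiplier (psi n)) -> (forall n y, @torus R y -> `|psi n y| <= c) ->
  measurable_fun setT phi -> (exists c' : R, forall y, `|phi y| <= c') ->
  (forall y, @torus R y -> psi ^~ y @ \oo --> phi y) -> multiplier phi.
Proof.
move=> mpsi bpsi mphi bphi cvg; split=> // F aF.
have c0 : 0 <= c.
  by apply: le_trans (bpsi 0%N (0, 0) _) => //; split; rewrite /= lexx ltr01.
have cFz z : cintegrable m (fun x => character z (s x) * F x).
  apply: cintegrable_bounded_mul => [|x|]; last by case: aF.
    exact: cmeasurable_character_comp.
  by rewrite cabs2_character.
have lim0 (h : E -> R) : m.-integrable setT (EFin \o h) ->
    m.-integrable setT (EFin \o (fun x => phi (s x) * h x)) /\
    ((forall n, \int[m]_x (psi n (s x) * h x) = 0) -> \int[m]_x (phi (s x) * h x) = 0).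
  move=> ih; have mh : measurable_fun setT h by apply/measurable_EFinP; exact: measurable_int ih.
  have := @dominated_convergence _ E R m setT measurableT
    (fun n x => (psi n (s x) * h x)%:E) (fun x => (phi (s x) * h x)%:E)
    (fun x => (c * `|h x|)%:E).
  case.
  - move=> n; apply/measurable_EFinP/measurable_funM => //.
    by have [+ _ _] := mpsi n => /measurableT_comp; apply.
  - by apply/measurable_EFinP/measurable_funM => //; exact: measurableT_comp.
  - apply: aeW => x _; apply: cvg_EFin; first exact: nearW.
    by apply: cvgM; [exact: cvg|exact: cvg_cst].
  - have := integrableZr c (f := fun x => `|h x|); apply.
    by have := integrable_abse ih; under [EFin \o _]funext do [].
  - apply: aeW => x n _; rewrite /= lee_fin normrM ler_wpM2r//; exact: bpsi.
  move=> iphi _ lim; split=> // zero.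
  rewrite /Rintegral (_ : (\int[m]_x _)%E = 0%E)//.
  have : (fun n => \int[m]_x (psi n (s x) * h x)%:E)%E @ \oo --> 0%E.
    rewrite (_ : (fun n => _) = fun=> 0%E); first exact: cvg_cst.
    apply/funext => n; rewrite -(fineK (x := (\int[m]_x _)%E)).
      by have := zero n; rewrite /Rintegral => ->.
    apply: integrable_fin_num => //.
    apply: (@integrable_le _ _ _ m (fun x => psi n (s x) * h x) (fun x => c * `|h x|)).
    - apply: measurable_funM => //.
      by have [+ _ _] := mpsi n => /measurableT_comp; apply.
    - by move=> x; rewrite normrM ler_wpM2r//; exact: bpsi.
    - have := integrableZr c (f := fun x => `|h x|); apply.
      by have := integrable_abse ih; under [EFin \o _]funext do [].
  by move=> z0; have := cvg_unique _ lim z0; apply.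
have [cF zF] := aF; split.
  have [[f1 _] [f2 _]] := (lim0 _ cF.1, lim0 _ cF.2).
  split; first by under eq_fun do rewrite ReM /= mul0r subr0.
  by under eq_fun do rewrite ImM /= mul0r addr0.
move=> z; apply: cplx_ext; rewrite /cintegral /=.
- under eq_Rintegral do rewrite mulrCA ReM /= mul0r subr0.
  apply: (lim0 _ (cFz z).1).2 => n.
  have [_ _ /(_ _ aF) [_ /(_ z) /(congr1 (@complex.Re R))]] := mpsi n.
  rewrite /cintegral /=.
  by under eq_Rintegral do rewrite mulrCA ReM /= mul0r subr0.
- under eq_Rintegral do rewrite mulrCA ImM /= mul0r addr0.
  apply: (lim0 _ (cFz z).2).2 => n.
  have [_ _ /(_ _ aF) [_ /(_ z) /(congr1 (@complex.Im R))]] := mpsi n.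
  rewrite /cintegral /=.
  by under eq_Rintegral do rewrite mulrCA ImM /= mul0r addr0.
Qed.

(** After scaling into $[-1,1]$, [abs_iter] gives the absolute value and so the positive part [v];
    the functions $1-(1-v)^n$ then converge to the indicator of [v > 0]. *)
Lemma multiplier_pos psi : multiplier psi -> multiplier (fun y => (0 < psi y)%R%:R).
Proof.
move=> mpsi; have [mp [c b] _] := mpsi.
have mpos : measurable_fun setT (fun y => (0 < psi y)%R%:R : R).
  by apply: measurableT_comp => //; exact: measurable_fun_ltr.
have bpos : exists c' : R, forall y, `|(0 < psi y)%R%:R : R| <= c'.
  by exists 1 => y; case: (0 < psi y); rewrite ?normr1 ?normr0.
pose k := `|c| + 1; have k0 : 0 < k by rewrite ltr_wpDl.
pose u y := k^-1 * psi y.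
have mu : multiplier u by exact: multiplierZ.
have u1 y : `|u y| <= 1.
  rewrite normrM [`|k^-1|]ger0_norm ?invr_ge0 ?(ltW k0)// ler_pdivrMl// mulr1.
  by apply: le_trans (b y) _; apply: le_trans (ler_norm c) _; rewrite lerDl.
have mabs : multiplier (fun y => `|u y|).
  apply: (@multiplier_lim (fun n y => abs_iter (u y) n) _ 1).
  - elim=> [|n IH] /=; first exact: multiplier_cst.
    by apply: multiplierD => //; apply: multiplierZ; apply: multiplierB; exact: multiplierM.
  - move=> n y _; have [/andP[h1 h2] _] := abs_iter_bound n (u1 y).
    by rewrite ger0_norm// (le_trans h2).
  - by apply: measurableT_comp => //; case: mu.
  - by exists 1 => y; rewrite normr_id.
  - by move=> y _; exact: abs_iter_cvg.
pose v y := 2^-1 * (`|u y| + u y).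
have mv : multiplier v by apply: multiplierZ; exact: multiplierD.
have v01 y : 0 <= v y <= 1.
  have := u1 y; have := ler_norm (u y); have := ler_norm (- u y); rewrite normrN /v.
  by move=> h1 h2 h3; apply/andP; split; lra.
have vpos y : (0 < v y) = (0 < psi y).
  rewrite /v; have [p0|p0] := ltP 0 (psi y).
    have u0 : 0 < u y by rewrite mulr_gt0// invr_gt0.
    by rewrite gtr0_norm//; lra.
  have u0 : u y <= 0 by rewrite mulr_ge0_le0// invr_ge0 ltW.
  by rewrite ler0_norm// addNr mulr0 ltxx.
apply: (@multiplier_lim (fun n y => 1 - (1 - v y) ^+ n) _ 1) => //.
- move=> n; apply: multiplierB; first exact: multiplier_cst.
  by apply: multiplierX; apply: multiplierB; first exact: multiplier_cst.
- move=> n y _; have /andP[v0 v1] := v01 y.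
  have a0 : 0 <= 1 - v y by lra.
  have a1 : 1 - v y <= 1 by lra.
  have := exprn_ge0 n a0; have := exprn_ile1 n a0 a1 => h1 h2.
  by rewrite ger0_norm; lra.
- by move=> y _; rewrite -vpos; exact: pos_indic_cvg.
Qed.

Definition mult_sets : set (set (R * R)%type) :=
  [set B | measurable B /\ multiplier (\1_B)].

Lemma mult_sets_sigma : sigma_algebra setT mult_sets.
Proof.
have C A : mult_sets A -> mult_sets (~` A).
  move=> [mA hA]; split; first exact: measurableC.
  have := multiplierD (multiplier_cst 1) (multiplierZ (-1) hA); congr multiplier.
  by apply/funext => y; rewrite mulN1r !indicE in_setC; case: (y \in A); rewrite ?subrr ?subr0.
split.
- split=> //; have := multiplier_cst 0; congr multiplier.
  by apply/funext => y; rewrite indicE in_set0.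
- by move=> A /C; rewrite setTD.
- move=> A hA; have mU : measurable (\bigcup_k A k).
    by apply: bigcupT_measurable => k; have [] := hA k.
  split=> //.
  (* The indicator of the union of the first [n] sets, written with operations that preserve
     multipliers. *)
  pose psi n y : R := 1 - \prod_(k < n) (1 - \1_(A k) y).
  apply: (@multiplier_lim psi _ 1).
  + move=> n; rewrite /psi; apply: multiplierB; first exact: multiplier_cst.
    elim: n => [|n IH].
      by under eq_fun do rewrite big_ord0; exact: multiplier_cst.
    under eq_fun do rewrite big_ord_recr /=; apply: multiplierM => //.
    by apply: multiplierB; [exact: multiplier_cst|have [] := hA n].
  + move=> n y _; rewrite /psi.
    have : 0 <= \prod_(k < n) (1 - \1_(A k) y : R) <= 1.
      apply/andP; split.
        by apply: prodr_ge0 => k _; rewrite indicE; case: (_ \in _); rewrite ?subrr ?subr0.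
      apply: prodr_ile1 => k _; rewrite indicE; case: (_ \in _); rewrite ?subrr ?subr0 ?lexx ?ler01//.
    by move=> /andP[h1 h2]; rewrite ger0_norm; lra.
  + exact: measurable_indic.
  + by exists 1 => y; rewrite indicE; case: (_ \in _); rewrite ?normr1 ?normr0.
  + move=> y _; rewrite indicE; have [/set_mem [k _ Ak]|yA] := boolP (y \in _).
      apply: cvg_near_cst; exists k.+1 => // n /= kn.
      rewrite /psi (bigD1 (Ordinal kn)) //= indicE mem_set// subrr mul0r subr0//.
    apply: cvg_near_cst; exists 0%N => // n /= _; rewrite /psi big1 ?subrr// => k _.
    rewrite indicE memNset ?subr0// => Ak; move/negP : yA; apply; apply/mem_set; by exists k.
Qed.

Lemma multiplier_Re_character z : multiplier (fun y => complex.Re (character z y)).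
Proof.
split; first by have [] := cmeasurable_character R z.
  by exists 1 => y; rewrite /character /= ler_norml cos_geN1 cos_le1.
move=> F aF.
have := annihZ (2^-1)%:C%C (annihD (annih_character z aF) (annih_character (- z) aF)).
congr annih; apply/funext => x; rewrite characterN -mulrDl mulrA; congr (_ * _).
by apply: cplx_ext; rewrite !cplxE /=; lra.
Qed.

Lemma multiplier_Im_character z : multiplier (fun y => complex.Im (character z y)).
Proof.
split; first by have [] := cmeasurable_character R z.
  by exists 1 => y; rewrite /character /= ler_norml sin_geN1 sin_le1.
move=> F aF.
have := annihZ (Complex 0 (- 2^-1)) (annihD (annih_character z aF)
  (annihZ (-1) (annih_character (- z) aF))).
congr annih; apply/funext => x; rewrite characterN mulN1r -mulNr -mulrDl mulrA; congr (_ * _).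
by apply: cplx_ext; rewrite !cplxE /=; lra.
Qed.

Lemma mult_sets_gt psi (c : R) : multiplier psi -> mult_sets [set y | c < psi y].
Proof.
move=> mpsi; have [mp _ _] := mpsi.
have mc := multiplierD mpsi (multiplier_cst (- c)).
split.
  have := measurable_fun_ltr (measurable_cst c) mp measurableT (Y := [set true]) I.
  by rewrite setTI.
have := multiplier_pos mc; congr multiplier; apply/funext => y.
by rewrite indicE subr_gt0; congr ((nat_of_bool _)%:R); apply/idP/asboolP.
Qed.

Lemma mult_sets_torus B B' : measurable B' -> B `&` @torus R = B' `&` @torus R ->
  mult_sets B -> mult_sets B'.
Proof.
move=> mB' BB [mB hB]; split=> //; apply: multiplier_ext hB.
- exact: measurable_indic.
- move=> y ty; rewrite !indicE; congr ((nat_of_bool _)%:R).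
  have BB' : B y <-> B' y.
    split=> h.
      by have : (B `&` @torus R) y by []; rewrite BB => -[].
    by have : (B' `&` @torus R) y by []; rewrite -BB => -[].
  by apply/asboolP/asboolP => /BB'.
- by exists 1 => y; rewrite indicE; case: (_ \in _); rewrite ?normr1 ?normr0.
Qed.

Lemma mult_setsC B : mult_sets B -> mult_sets (~` B).
Proof. by case: mult_sets_sigma => _ H _ /H; rewrite setTD. Qed.

Lemma mult_setsU B B' : mult_sets B -> mult_sets B' -> mult_sets (B `|` B').
Proof.
case: mult_sets_sigma => _ _ H h h'; rewrite -bigcup2E; apply: H.
by case=> [|[|n]] //=; case: mult_sets_sigma.
Qed.

Lemma mult_setsI B B' : mult_sets B -> mult_sets B' -> mult_sets (B `&` B').
Proof.
by move=> h h'; rewrite -[B `&` B']setCK setCI; apply: mult_setsC; apply: mult_setsU; exact: mult_setsC.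
Qed.

(** [p] is the angle of a character, so [lt_cos_sin] describes its half-lines by conditions on the
    real and imaginary parts. Outside of $0<c\le 1$ the half-line misses the torus or contains
    it. *)
Lemma mult_sets_coord (p : (R * R)%type -> R) z (c : R) : measurable_fun setT p ->
  (forall y, @torus R y -> 0 <= p y < 1) ->
  (forall y, character z y = Complex (cos (2 * pi * p y)) (sin (2 * pi * p y))) ->
  mult_sets [set y | p y < c].
Proof.
move=> mp tp zp.
have mB : measurable [set y | p y < c].
  have := measurable_fun_ltr mp (measurable_cst c) measurableT (Y := [set true]) I.
  by rewrite setTI.
have [_ _ bigU] := mult_sets_sigma; have [s0 _ _] := mult_sets_sigma.
have [c0|c0] := leP c 0.
  apply: mult_sets_torus s0 => //; rewrite set0I; apply/esym/seteqP; split=> // y [/= h /tp /andP[h' _]].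
  by have := lt_le_trans h c0; rewrite ltNge h'.
have [c1|c1] := ltP 1 c.
  apply: (@mult_sets_torus setT) => //; last by rewrite -setC0; exact: mult_setsC.
  apply/seteqP; split=> y [_ ty]; split=> //=.
  by have /andP[_ h] := tp _ ty; exact: lt_trans c1.
have hs := multiplierZ (-1) (multiplier_Im_character z).
rewrite (_ : (fun y => _) = fun y => - sin (2 * pi * p y)) in hs; last first.
  by apply/funext => y; rewrite zp mulN1r.
have hc := multiplier_Re_character z.
rewrite (_ : (fun y => _) = fun y => cos (2 * pi * p y)) in hc; last first.
  by apply/funext => y; rewrite zp.
have hS : mult_sets [set y | 0 <= sin (2 * pi * p y)].
  have := mult_setsC (mult_sets_gt 0 hs).
  congr mult_sets; apply/seteqP; split=> y /=; rewrite oppr_gt0.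
    by move/negP; rewrite -leNgt.
  by move=> h; apply/negP; rewrite -leNgt.
have [ch|ch] := leP c 2^-1.
  have hC := mult_sets_gt (cos (2 * pi * c)) hc.
  apply: mult_sets_torus (mult_setsI hS hC) => //; apply/seteqP; split=> y [/= h ty]; split=> //=.
    by rewrite (lt_cos_sin (tp _ ty)) ?c0// ch; move: h => -[-> ->].
  by move: h; rewrite (lt_cos_sin (tp _ ty)) ?c0// ch => /andP[].
have hC := mult_sets_gt (- cos (2 * pi * c)) (multiplierZ (-1) hc).
apply: mult_sets_torus (mult_setsU hS hC) => //; apply/seteqP; split=> y [/= h ty]; split=> //=.
  rewrite (lt_cos_sin (tp _ ty)) ?c0// leNgt ch /=; move: h; rewrite mulN1r ltrN2.
  by case=> ->; rewrite ?orbT.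
by move: h; rewrite (lt_cos_sin (tp _ ty)) ?c0// leNgt ch /= mulN1r ltrN2 => /orP.
Qed.

(** Both coordinates are measurable for the sigma-algebra [mult_sets], hence so is the identity of
    the plane with its Borel sets as target. *)
Lemma measurable_mult_sets B : measurable B -> mult_sets B.
Proof.
move=> mB.
have sE : mult_sets.-sigma.-measurable = mult_sets.
  exact: measurable_g_measurableTypeE mult_sets_sigma.
have mc (p : (R * R)%type -> R) : (forall c, mult_sets [set y | p y < c]) ->
    measurable_fun (setT : set (g_sigma_algebraType mult_sets)) p.
  move=> H mD; apply: (measurability _ (RGenInftyO.measurableE R)) => //.
  move=> _ [_ [c ->] <-]; rewrite setTI sE (_ : _ @^-1` _ = [set y | p y < c])//.
have m1 : measurable_fun (setT : set (g_sigma_algebraType mult_sets)) (@fst R R).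
  apply: mc => c; apply: (@mult_sets_coord fst (1, 0)) => //; first by move=> y [].
  by move=> y; rewrite /character /= mul1r mul0r addr0.
have m2 : measurable_fun (setT : set (g_sigma_algebraType mult_sets)) (@snd R R).
  apply: mc => c; apply: (@mult_sets_coord snd (0, 1)) => //; first by move=> y [].
  by move=> y; rewrite /character /= mul1r mul0r add0r.
have := measurable_fun_pair m1 m2 measurableT mB; rewrite setTI sE; congr mult_sets.
by apply/seteqP; split=> -[a b].
Qed.

(** Multiplication by [\1_B (s x)] keeps [F] in [annih]; the claim is the coefficient of the product
    at the trivial character. *)
Theorem fourier_uniqueness F B : cintegrable m F ->
  (forall z, cintegral m (fun x => character z (s x) * F x) = 0) -> measurable B ->
  cintegral m (fun x => (\1_B (s x))%:C%C * F x) = 0.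
Proof.
move=> cF zF /measurable_mult_sets [_ [_ _ /(_ _ (conj cF zF)) [_ /(_ 0)]]].
by under eq_cintegral do rewrite character0 mul1r.
Qed.

End FourierUniqueness.

(** * Bochner's theorem for Z^2 *)

Section Counting.

Lemma sum_nat_blocks (V : zmodType) (K n : nat) (f : nat -> V) :
  \sum_(0 <= i < K * n) f i = \sum_(0 <= j < n) \sum_(0 <= r < K) f (K * j + r)%N.
Proof.
elim: n => [|n IH]; first by rewrite muln0 !big_nil.
rewrite big_nat_recr//= -IH mulnS addnC.
rewrite (big_cat_nat (n := (K * n)%N))//=; last exact: leq_addr.
congr (_ + _); rewrite -{1}[(K * n)%N]add0n big_addn addKn.
by apply: eq_bigr => r _; rewrite addnC.
Qed.

(** A downward closed set of indices is an initial segment, so its cardinality decides membership.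
    Index 0 is not counted, which makes the count the largest index of the segment. *)
Lemma count_down_closed (P : nat -> bool) (n : nat) :
  (forall k, (k.+1 < n)%N -> P k.+1 -> P k) ->
  forall k, (1 <= k < n)%N -> P k = (k <= \sum_(1 <= i < n) P i)%N.
Proof.
have le_cnt m : (\sum_(1 <= i < m) P i <= m.-1)%N.
  rewrite -[leqRHS]muln1 -subn1 -[leqRHS]sum_nat_const_nat.
  by apply: leq_sum => i _; case: (P i).
elim: n => [|n IH] dc k; first by rewrite ltn0 andbF.
move=> /andP[k0 kn].
have n0 : (0 < n)%N by lia.
have IHn j : (1 <= j < n)%N -> P j = (j <= \sum_(1 <= i < n) P i)%N.
  by apply: IH => i il; apply: dc; exact: ltnW.
rewrite big_nat_recr//=.
have [Pn|Pn] := boolP (P n); last first.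
  rewrite addn0; have [->|nk] := eqVneq k n.
    by rewrite (negbTE Pn); apply/esym/negbTE; rewrite -ltnNge; apply: leq_ltn_trans (le_cnt n) _; rewrite ltn_predL.
  by apply: IHn; rewrite k0 /= ltn_neqAle nk.
have allB j : (j <= n)%N -> P (n - j)%N.
  elim: j => [|j IHj] jn; first by rewrite subn0.
  by apply: dc; rewrite subnSK//; [rewrite ltnS leq_subr|exact/IHj/ltnW].
have all i : (i <= n)%N -> P i by move=> iln; rewrite -(subKn iln) allB// leq_subr.
rewrite all//; apply/esym.
suff -> : (\sum_(1 <= i < n) P i = n.-1)%N by rewrite addn1 prednK.
rewrite (eq_big_nat _ _ (F2 := fun=> 1%N)); first by rewrite sum_nat_const_nat muln1 subn1.
by move=> i /andP[_ iln]; rewrite all// ltnW.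
Qed.

End Counting.

Section Cells.

(* The cell j < 4^l of level l is the dyadic square with lower left corner
   (cellx l j / 2^l, celly l j / 2^l); its children are 4 j + r, r < 4. *)
Fixpoint cellx (l j : nat) : nat :=
  if l is l'.+1 then (2 * cellx l' (j %/ 4) + (j %% 4) %/ 2)%N else 0%N.

Fixpoint celly (l j : nat) : nat :=
  if l is l'.+1 then (2 * celly l' (j %/ 4) + (j %% 4) %% 2)%N else 0%N.

(** The numbering of the cells follows the Z-order curve, a bijection onto the grid; each induction
    step splits off the last binary digit of both coordinates. *)
Lemma sum_cells (V : zmodType) (l : nat) (h : nat -> nat -> V) :
  \sum_(0 <= i < 4 ^ l) h (cellx l i) (celly l i) =
  \sum_(0 <= a < 2 ^ l) \sum_(0 <= b < 2 ^ l) h a b.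
Proof.
elim: l h => [|l IH] h; first by rewrite !expn0 !big_nat1.
rewrite !expnS sum_nat_blocks.
transitivity (\sum_(0 <= j < 4 ^ l) \sum_(0 <= r < 4)
    h (2 * cellx l j + r %/ 2)%N (2 * celly l j + r %% 2)%N).
  apply: eq_bigr => j _; apply: eq_big_nat => r /andP[_ r4].
  have -> : h (cellx l.+1 (4 * j + r)) (celly l.+1 (4 * j + r)) =
    h (2 * cellx l ((4 * j + r) %/ 4) + ((4 * j + r) %% 4) %/ 2)%N
      (2 * celly l ((4 * j + r) %/ 4) + ((4 * j + r) %% 4) %% 2)%N by [].
  have -> : ((4 * j + r) %/ 4 = j)%N by lia.
  by have -> : ((4 * j + r) %% 4 = r)%N by lia.
rewrite (IH (fun a b => \sum_(0 <= r < 4) h (2 * a + r %/ 2)%N (2 * b + r %% 2)%N)).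
rewrite sum_nat_blocks; apply: eq_bigr => a _.
under [RHS]eq_bigr do rewrite sum_nat_blocks.
rewrite [RHS]exchange_big /=; apply: eq_bigr => b _.
by rewrite !big_nat_recr //= !big_nil !add0r /= !addrA !addn0.
Qed.

(** Dropping the last [k] base 4 digits of the number of a cell leads to its ancestor [k] levels
    higher. *)
Lemma cell_nested l k i :
  (2 ^ k * cellx l (i %/ 4 ^ k) <= cellx (l + k) i < 2 ^ k * (cellx l (i %/ 4 ^ k)).+1)%N /\
  (2 ^ k * celly l (i %/ 4 ^ k) <= celly (l + k) i < 2 ^ k * (celly l (i %/ 4 ^ k)).+1)%N.
Proof.
elim: k i => [|k IH] i; first by rewrite !expn0 divn1 addn0 !mul1n; lia.
rewrite addnS /= !expnS.
have -> : (i %/ (4 * 4 ^ k) = i %/ 4 %/ 4 ^ k)%N by rewrite -divnMA.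
have [/andP[h1 h2] /andP[h3 h4]] := IH (i %/ 4)%N.
have h5 : (i %% 4 < 4)%N by rewrite ltn_mod.
move: h1 h2 h3 h4 h5; rewrite !mulnS.
set p := (2 ^ k)%N; set q := (p * _)%N; set q' := (p * celly _ _)%N.
rewrite -!mulnA -/q -/q'.
by move=> h1 h2 h3 h4 h5; split; lia.
Qed.

End Cells.

Section UltraLimit.
Context (R : realType).
Variable U : set_system nat.
Hypothesis uU : UltraFilter U.

(** Limits along an ultrafilter replace a diagonal extraction: the same filter serves all cells of
    all levels, and the limits stay additive. *)
Lemma ulim_exists (u : nat -> R) (c : R) : (\forall n \near U, `|u n| <= c) ->
  exists l : R, u @ U --> l.
Proof.
move=> uc.
have : compact `[- c, c]%classic by exact: segment_compact.
move=> /(_ (u @ U) _) [|l [_ lc]].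
  by apply: filterS uc => n /=; rewrite in_itv /= -ler_norml.
exists l => A nA; have [//|UA] := in_ultra_setVsetC (u @^-1` A) uU.
have := lc (~` A) A UA nA; by case=> x [].
Qed.

Lemma cvg_sum_nat (F : set_system nat) (FF : Filter F) (f : nat -> nat -> R) (a : nat -> R) N :
  (forall j, (j < N)%N -> f ^~ j @ F --> a j) ->
  (fun n => \sum_(0 <= j < N) f n j) @ F --> \sum_(0 <= j < N) a j.
Proof.
elim: N => [|N IH] H.
  rewrite big_nil; under eq_fun do rewrite big_nil; exact: cvg_cst.
rewrite big_nat_recr//=; under eq_fun do rewrite big_nat_recr//=.
by apply: cvgD; [apply: IH => j jN; apply: H; exact: ltnW|exact: H].
Qed.

End UltraLimit.

Section CharacterLipschitz.
Variable R : realType.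

Lemma lipschitz_derive1 (f df : R -> R) (x y : R) :
  (forall t : R, is_derive t (1 : R) f (df t)) -> (forall t, `|df t| <= 1) ->
  `|f x - f y| <= `|x - y|.
Proof.
move=> fdf df1; wlog xy : x y / x <= y.
  by move=> H; have [/H//|/ltW/H] := leP x y; rewrite distrC [`|x - y|]distrC.
have [] := @MVT_segment R f df x y xy (fun t _ => fdf t).
  by apply: derivable_within_continuous => t _; have [] := fdf t.
move=> c _ fc; rewrite distrC fc normrM [`|x - y|]distrC ler_piMl//.
Qed.

Definition char_lip (z : int * int) : R := 2 * pi * (`|z.1%:~R| + `|z.2%:~R|).

Lemma character_lipschitz z (x y : (R * R)%type) (e : R) :
  `|x.1 - y.1| <= e -> `|x.2 - y.2| <= e ->
  `|complex.Re (character z x) - complex.Re (character z y)| <= char_lip z * e /\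
  `|complex.Im (character z x) - complex.Im (character z y)| <= char_lip z * e.
Proof.
move=> h1 h2; rewrite /character /=.
set a := 2 * pi * _; set b := 2 * pi * _.
have ab : `|a - b| <= char_lip z * e.
  have p0 : 0 <= 2 * pi :> R by rewrite mulr_ge0// pi_ge0.
  rewrite /a /b -mulrBr normrM (ger0_norm p0) /char_lip -mulrA ler_wpM2l//.
  have -> : z.1%:~R * x.1 + z.2%:~R * x.2 - (z.1%:~R * y.1 + z.2%:~R * y.2) =
    z.1%:~R * (x.1 - y.1) + z.2%:~R * (x.2 - y.2) by ring.
  apply: le_trans (ler_normD _ _) _; rewrite mulrDl !normrM.
  by apply: lerD; rewrite ler_wpM2l.
split; apply: le_trans ab.
- apply: (@lipschitz_derive1 _ (fun t => - sin t)) => t.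
  by rewrite normrN ler_norml sin_geN1 sin_le1.
- apply: (@lipschitz_derive1 _ (@cos R)) => t.
  by rewrite ler_norml cos_geN1 cos_le1.
Qed.

End CharacterLipschitz.

(** * Weak limits of measures on dyadic grids *)

Section TreeLimit.
Context (R : realType).
Local Notation C := R[i].
Variables (u : nat -> nat -> R) (phi : int * int -> C).
Hypothesis u0 : forall n i, 0 <= u n i.
Hypothesis u1 : forall n, \sum_(0 <= i < 4 ^ n.+1) u n i = 1.

Definition cellpt (l j : nat) : (R * R)%type :=
  ((cellx l j)%:R / 2 ^+ l, (celly l j)%:R / 2 ^+ l).

(* The weights u n sit on the grid of level n + 1. *)
Hypothesis uphi : forall z,
  (fun n => \sum_(0 <= i < 4 ^ n.+1) u n i * complex.Re (character z (cellpt n.+1 i))) @ \oo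
    --> complex.Re (phi z) /\
  (fun n => \sum_(0 <= i < 4 ^ n.+1) u n i * complex.Im (character z (cellpt n.+1 i))) @ \oo
    --> complex.Im (phi z).

Lemma cellpt_nested l k i :
  [/\ (cellpt l (i %/ 4 ^ k)).1 <= (cellpt (l + k) i).1 <= (cellpt l (i %/ 4 ^ k)).1 + 2 ^- l &
      (cellpt l (i %/ 4 ^ k)).2 <= (cellpt (l + k) i).2 <= (cellpt l (i %/ 4 ^ k)).2 + 2 ^- l].
Proof.
have key (a b : nat) : (2 ^ k * a <= b < 2 ^ k * a.+1)%N ->
    (a%:R / 2 ^+ l <= b%:R / 2 ^+ (l + k) :> R) && (b%:R / 2 ^+ (l + k) <= a%:R / 2 ^+ l + 2 ^- l :> R).
  move=> /andP[h1 h2]; have p0 : 0 < (2 ^+ l : R) by rewrite exprn_gt0.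
  have q0 : 0 < (2 ^+ k : R) by rewrite exprn_gt0.
  have E : b%:R / 2 ^+ (l + k) = b%:R / 2 ^+ k / 2 ^+ l :> R.
    by rewrite exprD invfM mulrA mulrAC.
  rewrite !E -[X in _ + X]mul1r -mulrDl !ler_pM2r ?invr_gt0// natr1.
  rewrite ler_pdivlMr// ler_pdivrMr// -natrX -!natrM !ler_nat.
  by rewrite ![(_ * 2 ^ k)%N]mulnC h1 ltnW.
by have [h1 h2] := cell_nested l k i; split; exact: key.
Qed.

(** The mass that the grid weights [u n] give to cell [j] of level [l]. Because of the truncated
    subtraction this is the meaning for [l <= n.+1] only, which holds eventually for each [l]. *)
Definition cellmass (n l j : nat) : R :=
  \sum_(0 <= r < 4 ^ (n.+1 - l)) u n (4 ^ (n.+1 - l) * j + r)%N.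

Lemma cellmass_ge0 n l j : 0 <= cellmass n l j.
Proof. by apply: sumr_ge0. Qed.

Lemma sum_cellmass (n l : nat) (h : nat -> R) : (l <= n.+1)%N ->
  \sum_(0 <= j < 4 ^ l) cellmass n l j * h j =
  \sum_(0 <= i < 4 ^ n.+1) u n i * h (i %/ 4 ^ (n.+1 - l))%N.
Proof.
move=> ln; rewrite -{1}(subnK ln) expnD sum_nat_blocks; apply: eq_bigr => j _.
rewrite mulr_suml; apply: eq_big_nat => r /andP[_ rk].
by rewrite mulnC divnMDl ?expn_gt0// divn_small// addn0.
Qed.

Lemma cellmass_total n l : (l <= n.+1)%N -> \sum_(0 <= j < 4 ^ l) cellmass n l j = 1.
Proof.
move=> ln; rewrite -[RHS](u1 n); have := sum_cellmass (fun=> 1) ln.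
by under eq_bigr do rewrite mulr1; under [X in _ = X -> _]eq_bigr do rewrite mulr1.
Qed.

Lemma cellmass_children n l j : (l < n.+1)%N ->
  cellmass n l j = \sum_(0 <= r < 4) cellmass n l.+1 (4 * j + r)%N.
Proof.
move=> ln; rewrite /cellmass -(subnSK ln) expnSr sum_nat_blocks.
apply: eq_bigr => q _; apply: eq_bigr => r _; congr (u n _).
by rewrite subSS mulnDr mulnA addnA.
Qed.

Lemma cellmass_le1 n l j : (l <= n.+1)%N -> (j < 4 ^ l)%N -> `|cellmass n l j| <= 1.
Proof.
move=> ln jl; rewrite ger0_norm ?cellmass_ge0// -(cellmass_total ln).
rewrite big_mkord (bigD1 (Ordinal jl))//= lerDl; apply: sumr_ge0 => i _; exact: cellmass_ge0.
Qed.

(** Weak compactness of the probability measures on the unit square, made explicit: only the masses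
    of dyadic cells are passed to the limit. The sums of the values at the corners of the cells then
    recover the Fourier coefficients up to the Lipschitz constant times the side of the cells. *)
Lemma tree_masses : exists mu : nat -> nat -> R,
  [/\ forall l j, (j < 4 ^ l)%N -> 0 <= mu l j,
      forall l j, (j < 4 ^ l)%N -> mu l j = \sum_(0 <= r < 4) mu l.+1 (4 * j + r)%N,
      forall l, \sum_(0 <= j < 4 ^ l) mu l j = 1 &
      forall l z,
        `|\sum_(0 <= j < 4 ^ l) mu l j * complex.Re (character z (cellpt l j))
          - complex.Re (phi z)| <= char_lip R z * 2 ^- l /\
        `|\sum_(0 <= j < 4 ^ l) mu l j * complex.Im (character z (cellpt l j))
          - complex.Im (phi z)| <= char_lip R z * 2 ^- l].
Proof.
have [U [uU Uoo]] := ultraFilterLemma (F := eventually) _.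
have pU : ProperFilter U by exact: ultra_proper.
have large (l : nat) : \forall n \near U, (l <= n.+1)%N.
  by apply: Uoo; exists l => // n /= /leqW.
have ex l j : exists m : R, (j < 4 ^ l)%N -> (fun n => cellmass n l j) @ U --> m.
  have [jl|_] := ltnP j (4 ^ l); last by exists 0.
  have [|m hm] := @ulim_exists R U uU (fun n => cellmass n l j) 1; last by exists m.
  by apply: filterS (large l) => n ln; exact: cellmass_le1.
have [m hm] := choice (fun p : nat * nat => ex p.1 p.2).
pose mu l j := m (l, j).
have hmu l j : (j < 4 ^ l)%N -> (fun n => cellmass n l j) @ U --> mu l j := hm (l, j).
exists mu; split.
- move=> l j jl; apply: ler_cvg_to (cvg_cst (0 : R)) (hmu l j jl) _.
  by apply: nearW => n; exact: cellmass_ge0.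
- move=> l j jl.
  have h : (fun n => \sum_(0 <= r < 4) cellmass n l.+1 (4 * j + r)%N) @ U -->
      \sum_(0 <= r < 4) mu l.+1 (4 * j + r)%N.
    apply: cvg_sum_nat => r r4; apply: hmu; rewrite expnS.
    by apply: (@leq_trans (4 * j.+1)); rewrite ?leq_mul2l// mulnS addnC ltn_add2r.
  apply: (cvg_unique (@norm_hausdorff _ R) (hmu l j jl)); apply: cvg_trans h.
  by apply: near_eq_cvg; apply: filterS (large l.+1) => n ln; rewrite -cellmass_children.
- move=> l; have h : (fun n => \sum_(0 <= j < 4 ^ l) cellmass n l j) @ U -->
      \sum_(0 <= j < 4 ^ l) mu l j by apply: cvg_sum_nat => j; exact: hmu.
  apply: (cvg_unique (@norm_hausdorff _ R) h); apply: cvg_near_cst.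
  by apply: filterS (large l) => n; exact: cellmass_total.
(* Replacing each grid point by the corner of its ancestor of level [l] moves it by at most
   [2 ^- l]. The estimate is uniform in [n], so it survives the limit. *)
have key l (g : (R * R)%type -> R) (e c : R) :
    (forall x y : (R * R)%type, `|x.1 - y.1| <= 2 ^- l -> `|x.2 - y.2| <= 2 ^- l -> `|g x - g y| <= e) ->
    (fun n => \sum_(0 <= i < 4 ^ n.+1) u n i * g (cellpt n.+1 i)) @ \oo --> c ->
    `|\sum_(0 <= j < 4 ^ l) mu l j * g (cellpt l j) - c| <= e.
  move=> ge gc.
  have h1 : (fun n => \sum_(0 <= j < 4 ^ l) cellmass n l j * g (cellpt l j)) @ U -->
      \sum_(0 <= j < 4 ^ l) mu l j * g (cellpt l j).
    apply: (@cvg_sum_nat R U _ (fun n j => cellmass n l j * g (cellpt l j))) => j jl.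
    by apply: cvgM; [exact: hmu|exact: cvg_cst].
  have h2 : (fun n => \sum_(0 <= i < 4 ^ n.+1) u n i * g (cellpt n.+1 i)) @ U --> c.
    exact: cvg_trans (cvg_app _ Uoo) gc.
  have h3 : (fun n => `|\sum_(0 <= j < 4 ^ l) cellmass n l j * g (cellpt l j) -
      \sum_(0 <= i < 4 ^ n.+1) u n i * g (cellpt n.+1 i)|) @ U -->
      `|\sum_(0 <= j < 4 ^ l) mu l j * g (cellpt l j) - c|.
    by apply: cvg_norm; exact: cvgB.
  apply: ler_cvg_to h3 (cvg_cst e) _; apply: filterS (large l) => n ln /=.
  rewrite sum_cellmass// -sumrB; apply: le_trans (ler_norm_sum _ _ _) _.
  rewrite -[leRHS]mul1r -(u1 n) mulr_suml; apply: ler_sum => i _.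
  rewrite -mulrBr normrM ger0_norm// ler_wpM2l//; apply: ge.
    have [/andP[a1 a2] _] := cellpt_nested l (n.+1 - l) i; move: a1 a2; rewrite subnKC//.
    by rewrite distrC => a1 a2; rewrite ger0_norm ?subr_ge0// lerBlDl.
  have [_ /andP[a1 a2]] := cellpt_nested l (n.+1 - l) i; move: a1 a2; rewrite subnKC//.
  by rewrite distrC => a1 a2; rewrite ger0_norm ?subr_ge0// lerBlDl.
move=> l z; have [c1 c2] := uphi z; split.
  by apply: (key l (fun x => complex.Re (character z x))) c1 => x y h1 h2;
    have [] := character_lipschitz z h1 h2.
by apply: (key l (fun x => complex.Im (character z x))) c2 => x y h1 h2;
    have [] := character_lipschitz z h1 h2.
Qed.

End TreeLimit.

Section NatMeasurable.
Context d (T : measurableType d).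

Lemma measurable_fun_natP (f : T -> nat) :
  (forall n, measurable (f @^-1` [set n])) -> measurable_fun setT f.
Proof.
move=> H _ Y _; rewrite setTI.
have -> : f @^-1` Y = \bigcup_(n in Y) f @^-1` [set n].
  by apply/seteqP; split=> [x Yx|x [n Yn /= ->]]//; exists (f x).
by apply: bigcup_measurable => n _; exact: H.
Qed.

Lemma measurable_preimage_nat (f : T -> nat) (A : set nat) :
  measurable_fun setT f -> measurable (f @^-1` A).
Proof. by move=> mf; rewrite -[X in measurable X]setTI; apply: mf. Qed.

Lemma measurable_nat2 (h : nat -> nat -> nat) (f g : T -> nat) :
  measurable_fun setT f -> measurable_fun setT g ->
  measurable_fun setT (fun x => h (f x) (g x)).
Proof.
move=> mf mg; apply: measurable_fun_natP => n.
have -> : (fun x => h (f x) (g x)) @^-1` [set n] =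
    \bigcup_a \bigcup_(b in [set b | h a b = n]) (f @^-1` [set a] `&` g @^-1` [set b]).
  apply/seteqP; split=> [x /= hx|x [a _ [b /= <- [/= -> ->]]]]//.
  by exists (f x) => //; exists (g x).
apply: bigcupT_measurable => a; apply: bigcup_measurable => b _.
by apply: measurableI; exact: measurable_preimage_nat.
Qed.

Lemma measurable_nat_of_bool (b : T -> bool) : measurable_fun setT b ->
  measurable_fun setT (fun x => nat_of_bool (b x)).
Proof. by move=> mb; apply: measurableT_comp mb. Qed.

Lemma measurable_sum_nat (f : nat -> T -> nat) (m n : nat) :
  (forall i, measurable_fun setT (f i)) ->
  measurable_fun setT (fun x => \sum_(m <= i < n) f i x)%N.
Proof.
move=> mf; elim: n => [|n IH].
  by under eq_fun do rewrite big_geq//; exact: measurable_cst.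
have [mn|nm] := leqP m n.
  under eq_fun do rewrite big_nat_recr//=.
  exact: (@measurable_nat2 addn).
by under eq_fun do rewrite big_geq//; exact: measurable_cst.
Qed.

Variable (R : realType).

Lemma Rintegral_nat_valued (P : probability T R) (J : T -> nat) (h : nat -> R) N :
  measurable_fun setT J -> (forall x, (J x < N)%N) ->
  \int[P]_x h (J x) = \sum_(0 <= j < N) h j * fine (P (J @^-1` [set j])).
Proof.
move=> mJ JN; have mA j := measurable_preimage_nat [set j] mJ.
have -> : (fun x => h (J x)) =
    (fun x => \sum_(0 <= j < N) h j * \1_(J @^-1` [set j]) x).
  apply/funext => x; rewrite big_mkord (bigD1 (Ordinal (JN x)))//= indicE mem_set//= mulr1.
  rewrite big1 ?addr0// => i /eqP iJ; rewrite indicE memNset ?mulr0// => /= E.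
  by apply: iJ; apply: val_inj.
have i1 j : P.-integrable setT (EFin \o (fun x => \1_(J @^-1` [set j]) x : R)).
  apply: (@integrable_le _ _ _ P _ (fun=> 1)); first exact: measurable_indic.
    by move=> x; rewrite indicE; case: (_ \in _); rewrite ?normr1 ?normr0.
  exact: finite_measure_integrable_cst.
have im j : P.-integrable setT (EFin \o (fun x => h j * \1_(J @^-1` [set j]) x)).
  exact: integrableZr.
elim: N {JN} => [|N IH].
  by under eq_Rintegral do rewrite big_nil; rewrite big_nil Rintegral_cst// mul0r.
under eq_Rintegral do rewrite big_nat_recr//=.
rewrite big_nat_recr//= RintegralD//; last first.
  elim: N {IH} => [|N IH].
    by under eq_fun do rewrite big_nil; exact: finite_measure_integrable_cst.
  by under eq_fun do rewrite big_nat_recr//=; exact: integrableDr.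
rewrite IH RintegralZl//.
by congr (_ + _ * fine _); rewrite integral_indic// setIT.
Qed.

End NatMeasurable.

(** * A measure with prescribed masses of dyadic cells *)

Section TreeMeasure.
Context (R : realType).
Variable mu : nat -> nat -> R.
Hypothesis mu0 : forall l j, (j < 4 ^ l)%N -> 0 <= mu l j.
Hypothesis mu_children : forall l j, (j < 4 ^ l)%N ->
  mu l j = \sum_(0 <= r < 4) mu l.+1 (4 * j + r)%N.
Hypothesis mu_total : forall l, \sum_(0 <= j < 4 ^ l) mu l j = 1.

Let G l j : R := \sum_(0 <= i < j) mu l i.

Let G_mono l j k : (j <= k <= 4 ^ l)%N -> G l j <= G l k.
Proof.
move=> /andP[jk kl]; rewrite /G (big_cat_nat (n := j) (p := k))//= lerDl big_nat_cond.
by apply: sumr_ge0 => i /andP[/andP[_ ik] _]; apply: mu0; exact: leq_trans kl.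
Qed.

Let G_children l j : (j <= 4 ^ l)%N -> G l.+1 (4 * j)%N = G l j.
Proof.
move=> jl; rewrite /G sum_nat_blocks; apply/esym; apply: eq_big_nat => i /andP[_ ij].
by apply: mu_children; exact: leq_trans jl.
Qed.

(* Index of the cell of level l containing `|t|, when [0, 1) is cut into
   consecutive intervals of lengths mu l 0, mu l 1, ... *)
Let J l (t : R) : nat := (\sum_(1 <= i < 4 ^ l) (G l i <= `|t|)%R)%N.

Let J_lt l t : (J l t < 4 ^ l)%N.
Proof.
apply: (@leq_ltn_trans (4 ^ l).-1); last by rewrite ltn_predL expn_gt0.
rewrite -[leqRHS]muln1 -subn1 -[leqRHS]sum_nat_const_nat.
by apply: leq_sum => i _; case: (_ <= _).
Qed.

Let J_ge l k t : (k < 4 ^ l)%N -> (k <= J l t)%N = (G l k <= `|t|).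
Proof.
case: k => [|k] kl; first by rewrite /G big_nil normr_ge0 leq0n.
rewrite /J -(@count_down_closed (fun i => G l i <= `|t|) (4 ^ l))// => i il.
by apply: le_trans; apply: G_mono; rewrite leqnSn ltnW.
Qed.

(** The division points of level [l] are those of level [l.+1] whose index is a multiple of 4, by
    [G_children]; so the intervals of consecutive levels are nested. *)
Let J_children l t : (J l.+1 t %/ 4 = J l t)%N.
Proof.
have lt1 : (J l.+1 t %/ 4 < 4 ^ l)%N by rewrite ltn_divLR// -expnSr.
have E k : (k < 4 ^ l)%N -> (k <= J l t)%N = (k <= J l.+1 t %/ 4)%N.
  move=> kl; rewrite leq_divRL// J_ge// -(G_children (ltnW kl)) mulnC J_ge//.
  by rewrite expnSr ltn_pmul2r.
by apply/eqP; rewrite eqn_leq -E// leqnn /= ?E ?leqnn// -E.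
Qed.

Let J_nested l k t : (J (l + k) t %/ 4 ^ k = J l t)%N.
Proof.
elim: k => [|k IH]; first by rewrite addn0 expn0 divn1.
by rewrite addnS expnS divnMA J_children.
Qed.

Let mJ l : measurable_fun setT (J l).
Proof.
apply: measurable_sum_nat => i; apply: measurable_nat_of_bool.
by apply: measurable_fun_ler => //; exact: measurableT_comp.
Qed.

(* [uniform_prob] lives on this copy of R, which carries the same sigma-algebra. *)
Local Notation RL := (g_sigma_algebraType (R.-ocitv.-measurable)).

Let P : probability RL R := uniform_prob (@ltr01 R).

Lemma uniform_prob01E (A : set R) : measurable A ->
  uniform_prob (@ltr01 R) A = lebesgue_measure (A `&` `[0, 1]).
Proof.
move=> mA.
transitivity (\int[uniform_prob (@ltr01 R)]_x (\1_A x)%:E)%E.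
  by rewrite integral_indic// setIT.
rewrite integral_uniform.
- by rewrite subr0 invr1 mul1e integral_indic// setIC.
- by apply/measurable_EFinP; exact: measurable_indic.
- by move=> x; rewrite lee_fin.
Qed.

Let J_mass l j : (j < 4 ^ l)%N -> fine (P (J l @^-1` [set j])) = mu l j.
Proof.
move=> jl; have -> : P (J l @^-1` [set j]) = lebesgue_measure (J l @^-1` [set j] `&` `[0, 1]).
  exact: uniform_prob01E (measurable_preimage_nat [set j] (mJ l)).
have Gj : G l j.+1 = G l j + mu l j by rewrite /G big_nat_recr.
have G0 k : (k <= 4 ^ l)%N -> 0 <= G l k <= 1.
  move=> kl; rewrite -(mu_total l) -[X in _ <= _ <= X]/(G l (4 ^ l)) G_mono ?kl ?leqnn// andbT.
  by have := @G_mono l 0 k; rewrite {1}/G big_nil; apply; rewrite kl.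
have /andP[a0 a1] := G0 _ (ltnW jl); have /andP[b0 b1] := G0 _ jl.
have ab : G l j <= G l j.+1 by rewrite Gj lerDl mu0.
have diff : mu l j = G l j.+1 - G l j by rewrite Gj addrC addKr.
(* The parameters falling into a cell form a half-open interval, except that the last cell also
   receives [t = 1]; the two kinds of right end are distinguished by [b]. *)
have meas (b : bool) : fine (lebesgue_measure [set` Interval (BLeft (G l j)) (BSide b (G l j.+1))]) = mu l j.
  rewrite lebesgue_measure_itv /= lte_fin diff; case: ltP => //= h.
  by apply/esym/eqP; rewrite subr_eq0 eq_le h ab.
have Jin t : 0 <= t <= 1 -> (J l t = j) <-> (G l j <= t /\ ((j.+1 < 4 ^ l)%N -> t < G l j.+1)).
  move=> /andP[t0 t1]; have tt : `|t| = t by rewrite ger0_norm.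
  have h1 := J_ge t jl; rewrite tt in h1.
  split=> [E|[h2 h3]].
    split; first by rewrite -h1 E.
    by move=> j1; have := J_ge t j1; rewrite E ltnn tt => /esym/negbT; rewrite -ltNge.
  apply/eqP; rewrite eqn_leq h1 h2 andbT leqNgt; apply/negP => h4.
  have j1 : (j.+1 < 4 ^ l)%N by apply: leq_ltn_trans h4 _; exact: J_lt.
  by move: h4; rewrite J_ge// tt leNgt h3.
have [j1|j1] := ltnP j.+1 (4 ^ l).
  rewrite -(meas true); congr (fine (lebesgue_measure _)); apply/seteqP; split=> t /=.
    rewrite !in_itv /= => -[/= E t01]; have [h1 h2] := (Jin t t01).1 E.
    by rewrite h1 h2.
  rewrite !in_itv /= => /andP[h1 h2]; have t01 : 0 <= t <= 1.
    by rewrite (le_trans a0 h1) (le_trans (ltW h2)).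
  by split=> //; apply/(Jin t t01); split=> // _.
have jE : j.+1 = (4 ^ l)%N by apply/eqP; rewrite eqn_leq jl j1.
have G1 : G l j.+1 = 1 by rewrite jE /G mu_total.
rewrite -(meas false); congr (fine (lebesgue_measure _)); apply/seteqP; split=> t /=.
  rewrite !in_itv /= => -[/= E t01]; have [h1 h2] := (Jin t t01).1 E.
  by rewrite h1 G1; case/andP: t01.
rewrite !in_itv /= G1 => /andP[h1 h2]; have t01 : 0 <= t <= 1 by rewrite (le_trans a0 h1).
by split=> //; apply/(Jin t t01); split=> //; rewrite ltnNge j1.
Qed.

Let Xl l t := cellpt R l (J l t).

Let X (t : R) : (R * R)%type :=
  (fine (limn_esup (fun l => (Xl l t).1%:E)), fine (limn_esup (fun l => (Xl l t).2%:E))).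

Let mXl l : measurable_fun setT (fun t => (Xl l t).1) /\ measurable_fun setT (fun t => (Xl l t).2).
Proof.
split; first by apply: (measurableT_comp (f := fun j => (cellpt R l j).1)) (mJ l).
by apply: (measurableT_comp (f := fun j => (cellpt R l j).2)) (mJ l).
Qed.

Let mX : measurable_fun setT X.
Proof.
apply: measurable_fun_pair; apply: (measurableT_comp (fine_measurable measurableT));
  apply: measurable_fun_limn_esup => n; apply/measurable_EFinP.
  by have [] := mXl n.
by have [] := mXl n.
Qed.

Let Xl_X l t : `|(X t).1 - (Xl l t).1| <= 2 ^- l /\ `|(X t).2 - (Xl l t).2| <= 2 ^- l.
Proof.
have N m k : [/\ (Xl m t).1 <= (Xl (m + k) t).1 <= (Xl m t).1 + 2 ^- m &
    (Xl m t).2 <= (Xl (m + k) t).2 <= (Xl m t).2 + 2 ^- m].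
  by have := cellpt_nested R m k (J (m + k) t); rewrite J_nested.
have key (v : nat -> R) (a : R) : (forall m k, v m <= v (m + k)%N <= v m + 2 ^- m) ->
    a = fine (limn_esup (EFin \o v)) -> `|a - v l| <= 2 ^- l.
  move=> vN ->.
  have vc : cvgn v.
    apply: (@geometric_step_cvg _ v 1 2^-1) => // [|n].
      by rewrite invf_lt1// ltr1n.
    rewrite mul1r exprVn -[n.+1]addn1; have /andP[h1 h2] := vN n 1%N.
    by rewrite ger0_norm ?subr_ge0// lerBlDl.
  rewrite (cvg_ereal_fine_limsup vc).
  have v1 : v l <= limn v.
    apply: limr_ge => //; exists l => // n /= ln; have := vN l (n - l)%N.
    by rewrite subnKC// => /andP[].
  have v2 : limn v <= v l + 2 ^- l.
    apply: limr_le => //; exists l => // n /= ln; have := vN l (n - l)%N.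
    by rewrite subnKC// => /andP[].
  by rewrite ger0_norm ?subr_ge0// lerBlDl.
split.
  by apply: (key (fun l => (Xl l t).1)) => // m k; have [] := N m k.
by apply: (key (fun l => (Xl l t).2)) => // m k; have [] := N m k.
Qed.

(** No premeasure is extended: the measure is the distribution of a random point, whose parameter
    [t] is uniform on $[0,1]$ and which is the limit of the corners of the nested cells selected by
    [J]. The limit may lie on the far sides of the unit square, so [frac2] brings it back to the
    torus; this is why the test functions have to be periodic. *)
Theorem tree_measure : exists sigma : probability (R * R)%type R,
  sigma (~` @torus R) = 0%E /\
  forall (g : (R * R)%type -> R) (L c : R), measurable_fun setT g -> (forall x, `|g x| <= 1) ->
    (forall x, g (frac2 x) = g x) ->
    (forall (x y : (R * R)%type) (e : R), `|x.1 - y.1| <= e -> `|x.2 - y.2| <= e ->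
      `|g x - g y| <= L * e) ->
    (forall l, `|\sum_(0 <= j < 4 ^ l) mu l j * g (cellpt R l j) - c| <= L * 2 ^- l) ->
    \int[sigma]_x g x = c.
Proof.
have mfX : measurable_fun (setT : set RL) (fun t => frac2 (X t)).
  exact: (measurableT_comp (@measurable_frac2 R) mX).
pose Y : {mfun RL >-> (R * R)%type} := HB.pack (fun t => frac2 (X t)) (isMeasurableFun.Build _ _ _ _ _ mfX).
exists (distribution P Y); split.
  rewrite /distribution /pushforward /= (_ : _ @^-1` _ = set0) ?measure0//.
  by apply/seteqP; split=> // t /=; apply; exact: torus_frac2.
move=> g L c mg g1 gf gL gc.
have ig (h : RL -> R) : measurable_fun setT h -> (forall t, `|h t| <= 1) ->
    P.-integrable setT (EFin \o h).
  move=> mh h1; apply: (@integrable_le _ _ _ P h (fun=> 1)) => //.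
  exact: finite_measure_integrable_cst.
have mgX : measurable_fun (setT : set RL) (fun t => g (X t)) by exact: (measurableT_comp mg mX).
have -> : \int[distribution P Y]_x g x = \int[P]_t g (X t).
  rewrite /Rintegral /distribution integral_pushforward//=.
  - by congr fine; apply: eq_integral => t _ /=; rewrite gf.
  - exact/measurable_EFinP.
  - rewrite preimage_setT; have := ig _ mgX (fun t => g1 _); congr (_.-integrable _ _).
    by apply/funext => t /=; rewrite gf.
have L0 : 0 <= L.
  have := gL (0, 0) (0, 0) 1; rewrite !subrr !normr0 ler01 mulr1; exact.
apply/eqP; rewrite -subr_eq0; apply/eqP; apply: (@small_eq0 _ _ (2 * L)) => e e0.
have [l le] : exists l, 2 ^- l <= e.
  have : (fun n => geometric (1 : R) 2^-1 n) @ \oo --> (0 : R).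
    by apply: cvg_geometric; rewrite ger0_norm// invf_lt1// ltr1n.
  move=> /cvgrPdist_lt /(_ _ e0) [N _ /(_ N (leqnn N))].
  rewrite /= sub0r normrN mul1r ger0_norm ?exprn_ge0// exprVn => h.
  by exists N; exact: ltW.
apply: (@le_trans _ _ (2 * L * 2 ^- l)); last by rewrite ler_wpM2l// mulr_ge0.
have mXlP : measurable_fun setT (Xl l).
  by apply: (measurableT_comp (f := cellpt R l)) (mJ l).
have E : \int[P]_t g (Xl l t) = \sum_(0 <= j < 4 ^ l) mu l j * g (cellpt R l j).
  rewrite (@Rintegral_nat_valued _ _ _ P (J l) (fun j => g (cellpt R l j)) _ (mJ l) (J_lt l)).
  by apply: eq_big_nat => j /andP[_ jl]; rewrite J_mass// mulrC.
have mgXl : measurable_fun (setT : set RL) (fun t => g (Xl l t)) by exact: (measurableT_comp mg mXlP).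
have d1 : `|\int[P]_t g (X t) - \int[P]_t g (Xl l t)| <= L * 2 ^- l.
  rewrite -RintegralB//; [|by apply: ig|by apply: ig].
  apply: le_trans (le_normr_Rintegral _ _) _ => //.
    by apply: integrableBr; exact: ig.
  rewrite -[leRHS]mulr1 -[X in _ * X](_ : fine (P setT) = 1); last by rewrite probability_setT.
  rewrite -Rintegral_cst//; apply: le_Rintegral => //.
  - have := @integrableBr _ _ _ P _ _ (ig _ mgX (fun t => g1 _)) (ig _ mgXl (fun t => g1 _)).
    by move/integrable_abse; under [EFin \o _]funext do [].
  - exact: finite_measure_integrable_cst.
  - by move=> t _; have [h1 h2] := Xl_X l t; exact: gL.
rewrite [X in `|X|](_ : _ = (\int[P]_t g (X t) - \int[P]_t g (Xl l t)) +
  (\int[P]_t g (Xl l t) - c)); last by rewrite addrA subrK.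
apply: le_trans (ler_normD _ _) _; rewrite -mulrA mulr_natl mulr2n.
by apply: lerD => //; rewrite E.
Qed.

End TreeMeasure.

(** * Roots of unity and Fejér weights *)

Section RootsOfUnity.
Variable R : realType.
Local Notation C := R[i].

Definition eu (t : R) : C := Complex (cos (2 * pi * t)) (sin (2 * pi * t)).

Lemma euD s t : eu (s + t) = eu s * eu t.
Proof.
by rewrite /eu mulrDr; apply: cplx_ext; rewrite !cplxE /= ?cosD ?sinD; ring.
Qed.

Lemma eu0 : eu 0 = 1.
Proof. by rewrite /eu mulr0 cos0 sin0. Qed.

Lemma eu_int (n : int) : eu n%:~R = 1.
Proof.
have [c s] := cos_sin_periodic_int (0 : R) n.
by rewrite /eu -[2 * pi * _]add0r c s cos0 sin0.
Qed.

Lemma eu_natmul t (a : nat) : eu (a%:R * t) = eu t ^+ a.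
Proof.
elim: a => [|a IH]; first by rewrite mul0r eu0 expr0.
by rewrite -natr1 mulrDl mul1r euD IH exprSr.
Qed.

Lemma character_eu (z : int * int) (x : (R * R)%type) :
  character z x = eu (z.1%:~R * x.1) * eu (z.2%:~R * x.2).
Proof. by rewrite -euD. Qed.

Lemma eu_neq1 (t : R) : 0 < t < 1 -> eu t != 1.
Proof.
move=> /andP[t0 t1]; apply/eqP => -[c s].
have h := sin_half (t := t); rewrite t1 (ltW t0) s lexx in h; have {}h := esym (h isT).
have := cos_lt_iff (t := 0) (c := t); rewrite lexx h (ltW t0) c mulr0 cos0 ltxx t0.
by move/(_ _ isT) => /=; rewrite invr_ge0 ler0n => /(_ isT).
Qed.

(** A geometric sum whose ratio is an [M]-th root of unity; the bound on [d] ensures that the ratio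
    is 1 only for [d = 0]. *)
Lemma sum_roots_of_unity (d : int) (M : nat) : (`|d| < M)%N ->
  \sum_(0 <= a < M) eu (d%:~R / M%:R) ^+ a = (d == 0)%:R *+ M.
Proof.
move=> dM; have M0 : (0 < M)%N by apply: leq_ltn_trans dM.
have MR : 0 < (M%:R : R) by rewrite ltr0n.
have [->|d0] := eqVneq d 0.
  rewrite mul0r eu0.
  by under eq_bigr do rewrite expr1n; rewrite sumr_const_nat subn0.
rewrite mul0rn; set w := eu _.
have w1 : w != 1.
  have pos (e : nat) : (0 < e < M)%N -> eu (e%:R / M%:R) != 1.
    move=> /andP[e0 eM]; apply: eu_neq1.
    by rewrite divr_gt0 ?ltr0n//= ltr_pdivrMr// mul1r ltr_nat.
  move: dM d0 @w; case: d => e eM e0 w; first by apply: pos; lia.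
  apply/eqP => ww; have := pos e.+1 eM; apply/negP/negPn/eqP.
  have := euD ((Negz e)%:~R / M%:R) (e.+1%:R / M%:R).
  rewrite -/w ww mul1r => <-; rewrite NegzE rmorphN /= mulNr addNr.
  by rewrite eu0.
have wM : w ^+ M = 1.
  by rewrite -eu_natmul mulrC divfK ?gt_eqF// eu_int.
apply/eqP; rewrite -(mulrI_eq0 _ (lregP (_ : w - 1 != 0))) ?subr_eq0//.
by rewrite big_mkord -subrX1 wM subrr.
Qed.

(** The number of representations of [v] as a difference of two numbers below [N]. Divided by [N] it
    is a coefficient of the Fejér kernel. *)
Definition diff_count (N : nat) (v : int) : R :=
  \sum_(0 <= i < N) \sum_(0 <= j < N) (((i : int) - (j : int))%R == v)%:R.

Lemma sum_indic_eq (N m : nat) : \sum_(0 <= i < N) ((i == m)%:R : R) = (m < N)%:R.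
Proof.
elim: N => [|N IH]; first by rewrite big_nil ltn0.
rewrite big_nat_recr//= IH ltnS.
by case: (ltngtP m N) => _; rewrite ?addr0 ?add0r.
Qed.

Lemma sum_indic_shift (N k : nat) : \sum_(0 <= j < N) ((k + j < N)%N%:R : R) = (N - k)%:R.
Proof.
have H K : (K <= N)%N -> \sum_(0 <= j < N) ((j < K)%N%:R : R) = K%:R.
  move=> KN; rewrite (big_cat_nat (n := K))//= (eq_big_nat _ _ (F2 := fun=> 1)).
    rewrite [X in _ + X](eq_big_nat _ _ (F2 := fun=> 0)).
      by rewrite [X in _ + X]big1// addr0 sumr_const_nat subn0.
    by move=> i /andP[Ki _]; rewrite ltnNge Ki.
  by move=> i /andP[_ ->].
rewrite -(H (N - k)%N (leq_subr _ _)); apply: eq_bigr => j _.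
by rewrite ltn_subRL.
Qed.

Lemma diff_countE N v : diff_count N v = (N - `|v|)%:R.
Proof.
rewrite /diff_count; case: v => k.
  rewrite exchange_big /= -sum_indic_shift; apply: eq_bigr => j _.
  rewrite -sum_indic_eq; apply: eq_bigr => i _; congr (nat_of_bool _)%:R.
  by apply/eqP/eqP; lia.
rewrite -sum_indic_shift; apply: eq_bigr => i _.
rewrite -sum_indic_eq; apply: eq_bigr => j _; congr (nat_of_bool _)%:R.
by apply/eqP/eqP; lia.
Qed.

End RootsOfUnity.

Section Bochner.
Variable R : realType.
Local Notation C := R[i].
Variable phi : int * int -> C.
Hypothesis phi0 : phi 0 = 1.
Hypothesis phi_pos : forall s : seq ((int * int) * C),
  0 <= \sum_(p <- s) \sum_(q <- s) p.2 * conjc q.2 * phi (p.1 - q.1).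

Section Grid.
Variable n : nat.
Let N := (2 ^ n)%N.
(** The grid has twice as many points per axis as there are frequencies, so a frequency below [N]
    minus a difference of frequencies stays below [M] and no aliasing occurs. *)
Let M := (2 ^ n.+1)%N.

Let gridpt (a b : nat) : (R * R)%type := (a%:R / M%:R, b%:R / M%:R).

Let sq (i j : nat) : int * int := (i%:Z, j%:Z).

(** The positive definite form of [phi] evaluated at the vector of conjugate characters at a grid
    point, hence nonnegative. Up to normalisation it is a Fejér mean of the Fourier series with
    coefficients [phi]. *)
Definition fejer (a b : nat) : C :=
  \sum_(0 <= i < N) \sum_(0 <= j < N) \sum_(0 <= i' < N) \sum_(0 <= j' < N)
    conjc (character (sq i j) (gridpt a b)) * character (sq i' j') (gridpt a b) *
    phi (sq i j - sq i' j').

Lemma fejer_ge0 a b : 0 <= fejer a b.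
Proof.
have := phi_pos [seq (sq i j, conjc (character (sq i j) (gridpt a b))) |
  i <- index_iota 0 N, j <- index_iota 0 N].
rewrite big_flatten big_map; congr (0 <= _); apply: eq_bigr => i _.
rewrite big_map; apply: eq_bigr => j _; rewrite big_flatten big_map; apply: eq_bigr => i' _.
by rewrite big_map; apply: eq_bigr => j' _; rewrite conjcK.
Qed.

Definition fejer_weight (a b : nat) : R :=
  complex.Re (fejer a b) / ((N * M) ^ 2)%:R.

Lemma fejer_weight_ge0 a b : 0 <= fejer_weight a b.
Proof.
by rewrite mulr_ge0 ?invr_ge0 ?ler0n//; have := fejer_ge0 a b; rewrite lecE => /andP[].
Qed.

Lemma sum_character_grid (d : int * int) : (`|d.1| < M)%N -> (`|d.2| < M)%N ->
  \sum_(0 <= a < M) \sum_(0 <= b < M) character d (gridpt a b) =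
  ((d == 0)%:R *+ (M * M))%R.
Proof.
move=> d1 d2.
have E a b : character d (gridpt a b) = eu (d.1%:~R / M%:R) ^+ a * eu (d.2%:~R / M%:R) ^+ b.
  by rewrite character_eu -!eu_natmul /=; congr (eu _ * eu _); rewrite mulrC mulrAC -mulrA mulrC.
under eq_bigr do under eq_bigr do rewrite E.
under eq_bigr do rewrite -mulr_sumr.
rewrite -mulr_suml !sum_roots_of_unity// mulrnAr -mulrnAl -mulrnA.
have -> : (d == 0) = (d.1 == 0) && (d.2 == 0) by case: (d).
by case: (d.1 == 0); case: (d.2 == 0); rewrite ?(mulr1, mulr0, mul0rn, mul0r).
Qed.

(** Characters are orthogonal on the grid, so the weights have as Fourier coefficients the values of
    [phi] damped by the Fejér factors. *)
Lemma fejer_coef (v : int * int) : (`|v.1| < N)%N -> (`|v.2| < N)%N ->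
  \sum_(0 <= a < M) \sum_(0 <= b < M) (fejer_weight a b)%:C%C * character v (gridpt a b) =
  ((diff_count R N v.1 * diff_count R N v.2) / (N * N)%:R)%:C%C * phi v.
Proof.
move=> v1 v2.
have N0 : (0 < N)%N by rewrite expn_gt0.
have MN : M = (2 * N)%N by rewrite /M expnS.
have M0 : (0 < M)%N by rewrite expn_gt0.
have wE a b : (fejer_weight a b)%:C%C = (((N * M) ^ 2)%:R^-1)%:C%C * fejer a b.
  have := fejer_ge0 a b; rewrite lecE /= => /andP[/eqP im _].
  by apply: cplx_ext; rewrite !cplxE /= ?im !(mul0r, mulr0, subr0, addr0)// mulrC.
under eq_bigr do under eq_bigr do rewrite wE -mulrA.
under eq_bigr do rewrite -mulr_sumr.
rewrite -mulr_sumr.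
have step : \sum_(0 <= a < M) \sum_(0 <= b < M) fejer a b * character v (gridpt a b) =
    \sum_(0 <= i < N) \sum_(0 <= j < N) \sum_(0 <= i' < N) \sum_(0 <= j' < N)
      phi (sq i j - sq i' j') *
      \sum_(0 <= a < M) \sum_(0 <= b < M) character (v - (sq i j - sq i' j')) (gridpt a b).
  under eq_bigr do under eq_bigr do rewrite mulr_suml.
  under eq_bigr do rewrite exchange_big.
  rewrite exchange_big; apply: eq_bigr => i _.
  under eq_bigr do under eq_bigr do rewrite mulr_suml.
  under eq_bigr do rewrite exchange_big.
  rewrite exchange_big; apply: eq_bigr => j _.
  under eq_bigr do under eq_bigr do rewrite mulr_suml.
  under eq_bigr do rewrite exchange_big.
  rewrite exchange_big; apply: eq_bigr => i' _.
  under eq_bigr do under eq_bigr do rewrite mulr_suml.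
  under eq_bigr do rewrite exchange_big.
  rewrite exchange_big; apply: eq_bigr => j' _.
  rewrite mulr_sumr; apply: eq_bigr => a _; rewrite mulr_sumr; apply: eq_bigr => b _.
  rewrite characterB characterB conjcM conjcK.
  by rewrite mulrAC mulrC; congr (_ * _); rewrite mulrC mulrA.
rewrite step.
(* Orthogonality on the grid leaves only the quadruples of indices whose difference is [v]; these
   are then counted by [diff_count] in each coordinate. *)
have step2 : \sum_(0 <= i < N) \sum_(0 <= j < N) \sum_(0 <= i' < N) \sum_(0 <= j' < N)
      phi (sq i j - sq i' j') *
      \sum_(0 <= a < M) \sum_(0 <= b < M) character (v - (sq i j - sq i' j')) (gridpt a b) =
    \sum_(0 <= i < N) \sum_(0 <= j < N) \sum_(0 <= i' < N) \sum_(0 <= j' < N)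
      (((i : int) - (i' : int) == v.1)%:R * ((j : int) - (j' : int) == v.2)%:R)%:C%C *
        (phi v *+ (M * M)).
  apply: eq_big_nat => i iN; apply: eq_big_nat => j jN; apply: eq_big_nat => i' iN'.
  apply: eq_big_nat => j' jN'.
  rewrite sum_character_grid /=; [|by rewrite MN; lia..].
  have [vE|vE] := eqVneq (v - (sq i j - sq i' j')) 0.
    have -> : v = sq i j - sq i' j' by apply/eqP; rewrite -subr_eq0 vE.
    by rewrite /= !eqxx mulr1 mul1r mulr_natr.
  rewrite mul0rn mulr0 -natrM mulnb.
  case: andP => [[/eqP e1 /eqP e2]|_]; last by rewrite mul0r.
  by case/eqP: vE; rewrite /sq; move: e1 e2; case: (v) => x y /= <- <-; rewrite subrr.
rewrite step2.
under eq_bigr do under eq_bigr do under eq_bigr do rewrite -mulr_suml.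
under eq_bigr do under eq_bigr do rewrite -mulr_suml.
under eq_bigr do rewrite -mulr_suml.
rewrite -mulr_suml -[phi v *+ _]mulr_natr.
have -> : \sum_(0 <= i < N) \sum_(0 <= j < N) \sum_(0 <= i' < N) \sum_(0 <= j' < N)
    (((i : int) - (i' : int) == v.1)%:R * ((j : int) - (j' : int) == v.2)%:R)%:C%C =
    (diff_count R N v.1 * diff_count R N v.2)%:C%C.
  rewrite /diff_count mulr_suml rmorph_sum /=; apply: eq_bigr => i _.
  rewrite exchange_big /= mulr_suml rmorph_sum /=; apply: eq_bigr => i' _.
  rewrite mulr_sumr rmorph_sum /=; apply: eq_bigr => j _.
  by rewrite mulr_sumr rmorph_sum.
rewrite (_ : (M * M)%:R = ((M * M)%:R : R)%:C%C :> C); last by rewrite rmorph_nat.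
rewrite [phi v * _]mulrC !mulrA -!rmorphM /=; congr (_%:C%C * _).
have N1 : (N%:R : R) != 0 by rewrite pnatr_eq0 -lt0n.
have M1 : (M%:R : R) != 0 by rewrite pnatr_eq0 -lt0n.
by rewrite natrX !natrM; field; rewrite N1 M1.
Qed.

End Grid.

Lemma ReZ (a : R) (w : C) : complex.Re (a%:C%C * w) = a * complex.Re w.
Proof. by case: w => x y /=; rewrite mul0r subr0. Qed.

Lemma ImZ (a : R) (w : C) : complex.Im (a%:C%C * w) = a * complex.Im w.
Proof. by case: w => x y /=; rewrite mul0r addr0. Qed.

(** The Fejér weights are probability measures on finer and finer grids, and their Fourier
    coefficients tend to [phi]; the measure sought is a weak limit of them. *)
Theorem bochner : exists sigma : probability (R * R)%type R,
  sigma (~` @torus R) = 0%E /\ forall z, cintegral sigma (character z) = phi z.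
Proof.
pose u n i := fejer_weight n (cellx n.+1 i) (celly n.+1 i).
have gridE n i : ((cellx n.+1 i)%:R / (2 ^ n.+1)%N%:R, (celly n.+1 i)%:R / (2 ^ n.+1)%N%:R)
    = cellpt R n.+1 i.
  by rewrite /cellpt natrX.
have sumE n (z : int * int) : (`|z.1| < 2 ^ n)%N -> (`|z.2| < 2 ^ n)%N ->
  \sum_(0 <= i < 4 ^ n.+1) (u n i)%:C%C * character z (cellpt R n.+1 i) =
  ((((2 ^ n - `|z.1|)%N%:R * (2 ^ n - `|z.2|)%N%:R) / (2 ^ n * 2 ^ n)%N%:R))%:C%C * phi z.
  move=> z1 z2; rewrite -!diff_countE -fejer_coef//.
  rewrite -(sum_cells n.+1 (fun a b => (fejer_weight n a b)%:C%C *
    character z (a%:R / (2 ^ n.+1)%N%:R, b%:R / (2 ^ n.+1)%N%:R))).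
  by apply: eq_bigr => i _; rewrite gridE.
have u0 n i : 0 <= u n i by exact: fejer_weight_ge0.
have u1 n : \sum_(0 <= i < 4 ^ n.+1) u n i = 1.
  have H : \sum_(0 <= i < 4 ^ n.+1) (u n i)%:C%C = 1 :> C.
    transitivity (\sum_(0 <= i < 4 ^ n.+1) (u n i)%:C%C * character 0 (cellpt R n.+1 i)).
      by apply: eq_bigr => i _; rewrite character0 mulr1.
    rewrite sumE ?expn_gt0// phi0 mulr1 !subn0 -natrM divff//.
  by move/(congr1 (@complex.Re R)) : H; rewrite Re_sum.
(* The Fejér factors $(1-a/2^n)(1-b/2^n)$ tend to 1. *)
have lim (c : R) (a b : nat) : (fun n => (((2 ^ n - a)%N%:R * (2 ^ n - b)%N%:R)
    / (2 ^ n * 2 ^ n)%N%:R) * c) @ \oo --> c.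
  have one (a' : nat) : (fun n => (2 ^ n - a')%N%:R / (2 ^ n)%N%:R : R) @ \oo --> (1 : R).
    have geo : (fun n => 1 - geometric (a'%:R : R) 2^-1 n) @ \oo --> (1 - 0 : R).
      apply: cvgB; first exact: cvg_cst.
      by apply: cvg_geometric; rewrite ger0_norm// invf_lt1// ltr1n.
    rewrite subr0 in geo; apply: cvg_trans geo.
    apply: near_eq_cvg; exists a' => // n /= an.
    have h : (a' <= 2 ^ n)%N by apply: leq_trans an (ltnW (ltn_expl _ _)).
    rewrite natrB// mulrBl divff ?pnatr_eq0 -?lt0n ?expn_gt0//.
    by rewrite natrX exprVn.
  have h : (fun n => (2 ^ n - a)%N%:R / (2 ^ n)%N%:R *
     ((2 ^ n - b)%N%:R / (2 ^ n)%N%:R) * c) @ \oo --> 1 * 1 * c.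
    by apply: cvgM; [apply: cvgM; exact: one|exact: cvg_cst].
  rewrite !mul1r in h; apply: cvg_trans h; apply: near_eq_cvg; apply: nearW => n.
  by rewrite /= natrM invfM; congr (_ * _); rewrite mulrACA.
have uphi z :
    (fun n => \sum_(0 <= i < 4 ^ n.+1) u n i * complex.Re (character z (cellpt R n.+1 i))) @ \oo
      --> complex.Re (phi z) /\
    (fun n => \sum_(0 <= i < 4 ^ n.+1) u n i * complex.Im (character z (cellpt R n.+1 i))) @ \oo
      --> complex.Im (phi z).
  split.
  - apply: cvg_trans (lim (complex.Re (phi z)) `|z.1|%N `|z.2|%N); apply: near_eq_cvg.
    exists (`|z.1| + `|z.2|)%N => // n /= zn.
    have h := ltn_expl n (isT : (1 < 2)%N).
    have := sumE n z; rewrite !(leq_ltn_trans _ h) ?(leq_trans _ zn) ?leq_addr ?leq_addl//.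
    move=> /(_ isT isT) /(congr1 (@complex.Re R)).
    by rewrite Re_sum ReZ => <-; apply: eq_bigr => i _; rewrite ReZ.
  - apply: cvg_trans (lim (complex.Im (phi z)) `|z.1|%N `|z.2|%N); apply: near_eq_cvg.
    exists (`|z.1| + `|z.2|)%N => // n /= zn.
    have h := ltn_expl n (isT : (1 < 2)%N).
    have := sumE n z; rewrite !(leq_ltn_trans _ h) ?(leq_trans _ zn) ?leq_addr ?leq_addl//.
    move=> /(_ isT isT) /(congr1 (@complex.Im R)).
    by rewrite Im_sum ImZ => <-; apply: eq_bigr => i _; rewrite ImZ.
have [mu [mu0 muc mut muphi]] := tree_masses u0 u1 uphi.
have [sigma [storus sint]] := tree_measure mu0 muc mut.
exists sigma; split=> // z; have [m1 m2] := cmeasurable_character R z.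
apply: cplx_ext; rewrite /cintegral /=.
- apply: (sint (fun x => complex.Re (character z x)) (char_lip R z)) => //.
  + by move=> x; rewrite /character /= ler_norml cos_geN1 cos_le1.
  + by move=> x; rewrite character_frac2.
  + by move=> x y e h1 h2; have [] := character_lipschitz z h1 h2.
  + by move=> l; have [] := muphi l z.
- apply: (sint (fun x => complex.Im (character z x)) (char_lip R z)) => //.
  + by move=> x; rewrite /character /= ler_norml sin_geN1 sin_le1.
  + by move=> x; rewrite character_frac2.
  + by move=> x y e h1 h2; have [] := character_lipschitz z h1 h2.
  + by move=> l; have [] := muphi l z.
Qed.

End Bochner.

(** * Weak limits of multiplication operators *)

Section Convergence.
Context (R : realType).
Local Notation C := R[i].

Definition ccvg (u : nat -> C) (l : C) :=
  (fun n => complex.Re (u n)) @ \oo --> complex.Re l /\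
  (fun n => complex.Im (u n)) @ \oo --> complex.Im l.

Lemma ccvg_cst (l : C) : ccvg (fun=> l) l.
Proof. by split; exact: cvg_cst. Qed.

Lemma ccvgD u v a b : ccvg u a -> ccvg v b -> ccvg (fun n => u n + v n) (a + b).
Proof.
move=> [u1 u2] [v1 v2]; split.
  by rewrite ReD; under eq_fun do rewrite ReD; exact: cvgD.
by rewrite ImD; under eq_fun do rewrite ImD; exact: cvgD.
Qed.

Lemma ccvgM u v a b : ccvg u a -> ccvg v b -> ccvg (fun n => u n * v n) (a * b).
Proof.
move=> [u1 u2] [v1 v2]; split.
  by rewrite ReM; under eq_fun do rewrite ReM; apply: cvgB; exact: cvgM.
by rewrite ImM; under eq_fun do rewrite ImM; apply: cvgD; exact: cvgM.
Qed.

Lemma ccvgJ u a : ccvg u a -> ccvg (fun n => conjc (u n)) (conjc a).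
Proof.
move=> [u1 u2]; split; first by rewrite ReJ; under eq_fun do rewrite ReJ.
by rewrite ImJ; under eq_fun do rewrite ImJ; exact: cvgN.
Qed.

Lemma ccvg_uniq u a b : ccvg u a -> ccvg u b -> a = b.
Proof.
by move=> [u1 u2] [v1 v2]; apply: cplx_ext; [exact: cvg_unique u1 v1|exact: cvg_unique u2 v2].
Qed.

Lemma ccvg_sum (I : Type) (r : seq I) (u : I -> nat -> C) (a : I -> C) :
  (forall i, ccvg (u i) (a i)) -> ccvg (fun n => \sum_(i <- r) u i n) (\sum_(i <- r) a i).
Proof.
move=> ua; elim: r => [|i r ih].
  by rewrite big_nil; under eq_fun do rewrite big_nil; exact: ccvg_cst.
by rewrite big_cons; under eq_fun do rewrite big_cons; exact: ccvgD.
Qed.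

Lemma cvg_approx (u : nat -> R) l :
  (forall eps, 0 < eps -> exists2 v : nat -> R, cvgn v & exists2 m,
     v @ \oo --> m & `|l - m| <= eps /\ forall n, `|u n - v n| <= eps) ->
  u @ \oo --> l.
Proof.
move=> H; apply/cvgrPdist_le => e e0.
have [|v _ [m vm [lm uv]]] := H (e / 3); first by rewrite divr_gt0.
have e3 : 0 < e / 3 by rewrite divr_gt0.
move/cvgrPdist_le : vm => /(_ _ e3); apply: filterS => n vn.
rewrite (_ : l - u n = (l - m) + (m - v n) - (u n - v n)); last by ring.
apply: le_trans (ler_normB _ _) _; rewrite [leRHS](_ : e = e / 3 + e / 3 + e / 3); last by field.
by apply: lerD => //; apply: le_trans (ler_normD _ _) _; apply: lerD.
Qed.

Context d (T : measurableType d).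

Lemma clim_ccvg (u : nat -> T -> C) x l : ccvg (u ^~ x) l -> clim u x = l.
Proof.
move=> [u1 u2]; apply: cplx_ext; rewrite /clim /=; exact: cvg_ereal_fine_limsup.
Qed.

Lemma ccvg_at_clim (u : nat -> T -> C) x : ccvg_at (u ^~ x) -> ccvg (u ^~ x) (clim u x).
Proof. by move=> ux; split; [exact: clim_Re|exact: clim_Im]. Qed.

End Convergence.

Section WeakLimits.
Context (R : realType) d (T : measurableType d).
Local Notation C := R[i].
Variable mu : probability T R.

Lemma closed_span_ae (I : Type) (e : I -> T -> C) f f' : (forall i, L2 mu (e i)) ->
  cmeasurable f' -> {ae mu, forall x, f x = f' x} -> closed_span mu e f -> closed_span mu e f'.
Proof.
move=> Le mf' ff' /closed_spanP[Lf fP]; have Lf' := ae_eq_L2 mf' ff' Lf.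
apply/closed_spanP; split => // eps e0; have [s sP] := fP _ e0; exists s.
rewrite (ae_eq_l2n (g := fun x => f x - lincomb s e x))//.
- by apply: (L2_cmeasurable (mu := mu)); apply: L2B => //; exact: L2_lincomb.
- by apply: (L2_cmeasurable (mu := mu)); apply: L2B => //; exact: L2_lincomb.
- by apply: filterS ff' => x ->.
Qed.

Lemma nsq_inner0 f : L2 mu f -> inner mu f f = 0 -> {ae mu, forall x, f x = 0}.
Proof. by move=> Lf f0; apply: nsq0_ae => //; move: f0; rewrite inner_real => -[]. Qed.

(** Closed subspaces are weakly closed: the residual of the projection of [a] is orthogonal to the
    whole sequence, hence to its weak limit [a], and so it vanishes. *)
Lemma weak_limit_closed_span (I : Type) (e : I -> T -> C) (w : nat -> I) a :
  (forall i, L2 mu (e i)) -> L2 mu a ->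
  (forall f, L2 mu f -> ccvg (fun n => inner mu (e (w n)) f) (inner mu a f)) ->
  closed_span mu e a.
Proof.
move=> Le La wa; have [g cg gP] := projection Le La; have Lg := cg.1.
have Ld := L2B La Lg.
have eg i : inner mu (e i) (fun x => a x - g x) = 0.
  by rewrite (innerC Ld (Le i)) gP conjc0.
have ad : inner mu a (fun x => a x - g x) = 0.
  have := wa _ Ld; under eq_fun do rewrite eg; move=> h.
  by apply: ccvg_uniq h _; exact: ccvg_cst.
have gd : inner mu g (fun x => a x - g x) = 0 by exact: inner_closed_span0 cg Ld eg.
have d0 : {ae mu, forall x, a x - g x = 0}.
  by apply: nsq_inner0 => //; rewrite innerBl// ad gd subr0.
apply: (closed_span_ae Le (L2_cmeasurable La) _ cg).
by apply: filterS d0 => x /eqP; rewrite subr_eq0 => /eqP.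
Qed.

(** The uniform bound [B] carries the convergence of inner products from a total family to the
    closure of its span. *)
Lemma weak_cvg_total (I : Type) (f : I -> T -> C) (a : nat -> T -> C) b (B : R) :
  (forall i, L2 mu (f i)) -> total mu f ->
  (forall n, L2 mu (a n)) -> L2 mu b -> (forall n, l2n mu (a n) <= B) -> l2n mu b <= B ->
  (forall i, ccvg (fun n => inner mu (a n) (f i)) (inner mu b (f i))) ->
  forall h, L2 mu h -> ccvg (fun n => inner mu (a n) h) (inner mu b h).
Proof.
move=> Lf tf La Lb aB bB H h Lh.
have B0 : 0 <= B by apply: le_trans bB; exact: l2n_ge0.
have lin s : ccvg (fun n => inner mu (a n) (lincomb s f)) (inner mu b (lincomb s f)).
  have E g : L2 mu g -> inner mu g (lincomb s f) = \sum_(p <- s) conjc p.2 * inner mu g (f p.1).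
    move=> Lg; rewrite (innerC (L2_lincomb Lf s) Lg) (inner_lincombl Lf s Lg) rmorph_sum.
    by apply: eq_bigr => p _; rewrite (innerC (Lf p.1) Lg); exact: conjcM.
  rewrite E//; under eq_fun do rewrite (E _ (La _)).
  by apply: ccvg_sum => p; apply: ccvgM => //; exact: ccvg_cst.
have ap eps : 0 < eps -> exists s, l2n mu (fun x => h x - lincomb s f x) * B <= eps.
  move=> e0; have /closed_spanP[_ P] := total_closed_span Lf tf Lh.
  have B1 : 0 < B + 1 by lra.
  have [s sP] := P _ (divr_gt0 e0 B1); exists s.
  apply: (@le_trans _ _ (eps / (B + 1) * B)); first by rewrite ler_wpM2r// ltW.
  by rewrite mulrAC ler_pdivrMr// ler_wpM2l ?(ltW e0)// lerDl.
have Re_b s g : L2 mu g -> l2n mu g <= B -> 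
    `|complex.Re (inner mu g h) - complex.Re (inner mu g (lincomb s f))| <=
    l2n mu (fun x => h x - lincomb s f x) * B.
  move=> Lg gB; have Ls := L2_lincomb Lf s.
  rewrite -ReN -ReD -innerBr//; apply: le_trans (Re_inner_le Lg _) _; first exact: L2B.
  by rewrite mulrC ler_wpM2l// l2n_ge0.
have Im_b s g : L2 mu g -> l2n mu g <= B -> 
    `|complex.Im (inner mu g h) - complex.Im (inner mu g (lincomb s f))| <=
    l2n mu (fun x => h x - lincomb s f x) * B.
  move=> Lg gB; have Ls := L2_lincomb Lf s.
  rewrite -ImN -ImD -innerBr//; apply: le_trans (Im_inner_le Lg _) _; first exact: L2B.
  by rewrite mulrC ler_wpM2l// l2n_ge0.
split; apply: cvg_approx => eps e0; have [s sP] := ap _ e0; have [l1 l2] := lin s.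
- exists (fun n => complex.Re (inner mu (a n) (lincomb s f))); first by apply/cvg_ex; eexists; exact: l1.
  exists (complex.Re (inner mu b (lincomb s f))) => //.
  by split=> [|n]; apply: le_trans sP; exact: Re_b.
- exists (fun n => complex.Im (inner mu (a n) (lincomb s f))); first by apply/cvg_ex; eexists; exact: l2.
  exists (complex.Im (inner mu b (lincomb s f))) => //.
  by split=> [|n]; apply: le_trans sP; exact: Im_b.
Qed.

Lemma l2n_bounded_mul B c f : 0 <= B -> cmeasurable c -> (forall x, cabs2 (c x) <= B ^+ 2) -> L2 mu f ->
  l2n mu (fun x => c x * f x) <= B * l2n mu f.
Proof.
move=> B0 mc c1 Lf; have Lcf := L2_bounded_mul mc c1 Lf.
have lB : 0 <= B * l2n mu f by rewrite mulr_ge0// l2n_ge0.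
rewrite -(ler_pXn2r (n := 2)) ?nnegrE ?l2n_ge0// exprMn !sqr_l2n -lee_fin EFinM !nsqE_int//.
have mf : measurable_fun setT (fun x => (cabs2 (f x))%:E).
  by apply/measurable_EFinP/cmeasurable_cabs2/L2_cmeasurable; exact: Lf.
rewrite -ge0_integralZl//; last 2 first.
- by move=> x _; rewrite lee_fin cabs2_ge0.
- by rewrite lee_fin sqr_ge0.
apply: ge0_le_integral => //.
- by move=> x _; rewrite lee_fin cabs2_ge0.
- by apply/measurable_EFinP/cmeasurable_cabs2/L2_cmeasurable; exact: Lcf.
- exact: measurable_funeM.
- by move=> x _; rewrite cabs2M -EFinM lee_fin ler_wpM2r// cabs2_ge0.
Qed.

Lemma inner_mulJ c f g : inner mu (fun x => c x * f x) g = inner mu f (fun x => conjc (c x) * g x).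
Proof. by congr cintegral; apply/funext => x; rewrite conjcM conjcK mulrCA mulrA. Qed.

(** Totality is used twice: first in the right argument and then, after passing to the adjoint
    multiplication by the conjugate, in the left one. *)
Lemma weak_multiplier_total (I : Type) (f : I -> T -> C) (c : nat -> T -> C) q (B : R) : 0 <= B ->
  (forall i, L2 mu (f i)) -> total mu f ->
  (forall n, cmeasurable (c n)) -> (forall n x, cabs2 (c n x) <= B ^+ 2) ->
  cmeasurable q -> (forall x, cabs2 (q x) <= B ^+ 2) ->
  (forall i j, ccvg (fun n => inner mu (fun x => c n x * f i x) (f j))
                    (inner mu (fun x => q x * f i x) (f j))) ->
  forall g h, L2 mu g -> L2 mu h ->
    ccvg (fun n => inner mu (fun x => c n x * g x) h) (inner mu (fun x => q x * g x) h).
Proof.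
move=> B0 Lf tf mc c1 mq q1 H g h Lg Lh.
have Lcf n i : L2 mu (fun x => c n x * f i x) by exact: L2_bounded_mul (c1 n) _.
have Lqf i : L2 mu (fun x => q x * f i x) by exact: L2_bounded_mul q1 _.
have step i : ccvg (fun n => inner mu (fun x => c n x * f i x) h) (inner mu (fun x => q x * f i x) h).
  apply: (weak_cvg_total Lf tf _ _ (B := B * l2n mu (f i))) => //.
    by move=> n; exact: l2n_bounded_mul.
  exact: l2n_bounded_mul.
have mc' n : cmeasurable (fun x => conjc (c n x)) by exact: cmeasurableJ.
have mq' : cmeasurable (fun x => conjc (q x)) by exact: cmeasurableJ.
have c1' n x : cabs2 (conjc (c n x)) <= B ^+ 2 by rewrite cabs2J.
have q1' x : cabs2 (conjc (q x)) <= B ^+ 2 by rewrite cabs2J.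
have Lch n : L2 mu (fun x => conjc (c n x) * h x) by exact: L2_bounded_mul (c1' n) _.
have Lqh : L2 mu (fun x => conjc (q x) * h x) by exact: L2_bounded_mul q1' _.
have K : ccvg (fun n => inner mu (fun x => conjc (c n x) * h x) g)
              (inner mu (fun x => conjc (q x) * h x) g).
  apply: (weak_cvg_total Lf tf _ _ (B := B * l2n mu h)) => //.
  - by move=> n; exact: l2n_bounded_mul.
  - exact: l2n_bounded_mul.
  - move=> i; rewrite (innerC (Lf i) Lqh) -inner_mulJ.
    under eq_fun do rewrite (innerC (Lf i) (Lch _)) -inner_mulJ.
    exact: ccvgJ.
rewrite inner_mulJ (innerC Lqh Lg); under eq_fun do rewrite inner_mulJ (innerC (Lch _) Lg).
exact: ccvgJ.
Qed.

Variable s : T -> (R * R)%type.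
Hypothesis ms : measurable_fun setT s.

Lemma L2_character z g : L2 mu g -> L2 mu (fun x => character z (s x) * g x).
Proof.
move=> Lg; apply: (L2_bounded_mul (c := 1)) => //; first exact: cmeasurable_character_comp.
by move=> x; rewrite cabs2_character.
Qed.

(** The approximating combinations are trigonometric polynomials of [s x] times [g x], chosen so
    that they converge almost everywhere. Where [g] is nonzero it can be divided out, so the
    polynomials themselves converge there. *)
Theorem cyclic_span_function g f : L2 mu g ->
  closed_span mu (fun z x => character z (s x) * g x) f ->
  exists2 psi : R * R -> C, cmeasurable psi & {ae mu, forall x, f x = psi (s x) * g x}.
Proof.
move=> Lg cf; have Le z := L2_character z Lg.
have Lf := cf.1; have [S [S1 S2]] := closed_span_fast Le cf.
pose u n := lincomb (S n) (fun z x => character z (s x) * g x).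
pose c n (y : R * R) : C := \sum_(p <- S n) p.2 * character p.1 y.
have uc n x : u n x = c n (s x) * g x.
  by rewrite /u /lincomb /c mulr_suml; apply: eq_bigr => p _; rewrite mulrA.
have Lu n : L2 mu (u n) by exact: L2_lincomb.
have [Ll ll] := fast_cauchy_L2 Lu S2.
have fl : {ae mu, forall x, f x - clim u x = 0}.
  apply: l2n0_ae; first exact: L2B.
  apply/eqP; rewrite eq_le l2n_ge0 andbT; apply/ler_addgt0Pl => eps e0; rewrite addr0.
  have [n nP] : exists n, 3 * 4 ^- n <= eps.
    have h : (fun n => geometric (3 : R) 4^-1 n) @ \oo --> (0 : R).
      by apply: cvg_geometric; rewrite ger0_norm// invf_lt1// ltr1n.
    move/cvgrPdist_le : h => /(_ _ e0)[N _ /(_ N (leqnn N))]; rewrite sub0r normrN => h.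
    by exists N; rewrite -exprVn; apply: le_trans h; exact: ler_norm.
  apply: le_trans nP; apply: le_trans (l2n_triangle Lf (Lu n) Ll) _.
  rewrite [3](_ : _ = 1 + 2); last by ring.
  rewrite mulrDl; apply: lerD; last exact: ll.
  apply: le_trans (S1 n) _.
  by rewrite ler_wpM2r ?invr_ge0 ?exprn_ge0//; lra.
(* Being defined at every [y], the function is measurable whether or not the polynomials converge at
   [y]. *)
exists (clim c).
  apply: cmeasurable_clim => n; rewrite /c.
  elim: (S n) => [|p r ih]; first by under eq_fun do rewrite big_nil; exact: cmeasurable_cst.
  under eq_fun do rewrite big_cons; apply: cmeasurableD => //.
  by apply: cmeasurableM; [exact: cmeasurable_cst|exact: cmeasurable_character].
have ca := fast_cauchy_ae Lu S2.
apply: filterS2 fl ca => x /eqP; rewrite subr_eq0 => /eqP -> /ccvg_at_clim ux.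
have [g0|g0] := eqVneq (g x) 0.
  rewrite g0 mulr0; apply: ccvg_uniq ux _.
  by under eq_fun do rewrite uc g0 mulr0; exact: ccvg_cst.
have cx : ccvg (c ^~ (s x)) (clim u x / g x).
  have := ccvgM ux (ccvg_cst (g x)^-1).
  by under eq_fun do rewrite uc mulfK//.
by rewrite (clim_ccvg cx) divfK.
Qed.

(** The case [g = 1]: a weak limit of characters of [s] lies in the cyclic space of the constant
    function, so it is a function of [s]. *)
Theorem weak_limit_function (w : nat -> int * int) q : L2 mu q ->
  (forall h, L2 mu h ->
     ccvg (fun n => inner mu (fun x => character (w n) (s x) * 1) h) (inner mu q h)) ->
  exists2 psi : R * R -> C, cmeasurable psi & {ae mu, forall x, q x = psi (s x)}.
Proof.
move=> Lq H; have L1 : L2 mu (fun=> 1 : C) by exact: L2_cst.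
have [psi mpsi qpsi] := cyclic_span_function L1
  (weak_limit_closed_span (w := w) (fun z => L2_character z L1) Lq H).
by exists psi => //; apply: filterS qpsi => x; rewrite mulr1.
Qed.

End WeakLimits.

(** * Products and Koopman operators *)

Section Fubini.
Context (R : realType) d (T : measurableType d) d' (S : measurableType d').
Local Notation C := R[i].
Variables (mu : probability T R) (nu : probability S R).
Local Notation prodP := ((mu \x nu)%E : probability (T * S)%type R).

Lemma measurable_slice d'' (Z : measurableType d'') (f : T * S -> Z) y :
  measurable_fun setT f -> measurable_fun setT (fun x => f (x, y)).
Proof. by move=> mf; apply: (measurableT_comp mf); exact: measurable_pair2. Qed.

Lemma cmeasurable_slice (f : T * S -> C) y : cmeasurable f -> cmeasurable (fun x => f (x, y)).
Proof. by move=> [f1 f2]; split; [exact: measurable_slice f1|exact: measurable_slice f2]. Qed.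

Lemma Rintegral_fubini (f : T * S -> R) :
  prodP.-integrable setT (EFin \o f) ->
  nu.-integrable setT (EFin \o (fun y => \int[mu]_x f (x, y))) /\
  \int[nu]_y \int[mu]_x f (x, y) = \int[prodP]_p f p.
Proof.
move=> fi; have mG := measurable_fubini_G fi.
have ae_fin : {ae nu, forall y, fubini_G mu (EFin \o f) y \is a fin_num}.
  by apply: filterS (ae_integrable2 fi) => y /(integrable_fin_num measurableT).
have mfG : measurable_fun setT (EFin \o (fun y => \int[mu]_x f (x, y))).
  by apply/measurable_EFinP; exact: (measurableT_comp (fine_measurable measurableT) mG).
have E : ae_eq nu setT (EFin \o (fun y => \int[mu]_x f (x, y))) (fubini_G mu (EFin \o f)).
  by apply: filterS ae_fin => y yf _; rewrite /= fineK.
split; last first.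
  congr fine; rewrite -integral21_prod_meas1//.
  exact: ae_eq_integral.
apply/integrableP; split => //.
have /integrableP[mf fi'] := fi.
have fi2 := (integrable21ltyP _ _ mf).1 fi; apply: le_lt_trans fi2.
apply: ae_ge0_le_integral => //.
- exact: measurableT_comp.
- by move=> y _; exact: integral_ge0.
- apply: (measurable_fun_fubini_tonelli_G (m1 := mu) (abse \o (EFin \o f))) => //.
    exact: measurableT_comp.
  by move=> p; exact: abse_ge0.
- apply: filterS2 E (ae_integrable2 fi) => y -> // iy _.
  by apply: le_abse_integral => //; exact: measurable_int iy.
Qed.

Lemma cintegral_fubini (f : T * S -> C) : cintegrable prodP f ->
  cintegrable nu (fun y => cintegral mu (fun x => f (x, y))) /\
  cintegral nu (fun y => cintegral mu (fun x => f (x, y))) = cintegral prodP f.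
Proof.
move=> [/Rintegral_fubini[i1 e1] /Rintegral_fubini[i2 e2]]; split; first by split.
by apply: cplx_ext.
Qed.

Definition tens (f : T -> C) (g : S -> C) : T * S -> C := fun p => f p.1 * g p.2.

Lemma cmeasurable_fst (f : T -> C) : cmeasurable f -> @cmeasurable R _ (T * S)%type (fun p => f p.1).
Proof. by move=> [f1 f2]; split; [exact: (measurableT_comp f1 measurable_fst)|exact: (measurableT_comp f2 measurable_fst)]. Qed.

Lemma cmeasurable_snd (f : S -> C) : cmeasurable f -> @cmeasurable R _ (T * S)%type (fun p => f p.2).
Proof. by move=> [f1 f2]; split; [exact: (measurableT_comp f1 measurable_snd)|exact: (measurableT_comp f2 measurable_snd)]. Qed.

Lemma L2_tens f g : L2 mu f -> L2 nu g -> L2 prodP (tens f g).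
Proof.
move=> /L2P[mf fi] /L2P[mg gi]; apply/L2P; split.
  by apply: cmeasurableM; [exact: cmeasurable_fst|exact: cmeasurable_snd].
have mfg : measurable_fun setT (fun p : T * S => cabs2 (tens f g p)).
  by apply: cmeasurable_cabs2; apply: cmeasurableM; [exact: cmeasurable_fst|exact: cmeasurable_snd].
apply/integrableP; split; first exact/measurable_EFinP.
rewrite (eq_integral (fun p => (cabs2 (tens f g p))%:E)); last first.
  by move=> p _; rewrite gee0_abs// lee_fin cabs2_ge0.
rewrite (fubini_tonelli2 (m1 := mu) (m2 := nu) (fun p => (cabs2 (tens f g p))%:E)); last 2 first.
- exact/measurable_EFinP.
- by move=> p; rewrite lee_fin cabs2_ge0.
rewrite (eq_integral (fun y => (cabs2 (g y))%:E * \int[mu]_x (cabs2 (f x))%:E)%E); last first.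
  move=> y _; rewrite /fubini_G -(integralZl measurableT)//.
  by apply: eq_integral => x _; rewrite cabs2M mulrC EFinM.
have Kf : (\int[mu]_x (cabs2 (f x))%:E \is a fin_num)%E by exact: (integrable_fin_num _ fi).
rewrite -(fineK Kf) (integralZr measurableT)//.
have Kg : (\int[nu]_x (cabs2 (g x))%:E \is a fin_num)%E by exact: (integrable_fin_num _ gi).
by rewrite -(fineK Kg) -EFinM ltry.
Qed.

Lemma inner_tens f g f' g' : L2 mu f -> L2 nu g -> L2 mu f' -> L2 nu g' ->
  inner prodP (tens f g) (tens f' g') = inner mu f f' * inner nu g g'.
Proof.
move=> Lf Lg Lf' Lg'.
rewrite /inner -(cintegral_fubini (inner_cintegrable (L2_tens Lf Lg) (L2_tens Lf' Lg'))).2.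
rewrite -cintegralZ; last exact: inner_cintegrable.
apply: eq_cintegral => y; rewrite mulrC -cintegralZ; last exact: inner_cintegrable.
by apply: eq_cintegral => x; rewrite /tens conjcM; ring.
Qed.

(** The factor 2 comes from adding the bounds for the real and the imaginary part; it is harmless
    where only integrability is at stake. *)
Lemma cabs2_inner_le f g : L2 mu f -> L2 mu g ->
  cabs2 (inner mu f g) <= 2 * nsq mu g * nsq mu f.
Proof.
move=> Lf Lg; have h1 := cauchy_schwarz_Re Lf Lg.
have h2 : complex.Im (inner mu f g) ^+ 2 <= nsq mu f * nsq mu g.
  rewrite -!sqr_l2n -exprMn -real_normK ?num_real// ler_pXn2r ?nnegrE ?mulr_ge0 ?l2n_ge0//.
  exact: Im_inner_le.
rewrite /cabs2; lra.
Qed.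

Lemma ae_slice_L2 F : L2 prodP F -> {ae nu, forall y, L2 mu (fun x => F (x, y))}.
Proof.
move=> /L2P[mF iF]; have := ae_integrable2 iF; apply: filterS => y iy; apply/L2P; split => //.
exact: cmeasurable_slice.
Qed.

Lemma L2_partial_inner F e : L2 prodP F -> L2 mu e ->
  L2 nu (fun y => inner mu (fun x => F (x, y)) e).
Proof.
move=> LF Le; have L1 : L2 nu (fun=> 1 : C) by exact: L2_cst.
have ci := inner_cintegrable LF (L2_tens Le L1).
have [+ _] := cintegral_fubini ci.
rewrite (_ : (fun y => cintegral mu _) = (fun y => inner mu (fun x => F (x, y)) e)); last first.
  by apply/funext => y; apply: eq_cintegral => x; rewrite /tens mulr1.
move=> /cintegrable_cmeasurable mG; apply/L2P; split => //.
have [mF iF] := (L2P _ _).1 LF.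
have /integrableP[mF2 F2] := iF; have {}F2 := (integrable21ltyP mu nu mF2).1 iF.
have mc := cmeasurable_cabs2 mG.
apply/integrableP; split; first exact/measurable_EFinP.
have Kfin : (0 <= 2 * nsq mu e) by rewrite mulr_ge0// nsq_ge0.
have mH : measurable_fun setT (fun y => \int[mu]_x `|(cabs2 (F (x, y)))%:E|)%E.
  apply: (measurable_fun_fubini_tonelli_G (m1 := mu) (abse \o (EFin \o (fun p => cabs2 (F p))))) => //.
    exact: measurableT_comp.
  by move=> p; exact: abse_ge0.
apply: (@le_lt_trans _ _ (\int[nu]_y ((2 * nsq mu e)%:E * \int[mu]_x `|(cabs2 (F (x, y)))%:E|)))%E.
  apply: ae_ge0_le_integral => //.
  - by apply: measurableT_comp => //; exact/measurable_EFinP.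
  - by move=> y _; rewrite mule_ge0 ?lee_fin//; exact: integral_ge0.
  - exact: measurable_funeM.
  - apply: filterS (ae_slice_L2 LF) => y Ly _.
    rewrite [leLHS]gee0_abs ?lee_fin ?cabs2_ge0//.
    under eq_integral do rewrite gee0_abs ?lee_fin ?cabs2_ge0//.
    by rewrite -nsqE_int// -EFinM lee_fin; exact: cabs2_inner_le.
rewrite ge0_integralZl//; last by move=> y _; exact: integral_ge0.
by apply: lte_mul_pinfty => //; rewrite ?lee_fin.
Qed.

Lemma partial_inner_tens F e e' : L2 prodP F -> L2 mu e -> L2 nu e' ->
  inner nu (fun y => inner mu (fun x => F (x, y)) e) e' = inner prodP F (tens e e').
Proof.
move=> LF Le Le'; rewrite /inner -(cintegral_fubini (inner_cintegrable LF (L2_tens Le Le'))).2.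
have := ae_slice_L2 LF => sl.
have LP := L2_partial_inner LF Le.
apply: ae_eq_cintegral.
- apply: cmeasurableM; first exact: (L2_cmeasurable LP).
  by apply: cmeasurableJ; exact: (L2_cmeasurable Le').
- by have [/cintegrable_cmeasurable + _] := cintegral_fubini (inner_cintegrable LF (L2_tens Le Le')).
- apply: filterS sl => y Ly; rewrite mulrC -cintegralZ; last exact: inner_cintegrable.
  by apply: eq_cintegral => x; rewrite /tens conjcM /=; ring.
Qed.

Lemma ae_forall_count (I : countType) (P : I -> S -> Prop) :
  (forall i, {ae nu, forall y, P i y}) -> {ae nu, forall y, forall i, P i y}.
Proof.
move=> H; have : {ae nu, forall y, forall n, forall i, unpickle n = Some i -> P i y}.
  apply: ae_foralln => n; case: (unpickle n) => [i|]; last by apply: aeW.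
  by apply: filterS (H i) => y Py _ [<-].
by apply: filterS => y Py i; apply: (Py (pickle i)); rewrite pickleK.
Qed.

(** If [F] is orthogonal to all tensors, its partial inner products with each [e i] vanish for
    almost every [y]. Countability of [I] makes the exceptional set common to all [i], so almost
    every slice vanishes, and Tonelli's theorem concludes. *)
Lemma total_tens (I : countType) (J : Type) (e : I -> T -> C) (e' : J -> S -> C) :
  (forall i, L2 mu (e i)) -> (forall j, L2 nu (e' j)) -> total mu e -> total nu e' ->
  total prodP (fun ij : I * J => tens (e ij.1) (e' ij.2)).
Proof.
move=> Le Le' te te' F LF F0.
have : {ae nu, forall y, forall i, inner mu (fun x => F (x, y)) (e i) = 0}.
  apply: ae_forall_count => i; apply: te'; first exact: L2_partial_inner.
  by move=> j; rewrite partial_inner_tens//; exact: (F0 (i, j)).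
move=> G0; have H0 : {ae nu, forall y, \int[mu]_x (cabs2 (F (x, y)))%:E = 0}%E.
  apply: filterS2 G0 (ae_slice_L2 LF) => y y0 Ly.
  have z : {ae mu, forall x, F (x, y) = 0} by exact: te.
  have E : nsq mu (fun x => F (x, y)) = nsq mu (fun=> 0).
    by apply: ae_eq_nsq => //; exact: L2_cmeasurable Ly.
  rewrite -nsqE_int// E nsqE (_ : (fun x => _) = fun=> 0) ?Rintegral_cst ?mul0r//.
  by apply/funext => x; rewrite /cabs2 /= expr0n addr0.
apply: nsq0_ae => //; apply/eqP; rewrite -eqe (nsqE_int LF).
have [mF iF] := (L2P _ _).1 LF.
have mF2 : measurable_fun setT (fun p => (cabs2 (F p))%:E) by apply/measurable_EFinP/cmeasurable_cabs2.
rewrite fubini_tonelli2//; last by move=> p; rewrite lee_fin cabs2_ge0.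
rewrite (ae_eq_integral (cst 0%E))//.
- by rewrite integral_cst// mul0e.
- by apply: measurable_fun_fubini_tonelli_G => // p; rewrite lee_fin cabs2_ge0.
- by apply: filterS H0 => y + _.
Qed.

End Fubini.

Section AlmostEverywhere.
Context (R : realType) d (T : measurableType d).

Lemma measurable_iter (f : T -> T) n : measurable_fun setT f -> measurable_fun setT (iter n f).
Proof. by move=> mf; elim: n => [|n ih]; [exact: measurable_id|exact: (measurableT_comp mf ih)]. Qed.

Variable mu : probability T R.

Lemma ae_eq_measure (A B : set T) : measurable A -> measurable B ->
  {ae mu, forall x, A x <-> B x} -> mu A = mu B.
Proof.
have half (A' B' : set T) : measurable A' -> measurable B' ->
    {ae mu, forall x, A' x <-> B' x} -> (mu A' <= mu B')%E.
  move=> mA mB [N [mN N0 AB]]; rewrite -(measureU0 mB mN N0).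
  apply: le_measure; rewrite ?inE//; first exact: measurableU.
  by move=> x Ax; have [Bx|Bx] := pselect (B' x); [left|right; apply: AB => /= -[/(_ Ax)]].
move=> mA mB AB; apply/eqP; rewrite eq_le half//= half//.
by apply: filterS AB => x [].
Qed.

End AlmostEverywhere.

(** * Measure-preserving maps *)

Section MeasurePreserving.
Context (R : realType) d (T : measurableType d) d' (S : measurableType d').
Local Notation C := R[i].
Variables (mu : probability T R) (nu : probability S R) (h : T -> S).
Hypothesis mh : measurable_fun setT h.
Hypothesis mp : forall A, measurable A -> mu (h @^-1` A) = nu A.

Lemma ae_comp (P : S -> Prop) : {ae nu, forall y, P y} -> {ae mu, forall x, P (h x)}.
Proof.
move=> [A [mA A0 PA]]; exists (h @^-1` A); split.
- by rewrite -[X in measurable X]setTI; exact: mh.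
- by rewrite mp.
- by move=> x /= Px; apply: PA.
Qed.

Lemma integral_mp (f : S -> R) : nu.-integrable setT (EFin \o f) ->
  mu.-integrable setT (EFin \o (f \o h)) /\ \int[mu]_x f (h x) = \int[nu]_y f y.
Proof.
move=> fi; have mf := measurable_int _ fi.
have E g : measurable_fun setT g -> (forall y, 0 <= g y)%E ->
    (\int[mu]_x g (h x) = \int[nu]_y g y)%E.
  move=> mg g0; rewrite -(ge0_integral_pushforward mh mu measurableT mg)//.
  by apply: eq_measure_integral => A mA _; exact: mp.
have fhi : mu.-integrable setT (EFin \o (f \o h)).
  have /integrableP[_ fi'] := fi; apply/integrableP; split.
    exact: (measurableT_comp mf mh).
  rewrite (_ : (\int[mu]_x _)%E = \int[mu]_x (abse \o (EFin \o f)) (h x))%E// E//.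
    exact: measurableT_comp.
  by move=> y; exact: abse_ge0.
split=> //; congr fine.
rewrite -(integral_pushforward mh mf (mu := mu) (D := setT))//.
by apply: eq_measure_integral => A mA _; exact: mp.
Qed.

Lemma cintegral_mp (f : S -> C) : cintegrable nu f ->
  cintegrable mu (fun x => f (h x)) /\ cintegral mu (fun x => f (h x)) = cintegral nu f.
Proof.
by move=> [/integral_mp[i1 e1] /integral_mp[i2 e2]]; split; [split|apply: cplx_ext].
Qed.

Lemma L2_mp (f : S -> C) : L2 nu f -> L2 mu (fun x => f (h x)).
Proof.
move=> /L2P[mf fi]; apply/L2P; split; first exact: (cmeasurable_comp mf mh).
exact: (integral_mp fi).1.
Qed.

Lemma inner_mp (f g : S -> C) : L2 nu f -> L2 nu g ->
  inner mu (fun x => f (h x)) (fun x => g (h x)) = inner nu f g.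
Proof. by move=> Lf Lg; apply: (cintegral_mp (inner_cintegrable Lf Lg)).2. Qed.

End MeasurePreserving.

Section Projections.
Context (R : realType) d (T : measurableType d) d' (S : measurableType d').
Variables (mu : probability T R) (nu : probability S R).
Local Notation prodP := ((mu \x nu)%E : probability (T * S)%type R).

Lemma mp_fst A : measurable A -> prodP (fst @^-1` A) = mu A.
Proof.
by move=> mA; rewrite -setXT -[RHS]mule1 -(@probability_setT _ _ _ nu) -product_measure1E.
Qed.

Lemma mp_snd A : measurable A -> prodP (snd @^-1` A) = nu A.
Proof.
by move=> mA; rewrite -setTX -[RHS]mul1e -(@probability_setT _ _ _ mu) -product_measure1E.
Qed.

Lemma ae_fst (P : T -> Prop) : {ae mu, forall x, P x} -> {ae prodP, forall p, P p.1}.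
Proof. by apply: ae_comp => //; exact: mp_fst. Qed.

Lemma ae_snd (P : S -> Prop) : {ae nu, forall x, P x} -> {ae prodP, forall p, P p.2}.
Proof. by apply: ae_comp => //; exact: mp_snd. Qed.

Context d1 (T1 : measurableType d1) d2 (S1 : measurableType d2).
Variables (mu1 : probability T1 R) (nu1 : probability S1 R) (f : T -> T1) (g : S -> S1).
Hypotheses (mf : measurable_fun setT f) (mg : measurable_fun setT g).
Hypothesis fp : forall A, measurable A -> mu (f @^-1` A) = mu1 A.
Hypothesis gp : forall A, measurable A -> nu (g @^-1` A) = nu1 A.

Lemma measurable_prod_map : measurable_fun setT (fun p : T * S => (f p.1, g p.2)).
Proof.
by apply: measurable_fun_pair;
  [exact: (measurableT_comp mf measurable_fst)|exact: (measurableT_comp mg measurable_snd)].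
Qed.

(** By uniqueness of the product measure: the image measure takes the right values on rectangles. *)
Lemma mp_prod_map A : measurable A ->
  prodP ((fun p => (f p.1, g p.2)) @^-1` A) = (mu1 \x nu1)%E A.
Proof.
move=> mA; apply: esym; rewrite -[RHS]/(pushforward (mu \x nu)%E (fun p => (f p.1, g p.2)) A).
have mpm := measurable_prod_map.
apply: (product_measure_unique (m' := measure_function_pushforward__canonical__measure_function_Measure (mu \x nu)%E mpm)) => // B D mB mD.
have -> : measure_function_pushforward__canonical__measure_function_Measure (mu \x nu)%E mpm (B `*` D) =
    (mu \x nu)%E ((f @^-1` B) `*` (g @^-1` D)) by [].
have mfB : measurable (f @^-1` B) by rewrite -[X in measurable X]setTI; exact: mf.
have mgD : measurable (g @^-1` D) by rewrite -[X in measurable X]setTI; exact: mg.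
by transitivity (mu (f @^-1` B) * nu (g @^-1` D))%E; [exact: product_measure1E|congr (_ * _)%E; [exact: fp|exact: gp]].
Qed.

End Projections.

(** * Koopman operators and ergodicity *)

Section Koopman.
Context (R : realType).
Local Notation C := R[i].

Section System.
Variable X : Z2system R.
Hypothesis hX : is_action X.
Local Notation mu := (sys_prob X).

Lemma measurable_act z : measurable_fun setT (@sys_act R X z). Proof. by case: hX. Qed.

Lemma mp_act z A : measurable A -> mu (sys_act z @^-1` A) = mu A.
Proof. by case: hX => _ + _ _; exact. Qed.

Lemma ae_act z (P : X -> Prop) : {ae mu, forall x : X, P x} -> {ae mu, forall x : X, P (sys_act z x)}.
Proof. by apply: ae_comp; [exact: measurable_act|exact: mp_act]. Qed.

Lemma L2_koopman z f : L2 mu f -> L2 mu (koopman X z f).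
Proof. by apply: L2_mp; [exact: measurable_act|exact: mp_act]. Qed.

Lemma inner_koopman z f g : L2 mu f -> L2 mu g ->
  inner mu (koopman X z f) (koopman X z g) = inner mu f g.
Proof. by apply: inner_mp; [exact: measurable_act|exact: mp_act]. Qed.

Lemma koopmanK z f : {ae mu, forall x : X, koopman X z (koopman X (- z) f) x = f x}.
Proof.
case: hX => _ _ h1 h2; apply: filterS2 (h1 (- z) z) h2 => x xz x0.
by rewrite /koopman xz addNr x0.
Qed.

Lemma koopman_comp z w f : {ae mu, forall x : X, koopman X z (koopman X w f) x = koopman X (w + z) f x}.
Proof. by case: hX => _ _ h1 _; apply: filterS (h1 w z) => x xz; rewrite /koopman xz. Qed.

Lemma koopman_adjoint z f g : L2 mu f -> L2 mu g ->
  inner mu (koopman X z f) g = inner mu f (koopman X (- z) g).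
Proof.
move=> Lf Lg; have Lz := L2_koopman (- z) Lg; rewrite -(inner_koopman z Lf Lz).
apply: ae_eq_inner.
- exact: L2_cmeasurable (L2_koopman z Lf).
- exact: L2_cmeasurable (L2_koopman z Lf).
- exact: L2_cmeasurable Lg.
- exact: L2_cmeasurable (L2_koopman z Lz).
- exact: aeW.
- by apply: filterS (koopmanK z g) => x ->.
Qed.

(** Ergodicity speaks of strictly invariant sets, whereas sets obtained from functions are invariant
    only almost everywhere; such a set is first replaced by a strictly invariant one. *)
Lemma zero_one_invariant z : totally_ergodic X -> z != 0 ->
  forall A : set X, measurable A -> {ae mu, forall x, A (sys_act z x) <-> A x} ->
  mu A = 0%E \/ mu A = 1%E.
Proof.
move=> eX z0 A mA Ainv.
(* The points whose forward orbit eventually stays in [A]: strictly invariant, and almost everywhere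
   equal to [A]. *)
pose B := \bigcup_N \bigcap_(n in [set n | (N <= n)%N]) (iter n (@sys_act R X z) @^-1` A).
have mi n : measurable (iter n (@sys_act R X z) @^-1` A).
  rewrite -[X in measurable X]setTI.
  exact: (measurable_iter n (measurable_act z)).
have mB : measurable B by apply: bigcup_measurable => N _; apply: bigcap_measurableType => n _; exact: mi.
have Binv : sys_act z @^-1` B = B.
  apply/seteqP; split=> x [N _ xN].
    exists N.+1 => // -[//|n] /= Nn; have := xN n Nn.
    by rewrite /preimage /= -iterSr.
  by exists N => // n /= Nn; have := xN n.+1 (leqW Nn); rewrite /preimage /= -iterS iterSr.
have AB : {ae mu, forall x, A x <-> B x}.
  have : {ae mu, forall x : X, forall n, A (sys_act z (iter n (sys_act z) x)) <-> A (iter n (sys_act z) x)}.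
    apply: ae_foralln; elim => [|n ih] //.
    by apply: filterS (ae_act z ih) => x; rewrite -!iterSr.
  apply: filterS => x Hx.
  have {}Hx n : A (iter n (sys_act z) x) <-> A x.
    by elim: n => [//|n ih] /=; rewrite Hx.
  split=> [Ax|[N _ /(_ N (leqnn N))]]; last by move/Hx.
  by exists 0%N => // n _; apply/Hx.
by rewrite (ae_eq_measure mA mB AB); exact: (eX z z0 B mB Binv).
Qed.

(** The set where [f] exceeds its mean has measure 0 or 1. Measure 1 is impossible, because a
    function of integral 0 is not positive almost everywhere; the same holds for the set where [f]
    is below its mean. *)
Lemma ergodic_constant z (f : X -> R) : totally_ergodic X -> z != 0 ->
  mu.-integrable setT (EFin \o f) -> {ae mu, forall x : X, f (sys_act z x) = f x} ->
  {ae mu, forall x, f x = \int[mu]_y f y}.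
Proof.
move=> eX z0 fi finv; set m := \int[mu]_y f y.
have mf : measurable_fun setT f by apply/measurable_EFinP; exact: measurable_int fi.
have fini : (\int[mu]_x (f x)%:E)%E = m%:E by rewrite fineK//; exact: integrable_fin_num fi.
have side (g : X -> R) : mu.-integrable setT (EFin \o g) -> {ae mu, forall x : X, g (sys_act z x) = g x} ->
    \int[mu]_x g x = 0 -> mu [set x | 0 < g x] = 0%E.
  move=> gi ginv g0; have mg : measurable_fun setT g by apply/measurable_EFinP; exact: measurable_int gi.
  have mP : measurable [set x | 0 < g x].
    rewrite (_ : [set x | _] = g @^-1` `]0, +oo[); last by apply/seteqP; split=> x /=; rewrite in_itv/= andbT.
    by rewrite -[X in measurable X]setTI; exact: mg.
  have Pinv : {ae mu, forall x : X, 0 < g (sys_act z x) <-> 0 < g x}.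
    by apply: filterS ginv => x ->.
  have [//|P1] := zero_one_invariant eX z0 mP Pinv.
  have pos : {ae mu, forall x, 0 < g x}.
    exists (~` [set x | 0 < g x]); split => //; first exact: measurableC.
    by rewrite probability_setC// P1 subee.
  have ge : {ae mu, forall x, g x = `|g x|} by apply: filterS pos => x gx; rewrite gtr0_norm.
  have : {ae mu, forall x, setT x -> (g x)%:E = 0%E}.
    apply/(ae_eq_integral_abs mu measurableT (measurable_int _ gi)).
    have -> : (\int[mu]_x `|(EFin \o g) x| = \int[mu]_x (g x)%:E)%E.
      apply: ae_eq_integral => //.
      - by apply: measurableT_comp => //; exact: measurable_int gi.
      - exact: measurable_int gi.
      - by apply: filterS ge => x e _; rewrite [in RHS]e.
    have h := integrable_fin_num measurableT gi.
    by rewrite -(fineK h) [fine _]g0.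
  move=> gz; have : {ae mu, forall x : X, False}.
    by apply: filterS2 gz pos => x /(_ I)[->]; rewrite ltxx.
  move=> [N [mN N0 TN]]; have : mu setT = 0%E.
    by apply: subset_measure0 N0 => // x _; apply: TN.
  by rewrite probability_setT => /eqP; rewrite onee_eq0.
have ci : mu.-integrable setT (EFin \o (fun=> m)) by exact: finite_measure_integrable_cst.
have Im : \int[mu]_x m = m.
  by transitivity (m * fine (mu setT)); [exact: Rintegral_cst|rewrite probability_setT mulr1].
have I1 : \int[mu]_x (f x - m) = 0 by rewrite RintegralB// Im subrr.
have I2 : \int[mu]_x (m - f x) = 0 by rewrite RintegralB// Im subrr.
have h1 := side (fun x => f x - m) (integrableBr fi ci).
have h2 := side (fun x => m - f x) (integrableBr ci fi).
have mgt (g : X -> R) : measurable_fun setT g -> measurable [set x | 0 < g x].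
  move=> mg; rewrite (_ : [set x | _] = g @^-1` `]0, +oo[); last by apply/seteqP; split=> x /=; rewrite in_itv/= andbT.
  by rewrite -[X in measurable X]setTI; exact: mg.
have n1 : mu.-negligible [set x | 0 < f x - m].
  apply/negligibleP; first by apply: mgt; apply: measurable_funB => //; exact: measurable_cst.
  by apply: h1 => //; apply: filterS finv => x ->.
have n2 : mu.-negligible [set x | 0 < m - f x].
  apply/negligibleP; first by apply: mgt; apply: measurable_funB => //; exact: measurable_cst.
  by apply: h2 => //; apply: filterS finv => x ->.
apply: negligibleS (negligibleU n1 n2) => x /= fx.
by have [h|h|//] := ltgtP (f x) m; [right|left]; rewrite subr_gt0.
Qed.

Lemma ergodic_constant_complex z (f : X -> C) : totally_ergodic X -> z != 0 -> cintegrable mu f ->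
  {ae mu, forall x : X, koopman X z f x = f x} -> {ae mu, forall x, f x = cintegral mu f}.
Proof.
move=> eX z0 [f1 f2] finv.
have iRe : {ae mu, forall x : X, complex.Re (f (sys_act z x)) = complex.Re (f x)}.
  by apply: filterS finv => x e; exact: (congr1 _ e).
have h1 := ergodic_constant eX z0 f1 iRe.
have iIm : {ae mu, forall x : X, complex.Im (f (sys_act z x)) = complex.Im (f x)}.
  by apply: filterS finv => x e; exact: (congr1 _ e).
have h2 := ergodic_constant eX z0 f2 iIm.
by apply: filterS2 h1 h2 => x e1 e2; apply: cplx_ext.
Qed.

End System.

Lemma is_action_prod2 (X Y : Z2system R) : is_action X -> is_action Y -> is_action (sys_prod2 X Y).
Proof.
move=> hX hY; have [_ _ X1 X2] := hX; have [_ _ Y1 Y2] := hY; split.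
- by move=> z; exact: (measurable_prod_map (measurable_act hX z) (measurable_act hY z)).
- move=> z A mA.
  exact: (mp_prod_map (measurable_act hX z) (measurable_act hY z) (mp_act hX z) (mp_act hY z)).
- move=> z w; apply: filterS2 (ae_fst (sys_prob Y) (X1 z w)) (ae_snd (sys_prob X) (Y1 z w)).
  by move=> [x y] /= -> ->.
- apply: filterS2 (ae_fst (sys_prob Y) X2) (ae_snd (sys_prob X) Y2).
  by move=> [x y] /= -> ->.
Qed.

Lemma totally_ergodic_prod2 (X Y : Z2system R) : totally_ergodic (sys_prod2 X Y) ->
  totally_ergodic X /\ totally_ergodic Y.
Proof.
move=> e; split=> z z0 A mA iA.
- rewrite -(mp_fst (sys_prob X) (sys_prob Y) mA); apply: (e z z0).
    by rewrite -[X in measurable X]setTI; exact: measurable_fst.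
  by rewrite -[in RHS]iA.
- rewrite -(mp_snd (sys_prob X) (sys_prob Y) mA); apply: (e z z0).
    by rewrite -[X in measurable X]setTI; exact: measurable_snd.
  by rewrite -[in RHS]iA.
Qed.

Lemma totally_ergodic_factor k (F : 'I_k.+1 -> Z2system R) : totally_ergodic (sys_prod F) ->
  forall i, totally_ergodic (F i).
Proof.
elim: k F => [|k ih] F /= h i; first by rewrite (ord1 i).
have [h1 h2] := totally_ergodic_prod2 h.
have [->//|ik] := eqVneq i ord_max.
have ltik : (i < k.+1)%N by have := ltn_ord i; move: ik; rewrite -val_eqE /=; lia.
have -> : i = widen_ord (leqnSn _) (Ordinal ltik) by exact: val_inj.
exact: (ih (fun i => F (widen_ord (leqnSn _) i)) h1).
Qed.

End Koopman.

(** * Spectral models *)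

Section Models.
Context (R : realType).
Local Notation C := R[i].

Definition chi T (A : set T) (x : T) : C := ((\1_A x : R))%:C%C.

Lemma cabs2_chi_le1 T (A : set T) x : cabs2 (chi A x) <= 1.
Proof. by rewrite /chi indicE /cabs2 /=; case: (x \in A); rewrite ?expr1n ?expr0n ?addr0. Qed.

Lemma cmeasurable_chi d (T : measurableType d) (A : set T) : measurable A -> cmeasurable (chi A).
Proof. by move=> mA; split; [exact: measurable_indic|exact: measurable_cst]. Qed.

Lemma L2_chi d (T : measurableType d) (mu : probability T R) (A : set T) :
  measurable A -> L2 mu (chi A).
Proof. by move=> mA; apply: L2_bounded (cmeasurable_chi mA) _; exact: cabs2_chi_le1. Qed.

(* A spectral model of X: the Koopman operators act on L_2(sm_prob) as
   multiplication by the functions [character z (sm_sum x)]; the isomorphism is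
   given on a total family. The constants correspond to the functions supported
   by [sm_origin]. *)
Record spectral_model (X : Z2system R) := SpectralModel {
  sm_display : measure_display;
  sm_space :> measurableType sm_display;
  sm_prob : probability sm_space R;
  sm_sum : sm_space -> (R * R)%type;
  sm_origin : sm_space;
  sm_index : countType;
  sm_gen : sm_index -> X -> C;
  sm_fun : sm_index -> sm_space -> C;
  measurable_sm_sum : measurable_fun setT sm_sum;
  torus_sm_sum : forall x, @torus R (sm_sum x);
  measurable_sm_origin : measurable [set sm_origin];
  sm_sum_origin : sm_sum sm_origin = (0, 0);
  L2_sm_gen : forall i, L2 (sys_prob X) (sm_gen i);
  L2_sm_fun : forall i, L2 sm_prob (sm_fun i);
  total_sm_gen : total (sys_prob X) sm_gen;
  total_sm_fun : total sm_prob sm_fun;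
  sm_gram : forall z i j, inner (sys_prob X) (koopman X z (sm_gen i)) (sm_gen j) =
    inner sm_prob (fun x => character z (sm_sum x) * sm_fun i x) (sm_fun j);
  sm_one : exists2 c : C, c != 0 & forall i, inner (sys_prob X) (fun=> 1) (sm_gen i) =
    inner sm_prob (fun x => c * chi [set sm_origin] x) (sm_fun i) }.

Section ModelTheory.
Variables (X : Z2system R) (m : spectral_model X).
Hypothesis hX : is_action X.
Local Notation mu := (sys_prob X).
Local Notation M := (sm_prob m).
Local Notation s := (@sm_sum X m).

Definition sm_corr := corr mu M (@sm_gen X m) (@sm_fun X m).

Lemma sm_same_gram : same_gram mu M (@sm_gen X m) (@sm_fun X m).
Proof.
move=> i j; have := sm_gram 0 i j.
rewrite (_ : (fun x => _) = sm_fun i); last by apply/funext => x; rewrite character0 mul1r.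
move=> <-; apply: ae_eq_inner.
- exact: L2_cmeasurable (L2_sm_gen i).
- exact: L2_cmeasurable (L2_koopman hX 0 (L2_sm_gen i)).
- exact: L2_cmeasurable (L2_sm_gen j).
- exact: L2_cmeasurable (L2_sm_gen j).
- by case: hX => _ _ _; apply: filterS => x x0; rewrite /koopman x0.
- exact: aeW.
Qed.

Lemma L2_sm_character z phi : L2 M phi -> L2 M (fun x => character z (s x) * phi x).
Proof. by apply: L2_character; exact: measurable_sm_sum. Qed.

Lemma sm_corr_inner F phi F' phi' : sm_corr F phi -> sm_corr F' phi' ->
  inner mu F F' = inner M phi phi'.
Proof.
by apply: corr_inner; [exact: L2_sm_gen|exact: L2_sm_fun|exact: sm_same_gram
  |exact: total_sm_gen|exact: total_sm_fun].
Qed.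

(** The model prescribes the action on generators only. Taking adjoints moves the operator from [F]
    to a generator, where [sm_gram] applies. *)
Lemma sm_corr_koopman z F phi : sm_corr F phi ->
  sm_corr (koopman X z F) (fun x => character z (s x) * phi x).
Proof.
move=> c; have [LF Lphi _] := c; split; [exact: L2_koopman|exact: L2_sm_character|move=> i].
rewrite koopman_adjoint//; last exact: L2_sm_gen.
have ci : sm_corr (koopman X (- z) (sm_gen i)) (fun x => character (- z) (s x) * sm_fun i x).
  split; [exact: L2_koopman (L2_sm_gen i)|exact: L2_sm_character (L2_sm_fun i)|].
  by move=> j; exact: sm_gram.
rewrite (sm_corr_inner c ci) inner_mulJ; congr inner; apply/funext => x.
by rewrite characterN.
Qed.

Lemma sm_corr_exists_l phi : L2 M phi -> exists F, sm_corr F phi.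
Proof.
by apply: corr_exists_l; [exact: L2_sm_gen|exact: L2_sm_fun|exact: sm_same_gram|exact: total_sm_fun].
Qed.

Lemma sm_corr_exists_r F : L2 mu F -> exists phi, sm_corr F phi.
Proof.
move=> LF.
have g : same_gram M mu (@sm_fun X m) (@sm_gen X m) by move=> i j; rewrite -sm_same_gram.
have [phi c] := corr_exists_l (@L2_sm_fun X m) (@L2_sm_gen X m) g (@total_sm_gen X m) LF.
by exists phi; exact: corr_sym.
Qed.

Lemma sm_corr_uniq F F' phi : sm_corr F phi -> sm_corr F' phi -> {ae mu, forall x, F x = F' x}.
Proof. by apply: corr_uniq; [exact: L2_sm_gen|exact: total_sm_gen]. Qed.

Lemma sm_corr_uniq_r F phi phi' : sm_corr F phi -> sm_corr F phi' -> {ae M, forall x, phi x = phi' x}.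
Proof.
by move=> /corr_sym c /corr_sym; apply: (corr_uniq (@L2_sm_fun X m) (@total_sm_fun X m) c).
Qed.

Lemma sm_corrZ a F phi : sm_corr F phi -> sm_corr (fun x => a * F x) (fun x => a * phi x).
Proof. by apply: corrZ; [exact: L2_sm_gen|exact: L2_sm_fun]. Qed.

Lemma sm_corr_ae F F' phi phi' : @cmeasurable R _ X F' -> @cmeasurable R _ m phi' ->
  {ae mu, forall x, F x = F' x} -> {ae M, forall x, phi x = phi' x} ->
  sm_corr F phi -> sm_corr F' phi'.
Proof.
move=> mF mphi FF pp [LF Lp c].
have LF' := ae_eq_L2 mF FF LF; have Lp' := ae_eq_L2 mphi pp Lp.
split=> // i; transitivity (inner mu F (sm_gen i)).
  apply: ae_eq_inner => //; try exact: L2_cmeasurable (L2_sm_gen i).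
  - exact: L2_cmeasurable LF.
  - by apply: filterS FF => x ->.
  - exact: aeW.
rewrite c; apply: ae_eq_inner => //; try exact: L2_cmeasurable (L2_sm_fun i).
- exact: L2_cmeasurable Lp.
- exact: aeW.
Qed.

Lemma L2_origin c : L2 M (fun x => c * chi [set sm_origin m] x).
Proof. by apply: L2Z; apply: L2_chi; exact: measurable_sm_origin. Qed.

Lemma sm_corr_one : exists2 c : C, c != 0 & sm_corr (fun=> 1) (fun x => c * chi [set sm_origin m] x).
Proof.
have [c c0 h] := sm_one m; exists c => //; split => //; first exact: L2_cst.
exact: L2_origin.
Qed.

(** Otherwise the constant 1 would correspond to a function that vanishes almost everywhere. *)
Lemma sm_origin_gt0 : (0 < M [set sm_origin m])%E.
Proof.
rewrite lt0e measure_ge0 andbT; apply/eqP => M0.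
have [c c0 cc] := sm_corr_one; have := sm_corr_inner cc cc.
have -> : inner M (fun x => c * chi [set sm_origin m] x) (fun x => c * chi [set sm_origin m] x) =
    inner M (fun=> 0) (fun x => c * chi [set sm_origin m] x).
  apply: ae_eq_inner.
  - exact: L2_cmeasurable (L2_origin c).
  - exact: cmeasurable_cst.
  - exact: L2_cmeasurable (L2_origin c).
  - exact: L2_cmeasurable (L2_origin c).
  - exists [set sm_origin m]; split => //; first exact: measurable_sm_origin.
    move=> x /= xo; apply: contrapT => h; apply: xo.
    by rewrite /chi indicE memNset// mulr0.
  - exact: aeW.
rewrite inner0l ?inner_real; last exact: L2_origin.
move=> /(congr1 (@complex.Re R)) /=.
rewrite nsqE (_ : (fun x => _) = fun=> 1); last by apply/funext => x; rewrite /cabs2 /= expr1n expr0n addr0.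
move/eqP; rewrite (_ : \int[mu]_x 1 = 1 * fine (mu setT)); last exact: Rintegral_cst.
by rewrite probability_setT mulr1 oner_eq0.
Qed.

(** Inner products with constants become multiples of the inner product with the indicator of the
    atom, that is, of the value of [phi] there. *)
Lemma sm_L20 F phi : sm_corr F phi -> L20 mu F <-> {ae M, forall x, chi [set sm_origin m] x * phi x = 0}.
Proof.
move=> cF; have [LF Lphi _] := cF; have [c c0 c1] := sm_corr_one.
have mo := measurable_sm_origin m; have Lo := L2_chi M mo.
have Lop : L2 M (fun x => chi [set sm_origin m] x * phi x).
  by apply: L2_bounded_mul Lphi; [exact: cmeasurable_chi|exact: cabs2_chi_le1].
have E a : inner mu F (fun=> a) = conjc (a * c) * inner M phi (chi [set sm_origin m]).
  have -> : (fun=> a) = (fun x : X => a * 1) by apply/funext => x; rewrite mulr1.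
  rewrite (sm_corr_inner cF (sm_corrZ a c1)).
  rewrite (_ : (fun x => _) = (fun x => (a * c) * chi [set sm_origin m] x)) ?innerZr//.
  by apply/funext => x; rewrite mulrA.
have chiJ x : conjc (chi [set sm_origin m] x) = chi [set sm_origin m] x :> C.
  by apply: cplx_ext; rewrite ?ReJ ?ImJ /chi /= ?oppr0.
have chi2 x : chi [set sm_origin m] x * chi [set sm_origin m] x = chi [set sm_origin m] x :> C.
  by rewrite /chi indicE; case: (_ \in _); rewrite ?mulr1 ?mulr0.
split=> [[_ F0]|z].
- have z0 : inner M phi (chi [set sm_origin m]) = 0.
    apply/eqP; have /eqP := F0 1; rewrite /cst E mul1r mulf_eq0 conjc_eq0 (negPf c0)//.
  apply: nsq0_ae => //; have : inner M (fun x => chi [set sm_origin m] x * phi x)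
     (fun x => chi [set sm_origin m] x * phi x) = 0; last by rewrite inner_real => -[].
  rewrite inner_mulJ.
  have -> : (fun x => conjc (chi [set sm_origin m] x) * (chi [set sm_origin m] x * phi x)) =
     (fun x => phi (sm_origin m) * chi [set sm_origin m] x).
    apply/funext => x; rewrite chiJ mulrA chi2 /chi indicE.
    have [/set_mem -> |_] := boolP (x \in _); first by rewrite mulrC.
    by rewrite mul0r mulr0.
  by rewrite innerZr// z0 mulr0.
- split => // a; rewrite /cst E.
  rewrite (_ : inner M phi _ = 0) ?mulr0//.
  rewrite -(inner0l (mu := M) Lo) (_ : inner M phi _ = inner M (fun x => chi [set sm_origin m] x * phi x) (chi [set sm_origin m])).
    apply: ae_eq_inner => //; try exact: L2_cmeasurable Lo.
    - exact: L2_cmeasurable Lop.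
    - exact: aeW.
  by rewrite inner_mulJ; congr inner; apply/funext => x; rewrite chiJ chi2.
Qed.

End ModelTheory.

Section ProductModel.
Variables (X Y : Z2system R) (mX : spectral_model X) (mY : spectral_model Y).
Hypotheses (hX : is_action X) (hY : is_action Y).

Definition prod_sum (p : mX * mY) : (R * R)%type := tadd (sm_sum p.1) (sm_sum p.2).
Definition prod_gen (ij : sm_index mX * sm_index mY) : X * Y -> C := tens (sm_gen ij.1) (sm_gen ij.2).
Definition prod_fun (ij : sm_index mX * sm_index mY) : mX * mY -> C := tens (sm_fun ij.1) (sm_fun ij.2).

Local Notation prodP := ((sm_prob mX \x sm_prob mY)%E : probability (mX * mY)%type R).
Local Notation prodQ := (sys_prob (sys_prod2 X Y)).

Lemma measurable_prod_sum : measurable_fun setT prod_sum.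
Proof.
apply: measurable_tadd.
- exact: (measurableT_comp (@measurable_sm_sum X mX) measurable_fst).
- exact: (measurableT_comp (@measurable_sm_sum Y mY) measurable_snd).
Qed.

Lemma measurable_prod_origin : measurable [set (sm_origin mX, sm_origin mY)].
Proof.
rewrite (_ : [set _] = [set sm_origin mX] `*` [set sm_origin mY]).
  by apply: measurableX; exact: measurable_sm_origin.
by apply/seteqP; split=> [_ -> //|[x y] [/= -> ->]].
Qed.

Lemma prod_sum_origin : prod_sum (sm_origin mX, sm_origin mY) = (0, 0).
Proof. by rewrite /prod_sum !sm_sum_origin /tadd /frac2 /= !addr0 frac_id// lexx ltr01. Qed.

Lemma prod_gram z ij kl : inner prodQ (koopman (sys_prod2 X Y) z (prod_gen ij)) (prod_gen kl) =
  inner prodP (fun p => character z (prod_sum p) * prod_fun ij p) (prod_fun kl).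
Proof.
have -> : (fun p => character z (prod_sum p) * prod_fun ij p) =
    tens (fun x => character z (sm_sum x) * sm_fun ij.1 x) (fun y => character z (sm_sum y) * sm_fun ij.2 y).
  by apply/funext => p; rewrite /prod_sum character_tadd /prod_fun /tens mulrACA.
rewrite inner_tens; [|exact: L2_sm_character (L2_sm_fun _)|exact: L2_sm_character (L2_sm_fun _)|exact: L2_sm_fun..].
rewrite -!sm_gram -(inner_tens (mu := sys_prob X) (nu := sys_prob Y))//.
- exact: L2_koopman (L2_sm_gen _).
- exact: L2_koopman (L2_sm_gen _).
- exact: L2_sm_gen.
- exact: L2_sm_gen.
Qed.

Lemma prod_one : exists2 c : C, c != 0 & forall ij, inner prodQ (fun=> 1) (prod_gen ij) =
  inner prodP (fun x => c * chi [set (sm_origin mX, sm_origin mY)] x) (prod_fun ij).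
Proof.
have [c c0 cP] := sm_one mX; have [c' c0' cP'] := sm_one mY.
exists (c * c'); first by rewrite mulf_neq0.
move=> ij; rewrite (_ : (fun x => _) = tens (fun x => c * chi [set sm_origin mX] x)
    (fun y => c' * chi [set sm_origin mY] y)); last first.
  apply/funext => -[x y]; rewrite /tens /= mulrACA; congr (_ * _).
  rewrite /chi !indicE -rmorphM -natrM mulnb; congr (_ %:R)%:C%C; congr nat_of_bool.
  apply/idP/idP.
  - by move=> /set_mem[-> ->]; apply/andP; split; apply/mem_set.
  - by move=> /andP[/set_mem -> /set_mem ->]; apply/mem_set.
rewrite (inner_tens (mu := sm_prob mX) (nu := sm_prob mY)); last first.
- exact: L2_sm_fun.
- exact: L2_sm_fun.
- exact: L2_origin.
- exact: L2_origin.
rewrite -cP -cP' -(inner_tens (mu := sys_prob X) (nu := sys_prob Y)).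
- by congr inner; apply/funext => x; rewrite /tens mulr1.
- exact: L2_cst.
- exact: L2_cst.
- exact: L2_sm_gen.
- exact: L2_sm_gen.
Qed.

Definition prod_model : spectral_model (sys_prod2 X Y) :=
  @SpectralModel (sys_prod2 X Y) _ (mX * mY)%type prodP prod_sum (sm_origin mX, sm_origin mY)
    (sm_index mX * sm_index mY)%type prod_gen prod_fun measurable_prod_sum
    (fun p => torus_tadd _ _) measurable_prod_origin prod_sum_origin
    (fun ij => L2_tens (L2_sm_gen ij.1) (L2_sm_gen ij.2))
    (fun ij => L2_tens (L2_sm_fun ij.1) (L2_sm_fun ij.2))
    (total_tens (@L2_sm_gen X mX) (@L2_sm_gen Y mY) (@total_sm_gen X mX) (@total_sm_gen Y mY))
    (total_tens (@L2_sm_fun X mX) (@L2_sm_fun Y mY) (@total_sm_fun X mX) (@total_sm_fun Y mY))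
    prod_gram prod_one.

End ProductModel.
End Models.

(** * The model of a single action *)

Section Mixture.
Context (R : realType) d (T : measurableType d).
Local Notation C := R[i].
Variables (p : T) (sigma : probability T R).

Definition mixture : set T -> \bar R := mscale (2^-1)%:nng (measure_add (dirac p) sigma).

HB.instance Definition _ := Measure.on mixture.

Lemma mixtureE A : (mixture A = (2^-1)%:E * ((\1_A p)%:E + sigma A))%E.
Proof. by rewrite /mixture /mscale; congr (_ * _)%E; rewrite [LHS]measure_addE. Qed.

Lemma mixture_setT : mixture setT = 1%E.
Proof.
rewrite mixtureE probability_setT indicE in_setT -EFinD -EFinM; congr EFin.
by rewrite mulr1n; field.
Qed.

HB.instance Definition _ := @Measure_isProbability.Build _ _ R mixture mixture_setT.

Lemma ge0_integral_mixture (f : T -> \bar R) : measurable_fun setT f -> (forall x, 0 <= f x)%E ->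
  (\int[mixture]_x f x = (2^-1)%:E * (f p + \int[sigma]_x f x))%E.
Proof.
move=> mf f0; rewrite ge0_integral_mscale// ge0_integral_measure_add//.
by rewrite integral_dirac// diracT mul1e.
Qed.

Lemma integrable_mixture (f : T -> R) : mixture.-integrable setT (EFin \o f) ->
  sigma.-integrable setT (EFin \o f).
Proof.
move=> /integrableP[mf fi]; apply/integrableP; split => //.
rewrite ge0_integral_mixture// in fi; last exact: measurableT_comp.
rewrite ltNge leye_eq; apply/negP => /eqP e.
move: fi; rewrite e addey//.
by rewrite mulry gtr0_sg ?mul1e ?invr_gt0// ltxx.
Qed.

Lemma Rintegral_mixture (f : T -> R) : mixture.-integrable setT (EFin \o f) ->
  \int[mixture]_x f x = 2^-1 * (f p + \int[sigma]_x f x).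
Proof.
have pos (g : T -> R) : (forall x, 0 <= g x) -> mixture.-integrable setT (EFin \o g) ->
    \int[mixture]_x g x = 2^-1 * (g p + \int[sigma]_x g x).
  move=> g0 gi; have si := integrable_mixture gi.
  rewrite /Rintegral ge0_integral_mixture//; last exact: measurable_int gi.
  by rewrite -(fineK (integrable_fin_num measurableT si)) -EFinD -EFinM.
move=> fi; have si := integrable_mixture fi.
have ai : mixture.-integrable setT (EFin \o (fun x => `|f x|)).
  by have := integrable_abse fi.
have sai := integrable_mixture ai.
have E : f = (fun x => (`|f x| + f x) - `|f x|) by apply/funext => x; rewrite addrAC subrr add0r.
rewrite {1}E RintegralB//; last exact: integrableDr.
rewrite pos//; last 2 first.
- by move=> x; rewrite -lerBlDr sub0r -normrN ler_norm.
- exact: integrableDr.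
rewrite pos// RintegralD//; ring.
Qed.

Lemma cintegral_mixture (f : T -> C) : cintegrable mixture f ->
  cintegral mixture f = (2^-1)%:C%C * (f p + cintegral sigma f).
Proof.
move=> [f1 f2]; apply: cplx_ext; rewrite ?ReM ?ImM ?ReD ?ImD /=.
  by rewrite (Rintegral_mixture f1) mul0r subr0.
by rewrite (Rintegral_mixture f2) mul0r addr0.
Qed.

End Mixture.

Section FourierTotal.
Context (R : realType) d (E : measurableType d) (m : probability E R).
Local Notation C := R[i].
Variables (s : E -> (R * R)%type) (t : (R * R)%type -> E).
Hypothesis ms : measurable_fun setT s.
Hypothesis torus_s : forall x, @torus R (s x).
Hypothesis mt : measurable_fun setT t.

(** Where [F] does not vanish, [t] inverts [s], so the indicator of any measurable [A] is there the
    indicator of the preimage of [A] under [t], evaluated at [s x]. Fourier uniqueness thus gives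
    zero integrals of [F] over all measurable sets. *)
Lemma fourier_total (F : E -> C) : cintegrable m F ->
  {ae m, forall x, F x = 0 \/ t (s x) = x} ->
  (forall z, cintegral m (fun x => character z (s x) * F x) = 0) -> {ae m, forall x, F x = 0}.
Proof.
move=> Fi ts F0; have [mF1 mF2] := cintegrable_cmeasurable Fi.
have key A : measurable A -> cintegral m (fun x => (\1_A x)%:C%C * F x) = 0.
  move=> mA; have mtA : measurable (t @^-1` A) by rewrite -[X in measurable X]setTI; exact: mt.
  rewrite -(fourier_uniqueness ms torus_s Fi F0 mtA); apply: ae_eq_cintegral.
  - by apply: cmeasurableM => //; split; [exact: measurable_indic|exact: measurable_cst].
  - apply: cmeasurableM => //; split; last exact: measurable_cst.
    exact: (measurableT_comp (measurable_indic mtA) ms).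
  - apply: filterS ts => x [->|e]; first by rewrite !mulr0.
    rewrite !indicE (_ : (s x \in t @^-1` A) = (x \in A))//.
    by apply/idP/idP => /set_mem; rewrite /preimage /= ?e => ?; apply/mem_set; rewrite /preimage /= ?e.
have z (G : E -> R) : m.-integrable setT (EFin \o G) ->
    (forall A, measurable A -> \int[m]_x (\1_A x * G x) = 0) -> {ae m, forall x, G x = 0}.
  move=> Gi G0; have : ae_eq m setT (EFin \o G) (cst 0%E).
    apply: integral_ae_eq => // A _ mA; rewrite integral0 integral_mkcond.
    rewrite (_ : _ \_ A = (fun x => (\1_A x * G x)%:E)); last first.
      apply/funext => x; rewrite patchE indicE; case: ifP => _; rewrite ?mul1r// mul0r//.
    have fin : (\int[m]_x (\1_A x * G x)%:E)%E \is a fin_num.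
      apply: (integrable_fin_num measurableT).
      apply: (le_integrable measurableT _ _ Gi) => [|x _ /=].
        apply/measurable_EFinP/measurable_funM; first exact: measurable_indic.
        by apply/measurable_EFinP; exact: measurable_int Gi.
      by rewrite lee_fin normrM indicE; case: (x \in A); rewrite ?normr1 ?mul1r// normr0 mul0r.
    by rewrite -(fineK fin); congr EFin; exact: G0.
  by apply: filterS => x /(_ I)[].
have [i1 i2] := Fi.
have z1 : {ae m, forall x, complex.Re (F x) = 0}.
  apply: z => // A mA; have /(congr1 (@complex.Re R)) := key A mA; rewrite /cintegral /= => <-.
  by apply: eq_Rintegral => x _; rewrite ReZ.
have z2 : {ae m, forall x, complex.Im (F x) = 0}.
  apply: z => // A mA; have /(congr1 (@complex.Im R)) := key A mA; rewrite /cintegral /= => <-.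
  by apply: eq_Rintegral => x _; rewrite ImZ.
by apply: filterS2 z1 z2 => x e1 e2; exact: cplx_ext.
Qed.

End FourierTotal.

Section Swap.
Context (R : realType) d (T : measurableType d) (mu : probability T R).
Local Notation C := R[i].
Local Notation prodP := ((mu \x mu)%E : probability (T * T)%type R).

Definition swap (p : T * T) : T * T := (p.2, p.1).

Lemma measurable_swap : measurable_fun setT swap.
Proof. by apply: measurable_fun_pair; [exact: measurable_snd|exact: measurable_fst]. Qed.

Lemma mp_swap A : measurable A -> prodP (swap @^-1` A) = prodP A.
Proof.
move=> mA; apply: esym.
apply: (product_measure_unique (m' := measure_function_pushforward__canonical__measure_function_Measure (mu \x mu)%E measurable_swap)) => // B D mB mD.
transitivity ((mu \x mu)%E (D `*` B)); last by rewrite [LHS]product_measure1E// muleC.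
rewrite (_ : D `*` B = swap @^-1` (B `*` D))//.
by apply/seteqP; split=> [[x y] [/= ? ?]|[x y] [/= ? ?]]; split.
Qed.

Lemma L2_swap (f : T * T -> C) : L2 prodP f -> L2 prodP (f \o swap).
Proof. by apply: L2_mp; [exact: measurable_swap|exact: mp_swap]. Qed.

Lemma inner_swap (f g : T * T -> C) : L2 prodP f -> L2 prodP g ->
  inner prodP (f \o swap) (g \o swap) = inner prodP f g.
Proof. by apply: inner_mp; [exact: measurable_swap|exact: mp_swap]. Qed.

Lemma cintegral_chi A : measurable A -> cintegral mu (chi R A) = (fine (mu A))%:C%C.
Proof.
move=> mA; apply: cplx_ext; rewrite /cintegral /chi /=.
  by rewrite /Rintegral integral_indic// setIT.
by rewrite Rintegral_cst// mul0r.
Qed.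

End Swap.

Section CyclicVector.
Context (R : realType).
Local Notation C := R[i].
Variable X : Z2system R.
Hypothesis hX : is_action X.
Local Notation nu := (sys_prob X).
Local Notation X2 := (sys_square X).

Lemma L2_1 d (T : measurableType d) (mu : probability T R) : L2 mu (fun=> 1 : C).
Proof. exact: L2_cst. Qed.

Lemma inner_1 d (T : measurableType d) (mu : probability T R) : inner mu (fun=> 1 : C) (fun=> 1) = 1.
Proof.
rewrite inner_real nsqE (_ : (fun x => _) = fun=> 1).
  rewrite (_ : \int[mu]_x 1 = 1 * fine (mu setT)); last exact: Rintegral_cst.
  by rewrite probability_setT mulr1.
by apply/funext => x; rewrite /cabs2 /= expr1n expr0n addr0.
Qed.

(** The Lebesgue parametrisation supplies a set of measure $1/2$. The lemma guarantees that the
    cyclic vector found below is nonzero and can be normalised. *)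
Lemma nonzero_L20 : lebesgue_space nu -> exists2 F : X -> C, L20 nu F & ~ {ae nu, forall x, F x = 0}.
Proof.
move=> [phi [_ [[mphi _] phiE _ _ _]]].
pose A := phi @^-1` `[0, 2^-1].
have mA : measurable A by rewrite -[X in measurable X]setTI; exact: mphi.
have A2 : nu A = (2^-1)%:E.
  rewrite phiE// (_ : _ `&` _ = `[0, 2^-1]%classic); last first.
    apply/seteqP; split=> x /=; rewrite !in_itv/=; first by case.
    by move=> /andP[x0 x1]; split; apply/andP; split=> //; lra.
  rewrite lebesgue_measure_itv/= lte_fin invr_gt0 ltr0n/=.
  by rewrite -EFinB subr0.
have Lchi := L2_chi nu mA; have L1 := L2_1 nu.
have Lh : L2 nu (fun=> (2^-1 : R)%:C%C) by exact: L2_cst.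
have chi1 : inner nu (chi R A) (fun=> 1) = (2^-1 : R)%:C%C.
  rewrite -[2^-1]/(fine (2^-1)%:E) -A2 -cintegral_chi//.
  by apply: eq_cintegral => x; rewrite conjc1 mulr1.
exists (fun x => chi R A x - (2^-1 : R)%:C%C).
  split; first exact: L2B.
  move=> c; rewrite (_ : cst c = fun x => c * 1); last by apply/funext => x; rewrite mulr1.
  rewrite innerZr//; last exact: L2B.
  rewrite innerBl// chi1 (_ : (fun=> _%:C%C) = fun x => (2^-1 : R)%:C%C * 1).
    by rewrite innerZl// inner_1 mulr1 subrr mulr0.
  by apply/funext => x; rewrite mulr1.
move=> [N [mN N0 NP]].
have TN : setT `<=` N.
  move=> x _; apply: NP => /= /(congr1 (@complex.Re R)); rewrite /chi indicE /=.
  by case: (_ \in _) => /=; rewrite ?mulr1n ?mulr0n; lra.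
have T0 := subset_measure0 measurableT mN TN N0.
have : 0%E = 1%E :> \bar R by rewrite -T0; exact: probability_setT.
by move=> [] /eqP; rewrite eq_sym oner_eq0.
Qed.

(** Averaging the symmetric cyclic vector [g] over its first variable gives the cyclic vector. If
    [F] is orthogonal to the orbit of [f], then $F\otimes 1+1\otimes F$ is orthogonal to the orbit
    of [g], in whose closed span it lies; so it vanishes, and its squared norm is twice that of
    [F]. *)
Lemma simple_cyclic : simple_spectrum (sys_prob X2) (koopman X2) (L20_sym X) ->
  exists2 f : X -> C, L20 nu f & forall F, L20 nu F ->
    (forall z, inner nu (koopman X z f) F = 0) -> {ae nu, forall x, F x = 0}.
Proof.
move=> [g [[Lg g0] gsym] gE]; have hX2 := is_action_prod2 hX hX.
have L1 := L2_1 nu.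
pose f y := inner nu (fun x => g (x, y)) (fun=> 1).
have Lf : L2 nu f by exact: L2_partial_inner.
have fE F : L2 nu F -> inner nu f F = inner (sys_prob X2) g (tens (fun=> 1) F).
  by move=> LF; exact: partial_inner_tens.
exists f.
  split=> // c; rewrite fE; last exact: L2_cst.
  rewrite -[RHS](g0 c); congr inner; apply/funext => p; rewrite /tens mul1r//.
move=> F [LF F0] fF.
have F1 : inner nu F (fun=> 1) = 0 by exact: F0.
have fzF z : inner nu (koopman X z f) F = inner (sys_prob X2) (koopman X2 z g) (tens (fun=> 1) F).
  rewrite koopman_adjoint// fE; last exact: L2_koopman.
  by rewrite (koopman_adjoint hX2)//; exact: L2_tens.
pose G (p : X * X) := F p.1 * 1 + 1 * F p.2.
have LF1 : L2 (sys_prob X2) (tens F (fun=> 1)) by exact: L2_tens.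
have L1F : L2 (sys_prob X2) (tens (fun=> 1) F) by exact: L2_tens.
have LG : L2 (sys_prob X2) G by exact: (L2D LF1 L1F).
have zsym z : {ae sys_prob X2, forall p : X * X, koopman X2 z g p = (koopman X2 z g \o @swap _ X) p}.
  by have := ae_act hX2 z gsym; apply: filterS => p.
have Gspan : closed_span (sys_prob X2) (fun z => koopman X2 z g) G.
  rewrite -gE; split; last by apply: aeW => p; rewrite /G /= !mulr1 !mul1r addrC.
  split => // c; rewrite (_ : cst c = fun p => c * tens (fun=> 1) (fun=> 1) p); last first.
    by apply/funext => p; rewrite /tens !mulr1.
  have L11 : L2 (sys_prob X2) (tens (fun=> 1) (fun=> 1)) by exact: L2_tens.
  rewrite innerZr// (innerDl LF1 L1F)// !inner_tens// F1 mul0r mulr0 addr0 mulr0//.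
have zG z : inner (sys_prob X2) (koopman X2 z g) G = 0.
  have Lz := L2_koopman hX2 z Lg.
  rewrite (innerDr LF1 L1F)// -fzF fF addr0.
  rewrite -(inner_swap Lz LF1).
  transitivity (inner (sys_prob X2) (koopman X2 z g) (tens (fun=> 1) F)); last by rewrite -fzF.
  apply: ae_eq_inner.
  - exact: L2_cmeasurable (L2_swap Lz).
  - exact: L2_cmeasurable Lz.
  - exact: L2_cmeasurable (L2_swap LF1).
  - exact: L2_cmeasurable L1F.
  - by apply: filterS (zsym z) => p.
  - by apply: aeW => p; rewrite /swap /tens /= mulrC.
have G0 : inner (sys_prob X2) G G = 0.
  by apply: inner_closed_span0 Gspan LG zG => z; exact: L2_koopman.
apply: nsq_inner0 => //; move: G0.
rewrite (innerDl LF1 L1F)// !(innerDr LF1 L1F)// !inner_tens// !inner_1 F1 mul0r mulr0 addr0.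
by rewrite mulr1 add0r mul1r => /eqP; rewrite -mulr2n mulrn_eq0 /= => /eqP.
Qed.
End CyclicVector.

Lemma L2_character1 (R : realType) d (T : measurableType d) (mu : probability T R)
  (s : T -> (R * R)%type) z :
  measurable_fun setT s -> L2 mu (fun x => character z (s x)).
Proof.
move=> ms; apply: (@L2_bounded _ _ _ _ 1); first exact: cmeasurable_character_comp.
by move=> x; rewrite cabs2_character.
Qed.

Section SingleModel.
Context (R : realType).
Local Notation C := R[i].
Variable X : Z2system R.
Hypothesis hX : is_action X.
Local Notation nu := (sys_prob X).

Lemma koopman_gram f z w : L2 nu f ->
  inner nu (koopman X z f) (koopman X w f) = inner nu (koopman X (z - w) f) f.
Proof.
move=> Lf; have Lz := L2_koopman hX z Lf.
have h := koopman_adjoint hX (- w) Lz Lf.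
rewrite opprK in h; rewrite -h; apply: ae_eq_inner.
- exact: L2_cmeasurable (L2_koopman hX (- w) Lz).
- exact: L2_cmeasurable (L2_koopman hX (z - w) Lf).
- exact: L2_cmeasurable Lf.
- exact: L2_cmeasurable Lf.
- by apply: filterS (koopman_comp hX (- w) z f) => x.
- exact: aeW.
Qed.

(** That [sigma] is a probability measure encodes the normalisation of the cyclic vector [f]. *)
Record cyclic_data (f : X -> C) (sigma : probability (R * R)%type R) : Prop := {
  cyclic_L20 : L20 nu f;
  cyclic_total : forall F, L20 nu F ->
    (forall z, inner nu (koopman X z f) F = 0) -> {ae nu, forall x, F x = 0};
  cyclic_torus : sigma (~` @torus R) = 0%E;
  cyclic_fourier : forall z, inner nu (koopman X z f) f = cintegral sigma (character z) }.

Lemma cyclic_data_exists : lebesgue_space nu ->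
  simple_spectrum (sys_prob (sys_square X)) (koopman (sys_square X)) (L20_sym X) ->
  exists f sigma, cyclic_data f sigma.
Proof.
move=> hL hs; have [f0 f0L20 f0t] := simple_cyclic hX hs; have [F FL20 Fn] := nonzero_L20 hL.
have Lf0 := f0L20.1.
have f0n : nsq nu f0 != 0.
  apply/eqP => n0; apply: Fn; apply: f0t => // z.
  have z0 := nsq0_ae Lf0 n0; have LF := FL20.1.
  rewrite -(inner0l LF); apply: ae_eq_inner.
  - exact: L2_cmeasurable (L2_koopman hX z Lf0).
  - exact: cmeasurable_cst.
  - exact: L2_cmeasurable LF.
  - exact: L2_cmeasurable LF.
  - exact: (ae_act hX z z0).
  - exact: aeW.
pose a : C := ((Num.sqrt (nsq nu f0))^-1)%:C%C.
have sn : 0 < nsq nu f0 by rewrite lt_neqAle eq_sym f0n nsq_ge0.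
pose f x := a * f0 x.
have Lf : L2 nu f by exact: L2Z.
have a0 : a != 0.
  by apply/eqP => /(congr1 (@complex.Re R)) /= /eqP; rewrite invr_eq0 sqrtr_eq0 leNgt sn.
have zE z : koopman X z f = fun x => a * koopman X z f0 x by [].
have nf : nsq nu f = 1.
  rewrite nsqZ// /a /cabs2 /= exprVn sqr_sqrtr ?nsq_ge0// expr0n addr0 mulVf//.
have [] := @bochner R (fun z => inner nu (koopman X z f) f).
- transitivity (inner nu f f); last by rewrite inner_real nf.
  apply: ae_eq_inner; try exact: L2_cmeasurable Lf.
  + exact: L2_cmeasurable (L2_koopman hX 0 Lf).
  + by case: hX => _ _ _; apply: filterS => x x0; rewrite /koopman x0.
  + exact: aeW.
(* Positive definiteness: the form is the squared norm of a combination of the orbit of [f]. *)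
- move=> s; have Le z : L2 nu (koopman X z f) by exact: L2_koopman.
  have := inner_real nu (lincomb s (fun z => koopman X z f)).
  rewrite (inner_lincombl Le s (L2_lincomb Le s)) => h.
  rewrite (_ : \sum_(p <- s) _ = \sum_(p <- s) p.2 * inner nu (koopman X p.1 f) (lincomb s (fun z => koopman X z f))).
    by rewrite h lecR nsq_ge0.
  apply: eq_bigr => p _; rewrite (innerC (L2_lincomb Le s) (Le _)).
  rewrite (inner_lincombl Le s (Le _)) rmorph_sum mulr_sumr; apply: eq_bigr => q _.
  rewrite -mulrA; congr (_ * _); rewrite rmorphM; congr (_ * _).
  rewrite -koopman_gram//; exact: innerC.
move=> sigma [s0 sE]; exists f, sigma; split => //.
- split=> // c; rewrite innerZl//; last exact: L2_cst.
  by rewrite f0L20.2 mulr0.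
- move=> G LG Gz; apply: f0t => // z; have := Gz z; have LG' := LG.1.
  rewrite zE innerZl//; last exact: L2_koopman.
  by move/eqP; rewrite mulf_eq0 (negPf a0) => /eqP.
Qed.

Variables (f : X -> C) (sigma : probability (R * R)%type R).
Hypothesis cd : cyclic_data f sigma.

(* A point outside the torus, at which all characters take the value 1: it
   carries the constants. *)
Definition origin : (R * R)%type := (1, 1).

Lemma character_origin z : character z origin = 1 :> C.
Proof.
have := character_shift z (0 : R, 0 : R) 1 1; rewrite /= !add0r => ->.
by rewrite /character /= !mulr0 addr0 mulr0 cos0 sin0.
Qed.

Lemma origin_notin : ~ @torus R origin.
Proof. by rewrite /torus /= => -[/andP[_]]; rewrite ltxx. Qed.

Definition base_prob : probability (R * R)%type R := mixture origin sigma.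

Lemma measurable_origin : measurable [set origin].
Proof.
rewrite (_ : [set origin] = [set 1] `*` [set 1]); first exact: measurableX.
by apply/seteqP; split=> [_ -> //|[x y] [/= -> ->]].
Qed.

Lemma sigma_torus : {ae sigma, forall x, @torus R x}.
Proof.
exists (~` @torus R); split => //; last exact: (cyclic_torus cd).
by apply: measurableC; exact: torus_measurable.
Qed.

Lemma frac2_origin : frac2 origin = (0, 0).
Proof. by rewrite /frac2 /frac /= (_ : Num.floor 1 = 1) ?subrr// -[1 in LHS]/(1%:~R) intrKfloor. Qed.

Lemma base_torus : {ae base_prob, forall x, x = origin \/ @torus R x}.
Proof.
have mo := measurable_origin; have mt := @torus_measurable R.
have mN : measurable (~` ([set origin] `|` @torus R)) by apply: measurableC; exact: measurableU.
exists (~` ([set origin] `|` @torus R)); split => //.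
rewrite [LHS]mixtureE indicE memNset; last by move=> /=; apply; left.
rewrite add0e (subset_measure0 _ _ _ (cyclic_torus cd)) ?mule0//.
  by apply: measurableC.
by move=> x /= h1 h2; apply: h1; right.
Qed.

Lemma L2_base (F : R * R -> C) : L2 base_prob F -> L2 sigma F.
Proof. by move=> /L2P[mF Fi]; apply/L2P; split => //; exact: (integrable_mixture Fi). Qed.

Lemma inner_base (F G : R * R -> C) : L2 base_prob F -> L2 base_prob G ->
  inner base_prob F G = (2^-1)%:C%C * (F origin * conjc (G origin) + inner sigma F G).
Proof. by move=> LF LG; rewrite [LHS](cintegral_mixture (inner_cintegrable LF LG)). Qed.

(** The index [None] stands for the constants, to which the orbit of [f] is orthogonal. *)
Definition single_gen (i : option (int * int)) : X -> C :=
  if i is Some z then koopman X z f else fun=> 1.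

(** Compensates the factor $1/2$ in [mixture], so that inner products agree with those for
    [sigma]. *)
Definition sqrt2 : C := (Num.sqrt 2)%:C%C.

Lemma sqr_sqrt2 : sqrt2 * conjc sqrt2 = 2%:C%C.
Proof.
have h : Num.sqrt (2 : R) * Num.sqrt 2 = 2 by rewrite -expr2 sqr_sqrtr.
by apply: cplx_ext; rewrite /sqrt2 /= ?h; ring.
Qed.

Definition single_fun (i : option (int * int)) : R * R -> C :=
  if i is Some z then fun x => sqrt2 * chi R (~` [set origin]) x * character z x
  else fun x => sqrt2 * chi R [set origin] x.

Lemma chi_origin : chi R [set origin] origin = 1.
Proof. by rewrite /chi indicE mem_set. Qed.

Lemma chiC_origin : chi R (~` [set origin]) origin = 0.
Proof. by rewrite /chi indicE memNset//=; apply. Qed.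

Lemma chi_torus x : @torus R x -> chi R [set origin] x = 0 /\ chi R (~` [set origin]) x = 1.
Proof.
move=> tx; have h : x <> origin by move=> e; apply: origin_notin; rewrite -e.
by rewrite /chi !indicE memNset// mem_set.
Qed.

Lemma L2_single_gen i : L2 nu (single_gen i).
Proof.
case: i => [z|]; last exact: L2_cst.
by apply: L2_koopman => //; exact: (cyclic_L20 cd).1.
Qed.

Lemma L2_single_fun i : L2 base_prob (single_fun i).
Proof.
have mo := measurable_origin.
have Lo := L2_chi base_prob mo; have Lo' := L2_chi base_prob (measurableC mo).
case: i => [z|]; last exact: L2Z.
rewrite (_ : single_fun (Some z) = fun x => sqrt2 * (chi R (~` [set origin]) x * character z x)); last first.
  by apply/funext => x; rewrite /single_fun mulrA.
apply: L2Z; apply: L2_bounded_mul; first exact: cmeasurable_chi (measurableC mo).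
  exact: cabs2_chi_le1.
by apply: (@L2_character1 R _ _ _ id); exact: measurable_id.
Qed.

Lemma inner_single_gen0 z : inner nu (koopman X z f) (fun=> 1) = 0.
Proof.
rewrite koopman_adjoint//; [|exact: (cyclic_L20 cd).1|exact: L2_cst].
by rewrite (_ : koopman X _ _ = cst 1)// (cyclic_L20 cd).2.
Qed.

Lemma total_single_gen : total nu single_gen.
Proof.
move=> F LF F0; apply: (cyclic_total cd).
  split=> // c; rewrite (_ : cst c = fun x => c * 1); last by apply/funext => x; rewrite mulr1.
  by rewrite innerZr//; [rewrite (F0 None) mulr0|exact: L2_cst].
move=> z; rewrite (innerC LF); last exact: (L2_single_gen (Some z)).
by rewrite (F0 (Some z)) conjc0.
Qed.

Lemma inner_single_fun F i : L2 base_prob F -> inner base_prob F (single_fun i) =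
  (2^-1)%:C%C * conjc sqrt2 * (if i is Some z then inner sigma F (character z) else F origin).
Proof.
move=> LF; rewrite inner_base//; last exact: L2_single_fun.
have Ls := L2_base LF.
have mL i' : cmeasurable (single_fun i') by exact: L2_cmeasurable (L2_single_fun i').
have Lch z : L2 sigma (character z) by exact: (@L2_character1 R _ _ _ id).
case: i => [z|]; rewrite -mulrA; congr (_ * _).
- rewrite /single_fun chiC_origin mulr0 mul0r conjc0 mulr0 add0r.
  rewrite -innerZr//; apply: ae_eq_inner.
  + exact: L2_cmeasurable Ls.
  + exact: L2_cmeasurable Ls.
  + exact: (mL (Some z)).
  + by apply: cmeasurableM; [exact: cmeasurable_cst|exact: cmeasurable_character].
  + exact: aeW.
  + by apply: filterS sigma_torus => x /chi_torus[_ ->]; rewrite mulr1.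
- rewrite /single_fun chi_origin mulr1 mulrC.
  rewrite (_ : inner sigma F _ = 0) ?addr0//.
  rewrite (innerC (f := fun x => sqrt2 * chi R [set origin] x))//; last first.
    by apply: L2Z; exact: L2_chi measurable_origin.
  rewrite -[RHS]conjc0 -(inner0l Ls); congr conjc; apply: ae_eq_inner.
  + exact: (mL None).
  + exact: cmeasurable_cst.
  + exact: L2_cmeasurable Ls.
  + exact: L2_cmeasurable Ls.
  + by apply: filterS sigma_torus => x /chi_torus[-> _]; rewrite mulr0.
  + exact: aeW.
Qed.

Lemma half_sqrt2 : (2^-1)%:C%C * conjc sqrt2 * sqrt2 = 1 :> C.
Proof.
rewrite -mulrA [conjc _ * _]mulrC sqr_sqrt2.
by apply: cplx_ext => /=; rewrite !mul0r ?subr0 ?mulr0 ?addr0// mulVf// pnatr_eq0.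
Qed.

Lemma single_gram z i j : inner nu (koopman X z (single_gen i)) (single_gen j) =
  inner base_prob (fun x => character z (frac2 x) * single_fun i x) (single_fun j).
Proof.
have Lf := (cyclic_L20 cd).1.
rewrite (_ : (fun x => character z (frac2 x) * _) = (fun x => character z x * single_fun i x)); last first.
  by apply/funext => x; rewrite character_frac2.
have Lz : L2 base_prob (fun x => character z x * single_fun i x).
  by apply: (L2_character (s := id)) (L2_single_fun i); exact: measurable_id.
have Lch w : L2 sigma (character w) by exact: (@L2_character1 R _ _ _ id).
rewrite inner_single_fun//.
case: i Lz => [w|] Lz; case: j => [v|].
- have Lzw : L2 sigma (fun x => sqrt2 * character (z + w) x) by exact: L2Z.
  rewrite (_ : inner sigma _ _ = inner sigma (fun x => sqrt2 * character (z + w) x) (character v)); last first.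
    apply: ae_eq_inner; [exact: L2_cmeasurable (L2_base Lz)|exact: L2_cmeasurable Lzw|exact: cmeasurable_character..| |exact: aeW].
    by apply: filterS sigma_torus => x /chi_torus[_ c1]; rewrite /single_fun c1 characterD mulr1 mulrCA.
  rewrite innerZl// mulrA half_sqrt2 mul1r.
  transitivity (inner nu (koopman X (w + z) f) (koopman X v f)).
    apply: ae_eq_inner; [exact: L2_cmeasurable (L2_koopman hX z (L2_koopman hX w Lf))|exact: L2_cmeasurable (L2_koopman hX (w + z) Lf)|exact: L2_cmeasurable (L2_koopman hX v Lf)..| |exact: aeW].
    by apply: filterS (koopman_comp hX z w f) => x.
  rewrite koopman_gram// (cyclic_fourier cd); apply: eq_cintegral => x.
  by rewrite characterB addrC.
- rewrite /single_gen [RHS](_ : _ = 0); last first.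
    by rewrite /single_fun chiC_origin mulr0 mul0r mulr0 mulr0.
  have Lw := L2_koopman hX w Lf.
  rewrite koopman_adjoint//; last exact: L2_cst.
  by rewrite (_ : koopman X _ (fun=> 1) = fun=> 1)// inner_single_gen0.
- rewrite /single_gen (_ : koopman X _ (fun=> 1) = fun=> 1)//.
  rewrite (innerC (L2_koopman hX v Lf))//; last exact: L2_cst.
  rewrite inner_single_gen0 conjc0 (_ : inner sigma _ _ = 0) ?mulr0//.
  rewrite -(inner0l (Lch v)).
  apply: ae_eq_inner; [exact: L2_cmeasurable (L2_base Lz)|exact: cmeasurable_cst|exact: cmeasurable_character..| |exact: aeW].
  by apply: filterS sigma_torus => x /chi_torus[c0 _]; rewrite /single_fun c0 !mulr0.
- rewrite /single_gen (_ : koopman X _ (fun=> 1) = fun=> 1)// inner_1 /single_fun.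
  by rewrite character_origin chi_origin mul1r mulr1 half_sqrt2.
Qed.

(** The generator [None] tests the value at the extra point; the other generators test the Fourier
    coefficients on the torus, where [frac2] is the identity and [fourier_total] applies. *)
Lemma total_single_fun : total base_prob single_fun.
Proof.
move=> F LF F0; have h0 : (2^-1)%:C%C * conjc sqrt2 != 0 :> C.
  apply/eqP => h; move: half_sqrt2; rewrite h mul0r => /eqP.
  by rewrite eq_sym oner_eq0.
have Fo : F origin = 0.
  by move: (F0 None); rewrite inner_single_fun// => /eqP; rewrite mulf_eq0 (negPf h0) => /eqP.
have Ls := L2_base LF.
have Fz : {ae sigma, forall x, F x = 0}.
  apply: (@fourier_total R _ _ sigma (@frac2 R) id) => //.
  - exact: measurable_frac2.
  - exact: torus_frac2.
  - exact: L2_cintegrable Ls.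
  - by apply: filterS sigma_torus => x tx; right; rewrite frac2_id.
  - move=> z; move: (F0 (Some (- z))); rewrite inner_single_fun// => /eqP.
    rewrite mulf_eq0 (negPf h0) => /eqP <-; apply: eq_cintegral => x.
    by rewrite character_frac2 characterN conjcK mulrC.
have n1 := nsqE_int LF.
apply: nsq0_ae => //.
have [mF _] := (L2P _ _).1 LF.
have mF2 : measurable_fun setT (fun x => (cabs2 (F x))%:E) by apply/measurable_EFinP; exact: cmeasurable_cabs2.
apply/eqP; rewrite -eqe n1 ge0_integral_mixture//; last by move=> x; rewrite lee_fin cabs2_ge0.
rewrite Fo (ae_eq_integral (cst 0%E))//; last first.
  by apply: filterS Fz => x -> _; rewrite /cabs2 /= expr0n addr0.
by rewrite integral_cst// mul0e adde0 /cabs2 /= expr0n addr0 mule0.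
Qed.

Lemma single_one : exists2 c : C, c != 0 & forall i, inner nu (fun=> 1) (single_gen i) =
  inner base_prob (fun x => c * chi R [set origin] x) (single_fun i).
Proof.
exists sqrt2.
  by apply/eqP => h; move: sqr_sqrt2; rewrite h mul0r => /(congr1 (@complex.Re R)) /= /eqP; rewrite eq_sym pnatr_eq0.
move=> i; have := single_gram 0 None i.
by rewrite /single_gen (_ : koopman X _ (fun=> 1) = fun=> 1)// => ->; congr inner;
  apply/funext => x; rewrite character0 mul1r.
Qed.

Definition single_model : spectral_model X :=
  @SpectralModel R X _ (R * R)%type base_prob (@frac2 R) origin (option (int * int))
    single_gen single_fun (@measurable_frac2 R) (@torus_frac2 R) measurable_origin
    frac2_origin
    L2_single_gen L2_single_fun total_single_gen total_single_fun single_gram single_one.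

End SingleModel.

Arguments sm_corr {R X} m F phi.

Lemma measurable_inv_ge0 (R : realType) d (T : measurableType d) (f : T -> R) :
  (forall x, 0 <= f x) -> measurable_fun setT f -> measurable_fun setT (fun x => (f x)^-1).
Proof.
move=> f0 mf; under eq_fun do rewrite -powR_inv1//.
exact: (measurableT_comp (@measurable_powR R (-1)) mf).
Qed.

(** * Consequences of ergodicity and of the simple symmetric spectrum *)

Section ModelFacts.
Context (R : realType).
Local Notation C := R[i].

Section Ergodic.
Variables (X : Z2system R) (m : spectral_model X).
Hypothesis hX : is_action X.
Local Notation mu := (sys_prob X).
Local Notation M := (sm_prob m).
Local Notation s := (@sm_sum R X m).

Lemma sm_corr_lincomb (I : Type) (e : I -> X -> C) (f : I -> m -> C) t :
  (forall i, sm_corr m (e i) (f i)) -> sm_corr m (lincomb t e) (lincomb t f).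
Proof.
move=> ef; have Le i : L2 mu (e i) by case: (ef i).
have Lf i : L2 M (f i) by case: (ef i).
split; [exact: L2_lincomb|exact: L2_lincomb|move=> j].
rewrite (inner_lincombl Le t (L2_sm_gen j)) (inner_lincombl Lf t (L2_sm_fun j)).
by apply: eq_bigr => p _; congr (_ * _); case: (ef p.1).
Qed.

Lemma sm_closed_span (I : Type) (e : I -> X -> C) (f : I -> m -> C) F phi :
  (forall i, sm_corr m (e i) (f i)) -> sm_corr m F phi ->
  closed_span mu e F <-> closed_span M f phi.
Proof.
move=> ef c; have [LF Lp _] := c.
have E t : l2n mu (fun x => F x - lincomb t e x) = l2n M (fun x => phi x - lincomb t f x).
  have cB : sm_corr m (fun x => F x - lincomb t e x) (fun x => phi x - lincomb t f x).
    by apply: corrB c (sm_corr_lincomb t ef); [exact: L2_sm_gen|exact: L2_sm_fun].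
  by rewrite -!l2normE /l2norm (sm_corr_inner hX cB cB).
split=> /closed_spanP[_ H]; apply/closed_spanP; split => // eps e0; have [t] := H _ e0.
  by rewrite E; exists t.
by rewrite -E; exists t.
Qed.

Lemma character_0 z : character z (0 : R, 0 : R) = 1.
Proof. by rewrite /character /= !mulr0 addr0 mulr0 cos0 sin0. Qed.

Lemma measurable_set1_pair (a : R * R) : measurable [set a].
Proof.
rewrite (_ : [set a] = [set a.1] `*` [set a.2]); first exact: measurableX.
by case: a => a b; apply/seteqP; split=> [_ -> //|[x y] [/= -> ->]].
Qed.

(** The indicator of the other points with sum 0 corresponds to an invariant vector. By ergodicity
    that vector is constant, so its model is supported by the origin, from which the set is
    disjoint. *)
Lemma sm_sum_eq0 : totally_ergodic X -> {ae M, forall x, s x = (0, 0) -> x = sm_origin m}.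
Proof.
move=> eX; have mo := measurable_sm_origin m.
pose A := (s @^-1` [set (0, 0)]) `&` ~` [set sm_origin m].
have mA : measurable A.
  apply: measurableI; last exact: measurableC.
  by rewrite -[X in measurable X]setTI; apply: measurable_sm_sum => //; exact: measurable_set1_pair.
have LA := L2_chi M mA; have [F cF] := sm_corr_exists_l hX LA.
have zE z : (fun x => character z (s x) * chi R A x) = chi R A.
  apply/funext => x; rewrite /chi indicE; have [|_] := boolP (x \in A); last by rewrite mulr0.
  by move/set_mem => [/= -> _]; rewrite character_0 mul1r.
have inv : {ae mu, forall x : X, koopman X (1, 0) F x = F x}.
  by have := sm_corr_koopman hX (1, 0) cF; rewrite zE => c1; exact: sm_corr_uniq c1 cF.
have LF : L2 mu F by case: cF.
have Fc : {ae mu, forall x : X, F x = cintegral mu F * 1}.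
  apply: filterS (ergodic_constant_complex hX eX _ (L2_cintegrable LF) inv) => // x ->.
  by rewrite mulr1.
have [c c0 c1] := sm_corr_one m.
have c2 := sm_corrZ (cintegral mu F) c1.
have cF' : sm_corr m F (fun x => cintegral mu F * (c * chi R [set sm_origin m] x)).
  apply: (sm_corr_ae _ _ _ _ c2).
  - exact: L2_cmeasurable LF.
  - by apply: L2_cmeasurable; case: c2 => _ L _; exact: L.
  - by apply: filterS Fc => x ->.
  - exact: aeW.
apply: filterS (sm_corr_uniq_r cF cF') => x e sx0; apply: contrapT => xo.
move: e; rewrite /chi !indicE mem_set; last by split.
by rewrite memNset// !mulr0 => /(congr1 (@complex.Re R)) /= /eqP; rewrite oner_eq0.
Qed.

End Ergodic.

Section Symmetric.
Variables (X : Z2system R) (m : spectral_model X).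
Hypothesis hX : is_action X.
Local Notation X2 := (sys_square X).
Local Notation mu := (sys_prob X2).
Local Notation m2 := (prod_model m m hX hX).
Local Notation M := (sm_prob m2).
Hypothesis hs : simple_spectrum mu (koopman X2) (L20_sym X).
Hypothesis eX : totally_ergodic X2.

Lemma sm_corr_swap F phi : sm_corr m2 F phi -> sm_corr m2 (F \o @swap _ X) (phi \o @swap _ m).
Proof.
move=> [LF Lp c]; split; [exact: L2_swap|exact: L2_swap|move=> ij].
have h := c (ij.2, ij.1).
transitivity (inner mu (F \o @swap _ X) (@sm_gen _ _ m2 (ij.2, ij.1) \o @swap _ X)).
  by congr inner; apply/funext => p; rewrite /= /prod_gen /tens /= mulrC.
rewrite (inner_swap LF (@L2_sm_gen _ _ m2 (ij.2, ij.1))) h.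
rewrite -(inner_swap Lp (@L2_sm_fun _ _ m2 (ij.2, ij.1))).
by congr inner; apply/funext => p; rewrite /= /prod_fun /tens /= mulrC.
Qed.

(** Symmetric functions on the model vanishing at the origin correspond to elements of [L20_sym],
    the swap being the same on both sides; [gamma] is the model of the cyclic vector given by
    [hs]. *)
Lemma symmetric_cyclic : exists2 gamma : m2 -> C, L2 M gamma &
  forall phi, L2 M phi -> (forall p, phi (swap p) = phi p) -> phi (sm_origin m2) = 0 ->
  exists2 psi : R * R -> C, cmeasurable psi & {ae M, forall x, phi x = psi (sm_sum x) * gamma x}.
Proof.
have hX2 := is_action_prod2 hX hX.
have [g gL gE] := hs; have [[Lg _] _] := gL.
have [gamma cg] := sm_corr_exists_r m2 hX2 Lg; have [_ Lgamma _] := cg.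
exists gamma => // phi Lp ps p0.
have [F cF] := sm_corr_exists_l hX2 Lp; have [LF _ _] := cF.
have := cyclic_span_function (@measurable_sm_sum R _ m2) Lgamma (f := phi).
apply.
apply/(sm_closed_span hX2 (m := m2) (e := fun z => koopman X2 z g)).
- by move=> z; exact: (sm_corr_koopman hX2).
- exact: cF.
rewrite -gE; split.
  apply/(sm_L20 hX2 cF); apply: aeW => x; rewrite /chi indicE.
  by have [/set_mem ->|_] := boolP (x \in _); rewrite ?p0 ?mulr0 ?mul0r.
have := sm_corr_swap cF; rewrite (_ : phi \o _ = phi); last exact/funext.
by move=> /(sm_corr_uniq cF); apply: filterS => p.
Qed.

(** An atom would give an eigenvector [F] of the action. Then $F\otimes\overline F$ is invariant
    under the square of the action, because its eigenvalues have modulus 1, and it has mean 0;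
    ergodicity of the square forces it to vanish. *)
Lemma sm_atom (a : m) : measurable [set a] -> a <> sm_origin m -> sm_prob m [set a] = 0%E.
Proof.
move=> ma ao; have hX2 := is_action_prod2 hX hX.
have La := L2_chi (sm_prob m) ma; have [F cF] := sm_corr_exists_l hX La.
have [LF _ _] := cF; have LJ := L2J LF.
have F20 : L20 (sys_prob X) F.
  apply/(sm_L20 hX cF); apply: aeW => x; rewrite /chi !indicE.
  have [/set_mem ->|_] := boolP (x \in [set sm_origin m]); last by rewrite mul0r.
  by rewrite [X in _ * (nat_of_bool X)%:R%:C%C]memNset ?mulr0//= => e; apply: ao.
have F1 : inner (sys_prob X) F (fun=> 1) = 0 by exact: F20.2.
have inv z : {ae sys_prob X, forall x : X, koopman X z F x = character z (sm_sum a) * F x}.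
  have := sm_corr_koopman hX z cF; rewrite (_ : (fun x => _) = fun x => character z (sm_sum a) * chi R [set a] x).
    by move=> c1; apply: sm_corr_uniq c1 _; exact: sm_corrZ.
  apply/funext => x; rewrite /chi indicE.
  by have [/set_mem ->//|_] := boolP (x \in _); rewrite !mulr0.
pose G := tens F (fun x => conjc (F x)).
have LG : L2 mu G by exact: L2_tens.
have Ginv : {ae mu, forall p : X2, koopman X2 (1, 0) G p = G p}.
  apply: filterS2 (ae_fst (sys_prob X) (inv (1, 0))) (ae_snd (sys_prob X) (inv (1, 0))).
  move=> [x y] /= e1 e2; rewrite /koopman /= in e1 e2 *; rewrite /G /tens /= e1 e2 conjcM.
  by rewrite mulrACA mulJ_cabs2 cabs2_character mul1r.
have L1 := L2_1 (sys_prob X).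
have G0 : {ae mu, forall p : X2, G p = 0}.
  apply: filterS (ergodic_constant_complex hX2 eX _ (L2_cintegrable LG) Ginv) => // p ->.
  transitivity (inner mu G (tens (fun=> 1) (fun=> 1))).
    by apply: eq_cintegral => q; rewrite /tens mulr1 conjc1 mulr1.
  by rewrite inner_tens// F1 mul0r.
have : inner mu G G = 0.
  rewrite -(inner0l LG); apply: ae_eq_inner; [exact: L2_cmeasurable LG|exact: cmeasurable_cst|exact: L2_cmeasurable LG..|exact: G0|exact: aeW].
rewrite inner_tens// => /eqP; rewrite mulf_eq0.
have -> : inner (sys_prob X) (fun x => conjc (F x)) (fun x => conjc (F x)) = inner (sys_prob X) F F.
  by apply: eq_cintegral => x; rewrite conjcK mulrC.
rewrite orbb (sm_corr_inner hX cF cF) => /eqP.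
have -> : inner (sm_prob m) (chi R [set a]) (chi R [set a]) = cintegral (sm_prob m) (chi R [set a]).
  apply: eq_cintegral => x; rewrite /chi indicE; case: (_ \in _); first by rewrite conjc1 mulr1.
  by rewrite mul0r.
rewrite cintegral_chi// => /(congr1 (@complex.Re R)) /= h.
by rewrite -[LHS]fineK ?h//; exact: fin_num_measure.
Qed.

(** Off the origin [u] is the quotient of the symmetric functions [u * c] and [c], where [c] is the
    indicator of the complement of the origin. Both are functions of the sum times [gamma], which
    cancels. *)
Lemma symmetric_function (u : m2 -> R) : measurable_fun setT u -> (forall p, `|u p| <= 1) ->
  (forall p, u (swap p) = u p) ->
  exists2 v : R * R -> R, measurable_fun setT v & {ae M, forall x, u x = v (sm_sum x)}.
Proof.
move=> mu' u1 us; have [gamma Lgamma H] := symmetric_cyclic.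
have hX2 := is_action_prod2 hX hX.
have mo := measurable_sm_origin m2; have mo' := measurableC mo.
pose c := chi R (~` [set sm_origin m2]).
have co : c (sm_origin m2) = 0 by rewrite /c /chi indicE memNset//=; apply.
have cs p : c (swap p) = c p.
  rewrite /c /chi !indicE; congr (_ %:R)%:C%C; congr nat_of_bool; apply/idP/idP => /set_mem /= h; apply/mem_set => /= e; apply: h.
    by rewrite e.
  by case: p e => x y [-> ->].
have [psi1 mpsi1 h1] : exists2 psi : R * R -> C, cmeasurable psi & {ae M, forall x, c x = psi (sm_sum x) * gamma x}.
  by apply: H => //; exact: L2_chi.
have [psi2 mpsi2 h2] : exists2 psi : R * R -> C, cmeasurable psi & {ae M, forall x, (u x)%:C%C * c x = psi (sm_sum x) * gamma x}.
  apply: H.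
  - apply: (@L2_bounded_mul _ _ _ _ 1); last exact: L2_chi.
      by split => //; exact: measurable_cst.
    by move=> x; rewrite /cabs2 /= expr0n addr0 -real_normK ?num_real// expr_le1.
  - by move=> p; rewrite cs us.
  - by rewrite co mulr0.
(* The quotient of [psi2] by [psi1] in real form; the denominator is nonzero off the origin, since
   [psi1 (s x) * gamma x = 1] there. *)
pose w y := complex.Re (psi2 y * conjc (psi1 y)) / cabs2 (psi1 y).
have mw : measurable_fun setT w.
  apply: measurable_funM; first by case: (cmeasurableM mpsi2 (cmeasurableJ mpsi1)).
  by apply: measurable_inv_ge0; [move=> y; exact: cabs2_ge0|exact: cmeasurable_cabs2].
(* The origin needs its own value; almost surely it is the only point with sum [(0, 0)]. *)
pose v y := if y == (0, 0) then u (sm_origin m2) else w y.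
exists v.
  apply: measurable_fun_if => //; last exact: measurable_funTS.
  apply: (measurable_fun_bool true).
  rewrite (_ : _ @^-1` _ = [set (0, 0)]); last by apply/seteqP; split=> y /= /eqP.
  by rewrite setTI; exact: measurable_set1_pair.
have h0 := sm_sum_eq0 m2 hX2 eX.
apply: filterS3 h0 h1 h2 => x h0 h1 h2; rewrite /v.
case: eqP => [/h0 -> //|s0].
have xo : x <> sm_origin m2.
  by move=> e; apply: s0; rewrite e sm_sum_origin.
have c1 : c x = 1 by rewrite /c /chi indicE mem_set.
rewrite c1 ?mulr1 in h1 h2; rewrite /w.
set a := psi1 _ in h1 *; set b := psi2 _ in h2 *.
have a0 : cabs2 a != 0.
  apply/eqP => /cabs2_eq0 a0; move: h1; rewrite a0 mul0r => /eqP.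
  by rewrite oner_eq0.
have E : (u x)%:C%C * (cabs2 a)%:C%C = b * conjc a.
  rewrite h2 -mulJ_cabs2; transitivity (b * conjc a * (a * gamma x)); first by ring.
  by rewrite -h1 mulr1.
rewrite -E ReZ /=; rewrite mulfK//.
Qed.

End Symmetric.
End ModelFacts.

(** * Fibred models *)

Section NatValued.
Context (R : realType) d (T : measurableType d).

Lemma measurable_nat_comp d' (S : measurableType d') (h : nat -> S) (f : T -> nat) :
  measurable_fun setT f -> measurable_fun setT (fun x => h (f x)).
Proof. by move=> mf; apply: (measurableT_comp _ mf) => _ Y _; rewrite setTI. Qed.

Lemma measurable_nat_pieces d' (S : measurableType d') (g : nat -> T -> S) (f : T -> nat) :
  measurable_fun setT f -> (forall n, measurable_fun setT (g n)) ->
  measurable_fun setT (fun x => g (f x) x).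
Proof.
move=> mf mg _ Y mY; rewrite setTI.
have -> : (fun x => g (f x) x) @^-1` Y = \bigcup_n (f @^-1` [set n] `&` g n @^-1` Y).
  by apply/seteqP; split=> [x Yx|x [n _ [/= -> ]]]//; exists (f x).
apply: bigcup_measurable => n _; apply: measurableI; first exact: measurable_preimage_nat.
by rewrite -[X in measurable X]setTI; exact: mg.
Qed.

Definition weight (n : nat) : \bar R := (n%:R)%:E.

Lemma weight_ge0 n : (0 <= weight n)%E. Proof. by rewrite lee_fin. Qed.

Lemma measurable_weight (f : T -> nat) (phi : T -> \bar R) :
  measurable_fun setT f -> measurable_fun setT phi ->
  measurable_fun setT (fun x => weight (f x) * phi x)%E.
Proof. by move=> mf mphi; apply: emeasurable_funM => //; exact: measurable_nat_comp. Qed.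

End NatValued.

Section FibredModels.
Context (R : realType).
Local Notation C := R[i].

Definition weak_limit_at (X : Z2system R) (w : nat -> int * int) (a : R) (v : int * int) :=
  weak_cvg (sys_prob X) (fun n => koopman X (w n)) (mix (sys_prob X) a (koopman X v)).

(* A spectral model whose space is fibred with finite fibres: [fm_base] maps each
   point to the representative of its fibre, [fm_idx] numbers the [fm_size x]
   points of the fibre of x, and [fm_rec] recovers a point from its number and
   its representative. [fm_fibre] says that the fibres are equidistributed.
   [fm_coord i] is the contribution of the i-th factor to [sm_sum]. *)
Record fibred_model (X : Z2system R) (K : nat)
    (Lim : nat -> (nat -> int * int) -> R -> int * int -> Prop) := FibredModel {
  fm_model :> spectral_model X;
  fm_idx : fm_model -> nat;
  fm_size : fm_model -> nat;
  fm_base : fm_model -> fm_model;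
  fm_rec : nat -> fm_model -> fm_model;
  fm_coord : nat -> fm_model -> (R * R)%type;
  fm_comb : (nat -> (R * R)%type) -> fm_model;
  measurable_fm_idx : measurable_fun setT fm_idx;
  measurable_fm_size : measurable_fun setT fm_size;
  measurable_fm_base : measurable_fun setT fm_base;
  measurable_fm_rec : forall n, measurable_fun setT (fm_rec n);
  measurable_fm_coord : forall i, measurable_fun setT (fm_coord i);
  fm_idx_lt : forall x, (fm_idx x < fm_size x)%N;
  fm_size_base : forall x, fm_size (fm_base x) = fm_size x;
  fm_recK : forall x, fm_rec (fm_idx x) (fm_base x) = x;
  fm_sum_base : forall x, sm_sum (fm_base x) = sm_sum x;
  fm_base_origin : forall x, fm_base x = sm_origin fm_model <-> x = sm_origin fm_model;
  fm_size_pow : forall x, exists2 j, (j <= K)%N & fm_size x = (2 ^ j)%N;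
  fm_size_origin : fm_size (sm_origin fm_model) = 1%N;
  fm_size1 : {ae sm_prob fm_model, forall x, fm_size x = 1%N -> x = sm_origin fm_model};
  fm_size_gt0 : forall j, (j <= K)%N ->
    (0 < sm_prob fm_model [set x | fm_idx x = 0%N /\ fm_size x = (2 ^ j)%N])%E;
  fm_fibre : forall (N : fm_model -> nat) (phi : fm_model -> \bar R),
    measurable_fun setT N -> measurable_fun setT phi -> (forall x, 0 <= phi x)%E ->
    (\int[sm_prob fm_model]_x (weight R (fm_idx x == N (fm_base x)) * phi (fm_base x)) =
     \int[sm_prob fm_model]_x
       (weight R ((fm_idx x == 0) && (N (fm_base x) < fm_size x))%N * phi (fm_base x)))%E;
  fm_character : forall z x,
    character z (sm_sum x) = \prod_(0 <= i < K) character z (fm_coord i x) :> C;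
  torus_fm_coord : forall i x, @torus R (fm_coord i x);
  fm_comb_ext : forall c c', (forall i, (i < K)%N -> c i = c' i) -> fm_comb c = fm_comb c';
  measurable_fm_comb : forall g : nat -> R * R -> R * R,
    (forall i, measurable_fun setT (g i)) -> measurable_fun setT (fun y => fm_comb (g^~ y));
  fm_base_comb : {ae sm_prob fm_model, forall x, fm_base x = fm_comb (fm_coord^~ x)};
  fm_weak : forall (w : nat -> int * int) (a : nat -> R) (v : nat -> int * int),
    (forall i, (i < K)%N -> 0 < a i /\ Lim i w (a i) (v i)) ->
    exists (c : fm_model -> R) (B : R), [/\ measurable_fun setT c, forall x, 0 < c x <= B &
      forall i j, ccvg
       (fun n => inner (sm_prob fm_model) (fun x => character (w n) (sm_sum x) * sm_fun i x) (sm_fun j))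
       (inner (sm_prob fm_model) (fun x => (c x)%:C%C * (\prod_(0 <= l < K) character (v l) (fm_coord l x))
          * sm_fun i x) (sm_fun j))] }.

(** * Products of fibred models *)

Section ProductFibred.
Variables (X Y : Z2system R) (K1 K2 : nat).
Variables (Lim1 Lim2 Lim : nat -> (nat -> int * int) -> R -> int * int -> Prop).
Variables (mX : fibred_model X K1 Lim1) (mY : fibred_model Y K2 Lim2).
Hypotheses (hX : is_action X) (hY : is_action Y).
Hypothesis hL1 : forall i, (i < K1)%N -> forall w a v, Lim i w a v -> Lim1 i w a v.
Hypothesis hL2 : forall i, (i < K2)%N -> forall w a v, Lim (K1 + i)%N w a v -> Lim2 i w a v.
Let m := prod_model mX mY hX hY.
Local Notation M := (sm_prob m).
Local Notation M1 := (sm_prob mX).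
Local Notation M2 := (sm_prob mY).

Let midx1 := @measurable_fm_idx _ _ _ mX.
Let midx2 := @measurable_fm_idx _ _ _ mY.
Let msize1 := @measurable_fm_size _ _ _ mX.
Let msize2 := @measurable_fm_size _ _ _ mY.
Let mbase1 := @measurable_fm_base _ _ _ mX.
Let mbase2 := @measurable_fm_base _ _ _ mY.

(** Mixed radix numbering of a product of two fibres, the radix being the size of the first;
    remainder and quotient recover the two numbers. *)
Definition pf_idx (p : m) : nat := (fm_idx p.1 + fm_size p.1 * fm_idx p.2)%N.
Definition pf_size (p : m) : nat := (fm_size p.1 * fm_size p.2)%N.
Definition pf_base (p : m) : m := (fm_base p.1, fm_base p.2).
Definition pf_rec n (p : m) : m := (fm_rec (n %% fm_size p.1) p.1, fm_rec (n %/ fm_size p.1) p.2).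
Definition pf_coord i (p : m) : (R * R)%type :=
  if (i < K1)%N then fm_coord i p.1 else fm_coord (i - K1)%N p.2.
Definition pf_comb (c : nat -> (R * R)%type) : m := (fm_comb mX c, fm_comb mY (fun i => c (K1 + i)%N)).

Lemma fm_size_pos (X' : Z2system R) K' L' (m' : fibred_model X' K' L') (x : m') : (0 < fm_size x)%N.
Proof. exact: leq_ltn_trans (fm_idx_lt x). Qed.

Lemma radix_eq a b s n : (a < s)%N -> (a + s * b == n)%N = (a == n %% s)%N && (b == n %/ s)%N.
Proof.
move=> as_; have s0 : (0 < s)%N by apply: leq_ltn_trans as_.
apply/eqP/andP => [<-|[/eqP -> /eqP ->]]; last by rewrite addnC mulnC -divn_eq.
by rewrite mulnC addnC modnMDl modn_small// divnMDl// divn_small// addn0.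
Qed.

Lemma measurable_1 d1 (T1 : measurableType d1) d2 (T2 : measurableType d2) d3 (T3 : measurableType d3)
  (f : T1 -> T3) : measurable_fun setT f -> measurable_fun setT (fun p : T1 * T2 => f p.1).
Proof. by move=> mf; exact: (measurableT_comp mf measurable_fst). Qed.

Lemma measurable_2 d1 (T1 : measurableType d1) d2 (T2 : measurableType d2) d3 (T3 : measurableType d3)
  (f : T2 -> T3) : measurable_fun setT f -> measurable_fun setT (fun p : T1 * T2 => f p.2).
Proof. by move=> mf; exact: (measurableT_comp mf measurable_snd). Qed.

Lemma measurable_pf_idx : measurable_fun setT pf_idx.
Proof.
apply: (measurable_nat2 addn); first exact: measurable_1.
by apply: (measurable_nat2 muln); [exact: measurable_1|exact: measurable_2].
Qed.

Lemma measurable_pf_size : measurable_fun setT pf_size.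
Proof. by apply: (measurable_nat2 muln); [exact: measurable_1|exact: measurable_2]. Qed.

Lemma measurable_pf_base : measurable_fun setT pf_base.
Proof. by apply: measurable_fun_pair; [exact: measurable_1|exact: measurable_2]. Qed.

Lemma measurable_pf_rec n : measurable_fun setT (pf_rec n).
Proof.
apply: measurable_fun_pair.
  apply: (measurable_1 (f := fun x : mX => fm_rec (n %% fm_size x) x)).
  apply: (measurable_nat_pieces (g := fun k x => fm_rec (n %% k) x)) => // k.
  exact: measurable_fm_rec.
apply: (measurable_nat_pieces (f := fun p : m => fm_size p.1) (g := fun k (p : m) => fm_rec (n %/ k) p.2)).
  exact: measurable_1.
by move=> k; apply: measurable_2; exact: measurable_fm_rec.
Qed.

Lemma measurable_pf_coord i : measurable_fun setT (pf_coord i).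
Proof.
have [iK|iK] := boolP (i < K1)%N.
  rewrite (_ : pf_coord i = fun p => fm_coord i p.1); last by apply/funext => p; rewrite /pf_coord iK.
  by apply: measurable_1; exact: measurable_fm_coord.
rewrite (_ : pf_coord i = fun p => fm_coord (i - K1)%N p.2); last by apply/funext => p; rewrite /pf_coord (negPf iK).
by apply: measurable_2; exact: measurable_fm_coord.
Qed.

(** The law of the first factor is applied with the second coordinate fixed, then that of the second
    factor with the first coordinate fixed. This is why [N] in [fm_fibre] may vary with the fibre:
    the digits of a constant number depend on the radix. *)
Lemma pf_fibre (N : m -> nat) (phi : m -> \bar R) :
  measurable_fun setT N -> measurable_fun setT phi -> (forall x, 0 <= phi x)%E ->
  (\int[M]_x (weight R (pf_idx x == N (pf_base x)) * phi (pf_base x)) =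
   \int[M]_x (weight R ((pf_idx x == 0) && (N (pf_base x) < pf_size x))%N * phi (pf_base x)))%E.
Proof.
move=> mN mphi phi0.
have mNb : measurable_fun setT (fun p => N (pf_base p)) by exact: (measurableT_comp mN measurable_pf_base).
have mpb : measurable_fun setT (fun p => phi (pf_base p)) by exact: (measurableT_comp mphi measurable_pf_base).
have ms1 : measurable_fun setT (fun p : mX * mY => fm_size p.1) by exact: measurable_1.
have mi1 : measurable_fun setT (fun p : mX * mY => fm_idx p.1) by exact: measurable_1.
have mi2 : measurable_fun setT (fun p : mX * mY => fm_idx p.2) by exact: measurable_2.
have w0 n p : (0 <= weight R n * phi p)%E by rewrite mule_ge0// weight_ge0.
have weightM (a b : bool) : weight R (a && b) = (weight R a * weight R b)%E.
  by rewrite /weight -EFinM -natrM mulnb.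
(* Midway between the two sides: the first number has been moved to 0, the second is still
   prescribed. *)
pose g (p : mX * mY) := (weight R ((fm_idx p.1 == 0)%N * (fm_idx p.2 == N (pf_base p) %/ fm_size p.1)%N) * phi (pf_base p))%E.
have mdiv : measurable_fun setT (fun p : mX * mY => N (pf_base p) %/ fm_size p.1)%N.
  exact: (measurable_nat2 divn mNb ms1).
have mg : measurable_fun setT g.
  apply: measurable_weight => //; apply: (measurable_nat2 muln).
    exact: (measurable_nat_comp (fun n => (n == 0)%N : nat) mi1).
  exact: (measurable_nat2 (fun a b => (a == b)%N : nat) mi2 mdiv).
have g0 p : (0 <= g p)%E by exact: w0.
pose F p := (weight R (pf_idx p == N (pf_base p))%N * phi (pf_base p))%E.
have mF : measurable_fun setT F.
  by apply: measurable_weight => //; exact: (measurable_nat2 (fun a b => (a == b)%N : nat) measurable_pf_idx mNb).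
pose G p := (weight R ((pf_idx p == 0) && (N (pf_base p) < pf_size p))%N * phi (pf_base p))%E.
have mG : measurable_fun setT G.
  apply: measurable_weight => //.
  have -> : (fun p => ((pf_idx p == 0) && (N (pf_base p) < pf_size p))%N : nat) =
      (fun p => (pf_idx p == 0)%N * (N (pf_base p) < pf_size p)%N)%N.
    by apply/funext => p; rewrite mulnb.
  apply: (measurable_nat2 muln).
    exact: (measurable_nat_comp (fun n => (n == 0)%N : nat) measurable_pf_idx).
  exact: (measurable_nat2 (fun a b => (a < b)%N : nat) mNb measurable_pf_size).
transitivity (\int[M2]_y \int[M1]_x g (x, y))%E.
  rewrite [LHS](fubini_tonelli2 (m1 := M1) (m2 := M2) F mF (fun p => w0 _ _)).
  apply: eq_integral => y _; rewrite /fubini_G.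
  (* A remainder is below the radix, so the condition [N1 < fm_size] produced by [fm_fibre] holds
     automatically; the condition on the quotient is put into [phi1]. *)
  pose N1 (b : mX) := (N (b, fm_base y) %% fm_size b)%N.
  pose phi1 (b : mX) := (weight R (fm_idx y == N (b, fm_base y) %/ fm_size b)%N * phi (b, fm_base y))%E.
  have mNy : measurable_fun setT (fun b => N (b, fm_base y)) by exact: measurable_slice mN.
  have mN1 : measurable_fun setT N1 by exact: (measurable_nat2 modn).
  have mphi1 : measurable_fun setT phi1.
    apply: measurable_weight; last exact: measurable_slice mphi.
    exact: (measurable_nat2 (fun n s => (fm_idx y == n %/ s)%N : nat)).
  have h := fm_fibre mN1 mphi1 (fun b => w0 _ _).
  transitivity (\int[M1]_x (weight R (fm_idx x == N1 (fm_base x)) * phi1 (fm_base x)))%E.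
    apply: eq_integral => x _; rewrite /F /phi1 /N1 /pf_idx /pf_base /=.
    by rewrite radix_eq ?fm_idx_lt// !fm_size_base weightM muleA.
  rewrite h; apply: eq_integral => x _; rewrite /g /phi1 /N1 /pf_base /= fm_size_base.
  by rewrite ltn_mod fm_size_pos andbT muleA -weightM mulnb.
transitivity (\int[M1]_x \int[M2]_y g (x, y))%E; first by rewrite [RHS]fubini_tonelli.
rewrite [RHS](fubini_tonelli1 (m1 := M1) (m2 := M2) G mG (fun p => w0 _ _)).
apply: eq_integral => x _; rewrite /fubini_F.
pose N2 (b : mY) := (N (fm_base x, b) %/ fm_size x)%N.
pose phi2 (b : mY) := (weight R (fm_idx x == 0)%N * phi (fm_base x, b))%E.
have mN2 : measurable_fun setT N2.
  apply: (measurable_nat_comp (fun n => n %/ fm_size x)%N).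
  by apply: (measurableT_comp mN); exact: measurable_pair1.
have mphi2 : measurable_fun setT phi2.
  apply: measurable_weight; first exact: measurable_cst.
  by apply: (measurableT_comp mphi); exact: measurable_pair1.
have h := fm_fibre mN2 mphi2 (fun b => w0 _ _).
transitivity (\int[M2]_y (weight R (fm_idx y == N2 (fm_base y)) * phi2 (fm_base y)))%E.
  apply: eq_integral => y _; rewrite /g /phi2 /N2 /pf_base /=.
  by rewrite mulnb andbC weightM muleA.
rewrite h; apply: eq_integral => y _; rewrite /G /phi2 /N2 /pf_base /pf_idx /pf_size /=.
rewrite muleA -weightM; congr (weight R _ * _)%E; congr nat_of_bool.
rewrite addn_eq0 muln_eq0 (gtn_eqF (fm_size_pos x)) /= ltn_divLR ?fm_size_pos// mulnC.
by rewrite andbC andbA.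
Qed.

(** On tensors the inner products factor, so the limits multiply, and with them the multipliers and
    their bounds. *)
Lemma pf_weak (w : nat -> int * int) (a : nat -> R) (v : nat -> int * int) :
  (forall i, (i < K1 + K2)%N -> 0 < a i /\ Lim i w (a i) (v i)) ->
  exists (c : m -> R) (B : R), [/\ measurable_fun setT c, forall x, 0 < c x <= B &
    forall i j, ccvg
     (fun n => inner M (fun x => character (w n) (sm_sum x) * sm_fun i x) (sm_fun j))
     (inner M (fun x => (c x)%:C%C * (\prod_(0 <= l < K1 + K2) character (v l) (pf_coord l x))
        * sm_fun i x) (sm_fun j))].
Proof.
move=> H; have [i iK|c1 [B1 [mc1 cB1 h1]]] := @fm_weak _ _ _ mX w a v.
  by have [a0 l] := H i (ltn_addr _ iK); split => //; exact: hL1.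
have [i iK|c2 [B2 [mc2 cB2 h2]]] := @fm_weak _ _ _ mY w (fun i => a (K1 + i)%N) (fun i => v (K1 + i)%N).
  have iK' : (K1 + i < K1 + K2)%N by rewrite ltn_add2l.
  by have [a0 l] := H _ iK'; split => //; exact: hL2.
exists (fun p => c1 p.1 * c2 p.2), (B1 * B2); split.
- by apply: measurable_funM; [exact: measurable_1|exact: measurable_2].
- move=> p; have /andP[p1 p2] := cB1 p.1; have /andP[q1 q2] := cB2 p.2.
  by rewrite mulr_gt0//= ler_pM// ltW.
move=> i j.
have Lb (Z : Z2system R) (mz : spectral_model Z) (c : mz -> R) (B : R) (q : mz -> C) k :
    measurable_fun setT c -> (forall x, 0 < c x <= B) -> cmeasurable q ->
    (forall x, cabs2 (q x) <= 1) -> L2 (sm_prob mz) (fun x => (c x)%:C%C * q x * sm_fun k x).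
  move=> mc cB mq q1; apply: (@L2_bounded_mul _ _ _ _ (B ^+ 2)) (L2_sm_fun k).
    by apply: cmeasurableM mq; split => //; exact: measurable_cst.
  move=> x; have /andP[x0 x1] := cB x; rewrite cabs2M.
  rewrite -[leRHS]mulr1 ler_pM ?cabs2_ge0//.
  by rewrite /cabs2 /= expr0n addr0 ler_pXn2r// nnegrE; [exact: ltW|apply: le_trans x1; exact: ltW].
have mprod (Z : Z2system R) (mz : spectral_model Z) (co : nat -> mz -> (R * R)%type) (u : nat -> int * int) n :
    (forall l, measurable_fun setT (co l)) ->
    cmeasurable (fun x => \prod_(0 <= l < n) character (u l) (co l x)) /\
    forall x, cabs2 (\prod_(0 <= l < n) character (u l) (co l x)) <= 1.
  move=> mco; elim: n => [|n [ih1 ih2]].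
    under eq_fun do rewrite big_nil; split; first exact: cmeasurable_cst.
    by move=> x; rewrite big_nil /cabs2 /= expr1n expr0n addr0.
  split=> [|x]; last by rewrite big_nat_recr//= cabs2M cabs2_character mulr1.
  under eq_fun do rewrite big_nat_recr//=.
  by apply: cmeasurableM => //; exact: cmeasurable_character_comp.
have [mp1 b1] := mprod _ mX (@fm_coord _ _ _ mX) v K1 (@measurable_fm_coord _ _ _ mX).
have [mp2 b2] := mprod _ mY (@fm_coord _ _ _ mY) (fun l => v (K1 + l)%N) K2 (@measurable_fm_coord _ _ _ mY).
have E : (fun x : m => (c1 x.1 * c2 x.2)%:C%C * (\prod_(0 <= l < K1 + K2) character (v l) (pf_coord l x)) * sm_fun i x) =
  tens (fun x => (c1 x)%:C%C * (\prod_(0 <= l < K1) character (v l) (fm_coord l x)) * sm_fun i.1 x)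
       (fun y => (c2 y)%:C%C * (\prod_(0 <= l < K2) character (v (K1 + l)%N) (fm_coord l y)) * sm_fun i.2 y).
  apply/funext => -[x y]; rewrite /tens /=.
  rewrite (big_cat_nat (n := K1))//=; last exact: leq_addr.
  rewrite (eq_big_nat _ _ (F2 := fun l => character (v l) (fm_coord l x))); last first.
    by move=> l /andP[_ lK]; rewrite /pf_coord lK.
  have -> : \prod_(K1 <= l < K1 + K2) character (v l) (pf_coord l (x, y)) =
      \prod_(0 <= l < K2) character (v (K1 + l)%N) (fm_coord l y) :> C.
    rewrite -{1}[K1]add0n big_addn addKn; apply: eq_bigr => l _.
    by rewrite addnC /pf_coord ltnNge leq_addr /= addKn.
  by rewrite rmorphM /prod_fun /tens /=; ring.
rewrite E; under eq_fun => n.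
  rewrite (_ : (fun x => character (w n) (sm_sum x) * sm_fun i x) =
    tens (fun x => character (w n) (sm_sum x) * sm_fun i.1 x) (fun y => character (w n) (sm_sum y) * sm_fun i.2 y)); last first.
    by apply/funext => p; rewrite /= /prod_sum character_tadd /prod_fun /tens mulrACA.
  rewrite (inner_tens (mu := M1) (nu := M2)); [|exact: L2_sm_character (L2_sm_fun _)|exact: L2_sm_character (L2_sm_fun _)|exact: L2_sm_fun..].
  over.
rewrite (inner_tens (mu := M1) (nu := M2)); [|exact: Lb mc1 cB1 mp1 b1|exact: Lb mc2 cB2 mp2 b2|exact: L2_sm_fun..].
by apply: ccvgM; [exact: h1|exact: h2].
Qed.

Lemma pf_character z (x : m) :
  character z (sm_sum x) = \prod_(0 <= i < K1 + K2) character z (pf_coord i x) :> C.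
Proof.
case: x => x y; rewrite /= /prod_sum character_tadd /= !fm_character.
rewrite [RHS](big_cat_nat (n := K1))//=; last exact: leq_addr.
congr (_ * _); first by apply: eq_big_nat => l /andP[_ lK]; rewrite /pf_coord lK.
have := @big_addn C 1 *%R 0 (K1 + K2)%N K1 xpredT (fun i => character z (pf_coord i (x, y))).
rewrite add0n addKn => ->; apply: eq_bigr => l _.
by rewrite addnC /pf_coord ltnNge leq_addr /= addKn.
Qed.

Lemma pf_size_gt0 j : (j <= K1 + K2)%N ->
  (0 < M [set x | pf_idx x = 0%N /\ pf_size x = (2 ^ j)%N])%E.
Proof.
(* Any splitting of the exponent within the two ranges would do; the first factor takes as much as
   it can. *)
move=> jK; pose j1 := minn j K1; pose j2 := (j - j1)%N.
have j1K : (j1 <= K1)%N by exact: geq_minr.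
have j2K : (j2 <= K2)%N by rewrite /j2 /j1; lia.
have jE : j = (j1 + j2)%N by rewrite /j2 subnKC// geq_minl.
have mA (Z : Z2system R) K' L' (mz : fibred_model Z K' L') l :
    measurable [set x : mz | fm_idx x = 0%N /\ fm_size x = l].
  rewrite (_ : [set x | _] = @fm_idx _ _ _ mz @^-1` [set 0%N] `&` @fm_size _ _ _ mz @^-1` [set l])//.
  apply: measurableI; apply: measurable_preimage_nat; [exact: measurable_fm_idx|exact: measurable_fm_size].
have mB : measurable [set x | pf_idx x = 0%N /\ pf_size x = (2 ^ j)%N].
  rewrite (_ : [set x | _] = pf_idx @^-1` [set 0%N] `&` pf_size @^-1` [set (2 ^ j)%N])//.
  apply: measurableI; apply: measurable_preimage_nat; [exact: measurable_pf_idx|exact: measurable_pf_size].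
apply: (@lt_le_trans _ _ (M ([set x : mX | fm_idx x = 0%N /\ fm_size x = (2 ^ j1)%N] `*`
    [set y : mY | fm_idx y = 0%N /\ fm_size y = (2 ^ j2)%N]))).
  rewrite [ltRHS]product_measure1E//; apply: mule_gt0; exact: fm_size_gt0.
apply: le_measure; rewrite ?inE//; first exact: measurableX.
move=> [x y] [/= [x0 x1] [y0 y1]]; rewrite /pf_idx /pf_size /= x0 x1 y0 y1 muln0; split => //.
by rewrite jE expnD.
Qed.

Definition fibred_prod : fibred_model (sys_prod2 X Y) (K1 + K2) Lim.
Proof.
refine (@FibredModel (sys_prod2 X Y) (K1 + K2) Lim m pf_idx pf_size pf_base pf_rec pf_coord pf_comb
  measurable_pf_idx measurable_pf_size measurable_pf_base measurable_pf_rec measurable_pf_coord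
  _ _ _ _ _ _ _ _ pf_size_gt0 pf_fibre pf_character _ _ _ _ pf_weak).
- move=> [x y]; rewrite /pf_idx /pf_size /=.
  have h1 := fm_idx_lt x; have h2 := fm_idx_lt y.
  apply: (@leq_trans (fm_size x + fm_size x * fm_idx y)); first by rewrite ltn_add2r.
  by rewrite -mulnS leq_mul2l h2 orbT.
- by move=> [x y]; rewrite /pf_size /= !fm_size_base.
- move=> [x y]; rewrite /pf_rec /pf_idx /= fm_size_base.
  have := radix_eq (fm_idx y) (fm_idx x + fm_size x * fm_idx y) (fm_idx_lt x).
  by rewrite eqxx => /esym /andP[/eqP <- /eqP <-]; rewrite !fm_recK.
- by move=> [x y]; rewrite /= /prod_sum /= !fm_sum_base.
- move=> [x y]; rewrite /pf_base /=; split=> [[/fm_base_origin -> /fm_base_origin ->]//|[-> ->]].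
  by congr pair; apply/fm_base_origin.
- move=> [x y]; have [j1 j1K e1] := fm_size_pow x; have [j2 j2K e2] := fm_size_pow y.
  by exists (j1 + j2)%N; [exact: leq_add|rewrite /pf_size /= e1 e2 expnD].
- by rewrite /pf_size /= !fm_size_origin.
- apply: filterS2 (ae_fst M2 (@fm_size1 _ _ _ mX)) (ae_snd M1 (@fm_size1 _ _ _ mY)).
  move=> [x y] /= h1 h2; rewrite /pf_size /= => /eqP; rewrite muln_eq1 => /andP[/eqP e1 /eqP e2].
  by rewrite (h1 e1) (h2 e2).
- by move=> i x; rewrite /pf_coord; case: ifP => _; exact: torus_fm_coord.
- move=> c c' cc; rewrite /pf_comb; congr pair; apply: fm_comb_ext => i iK; apply: cc.
    exact: ltn_addr.
  by rewrite ltn_add2l.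
- move=> g mg; apply: measurable_fun_pair; first exact: measurable_fm_comb.
  have h := @measurable_fm_comb _ _ _ mY (fun i => g (K1 + i)%N) (fun i => mg _); exact: h.
- apply: filterS2 (ae_fst M2 (@fm_base_comb _ _ _ mX)) (ae_snd M1 (@fm_base_comb _ _ _ mY)).
  move=> [x y] /= h1 h2; rewrite /pf_base /pf_comb /= h1 h2; congr pair; apply: fm_comb_ext => i iK.
    by rewrite /pf_coord iK.
  by rewrite /pf_coord ltnNge leq_addr /= addKn.
Defined.

End ProductFibred.
End FibredModels.

Section WeakConvergence.
Context (R : realType).
Local Notation C := R[i].

Lemma ccvg_of_cvg (u : nat -> C) (l : C) : (fun n => u n : C^o) @ \oo --> (l : C^o) -> ccvg u l.
Proof.
move=> /cvgrPdist_lt H; split; apply/cvgrPdist_lt => e e0.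
- have e0C : 0 < e%:C%C :> C by rewrite ltcR.
  apply: filterS (H _ e0C) => n h; rewrite -ReN -ReD -ltcR.
  by apply: le_lt_trans h; exact: normc_ge_Re.
- have e0C : 0 < e%:C%C :> C by rewrite ltcR.
  apply: filterS (H _ e0C) => n h; rewrite -ImN -ImD ReNi -ltcR.
  apply: le_lt_trans (normc_ge_Re _) _; rewrite normrM normc_def /= sqrrN expr1n expr0n add0r sqrtr1.
  by rewrite mul1r.
Qed.

End WeakConvergence.

Lemma ge0_integral_swap (R : realType) d (T : measurableType d) (mu : probability T R)
  (g : T * T -> \bar R) : measurable_fun setT g -> (forall p, 0 <= g p)%E ->
  (\int[mu \x mu]_p g (swap p) = \int[mu \x mu]_p g p)%E.
Proof.
move=> mg g0.
transitivity (\int[pushforward (mu \x mu)%E (@swap _ T)]_p g p)%E.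
  by apply: esym; apply: ge0_integral_pushforward => //; exact: measurable_swap.
apply: eq_measure_integral; first exact: measurable_swap.
by move=> ms A mA _; exact: mp_swap.
Qed.

(** * The fibred model of the square of one action *)

Section PairModel.
Context (R : realType).
Local Notation C := R[i].
Variable X : Z2system R.
Hypothesis hX : is_action X.
Local Notation nu := (sys_prob X).
Local Notation X2 := (sys_square X).
Hypothesis hs : simple_spectrum (sys_prob X2) (koopman X2) (L20_sym X).
Hypothesis eX : totally_ergodic X2.
Variables (f : X -> C) (sigma : probability (R * R)%type R).
Hypothesis cd : cyclic_data f sigma.
Let mS := single_model hX cd.
Let m2 : spectral_model X2 := prod_model mS mS hX hX.
Local Notation rho := (base_prob sigma).
Local Notation M := (sm_prob m2).
Local Notation B := (R * R)%type.

(** The multiplier of [mix a id]: [Theta] is multiplication by the indicator of the extra point, so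
    the value there is [a + (1 - a)], and [a] elsewhere. *)
Definition kappa (a : R) (x : B) : R := if x == origin R then 1 else a.

Lemma measurable_kappa a : measurable_fun setT (kappa a).
Proof.
apply: measurable_fun_if => //; apply: (measurable_fun_bool true).
rewrite (_ : _ @^-1` _ = [set origin R]); last by apply/seteqP; split=> y /= /eqP.
by rewrite setTI; exact: measurable_origin.
Qed.

Lemma kappaE a x : (kappa a x)%:C%C = a%:C%C + (1 - a)%:C%C * chi R [set origin R] x :> C.
Proof.
rewrite /kappa /chi indicE; case: eqP => [->|h].
  by rewrite mem_set// mulr1 -rmorphD /= addrC subrK.
by rewrite memNset// mulr0 addr0.
Qed.

(** [Theta] kills the orbit of [f], which has mean 0, and fixes the constants; multiplication by the
    indicator of the extra point does the same to the model functions. *)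
Lemma mean_single_gen i j : inner nu (Theta nu (single_gen f i)) (single_gen f j) =
  inner rho (fun x => chi R [set origin R] x * single_fun i x) (single_fun j).
Proof.
have Lf := (cyclic_L20 cd).1.
case: i => [z|].
  rewrite (_ : Theta nu _ = fun=> 0); last first.
    apply/funext => x; rewrite /Theta.
    transitivity (inner nu (koopman X z f) (fun=> 1)); last exact: (inner_single_gen0 hX cd).
    by apply: eq_cintegral => y; rewrite conjc1 mulr1.
  rewrite (_ : (fun x => _) = fun=> 0); last first.
    apply/funext => x; rewrite /single_fun /chi !indicE.
    have [/set_mem /= ->|_] := boolP (x \in [set origin R]); last by rewrite mul0r.
    by rewrite memNset ?mulr0 ?mul0r ?mulr0//=; apply.
  by rewrite !inner0l//; [exact: (L2_single_fun sigma)|exact: (L2_single_gen hX cd)].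
have -> : Theta nu (single_gen f None) = koopman X 0 (single_gen f None).
  apply/funext => x; rewrite /Theta /koopman /single_gen.
  transitivity (inner nu (fun=> 1 : C) (fun=> 1)); last exact: inner_1.
  by apply: eq_cintegral => y; rewrite conjc1 mulr1.
rewrite (single_gram hX cd); congr inner; apply/funext => x; rewrite character0 mul1r /single_fun.
rewrite /chi indicE; case: (_ \in _); first by rewrite mul1r.
by rewrite mulr0 mul0r.
Qed.

Lemma single_weak w a v i j : weak_limit_at X w a v ->
  ccvg (fun n => inner rho (fun x => character (w n) (frac2 x) * single_fun i x) (single_fun j))
       (inner rho (fun x => (kappa a x)%:C%C * character v (frac2 x) * single_fun i x) (single_fun j)).
Proof.
move=> H; have Li := L2_single_gen hX cd i; have Lj := L2_single_gen hX cd j.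
have := ccvg_of_cvg (H _ _ Li Lj).
have -> : inner nu (mix nu a (koopman X v) (single_gen f i)) (single_gen f j) =
   inner rho (fun x => (kappa a x)%:C%C * character v (frac2 x) * single_fun i x) (single_fun j).
  have Lv := L2_koopman hX v Li.
  have LT : L2 nu (Theta nu (single_gen f i)) by exact: L2_cst.
  rewrite /mix innerDl//; [|exact: L2Z|exact: L2Z].
  rewrite !innerZl// mean_single_gen (single_gram hX cd).
  have Lfi := L2_single_fun sigma i; have Lfj := L2_single_fun sigma j.
  have Lc : L2 rho (fun x => character v (frac2 x) * single_fun i x).
    by apply: L2_character Lfi; exact: measurable_frac2.
  have Lo : L2 rho (fun x => chi R [set origin R] x * single_fun i x).
    by apply: L2_bounded_mul Lfi; [exact: cmeasurable_chi (@measurable_origin R)|exact: cabs2_chi_le1].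
  rewrite -!innerZl// -innerDl//; [|exact: L2Z|exact: L2Z].
  congr inner; apply/funext => x; rewrite kappaE.
  rewrite [in RHS]/chi /chi indicE.
  have [/set_mem /= ->|_] := boolP (x \in [set origin R]).
    by rewrite frac2_origin character_0 !mulr1 !mul1r mulrDl.
  by rewrite !mulr0 mul0r !addr0 mulr0 addr0 mulrA.
by under eq_fun do rewrite (single_gram hX cd).
Qed.

(** The limits of the two copies multiply, and the two characters combine into one of the sum. The
    bound is the square of [1 + b], which dominates [kappa]. *)
Lemma pair_weak (w : nat -> int * int) (a : nat -> R) (v : nat -> int * int) :
  (forall i, (i < 1)%N -> 0 < a i /\ weak_limit_at X w (a i) (v i)) ->
  exists (c : m2 -> R) (D : R), [/\ measurable_fun setT c, forall x, 0 < c x <= D &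
    forall i j, ccvg
     (fun n => inner M (fun x => character (w n) (sm_sum x) * sm_fun i x) (sm_fun j))
     (inner M (fun x => (c x)%:C%C * (\prod_(0 <= l < 1) character (v l) (sm_sum x))
        * sm_fun i x) (sm_fun j))].
Proof.
move=> H; have [a0 Ha] := H 0%N isT; set b := a 0%N in a0 Ha *; set u := v 0%N in Ha *.
have k0 x : 0 < kappa b x <= 1 + b.
  by rewrite /kappa; case: ifP => _; rewrite ?ltr01 ?a0/= ?lerDl ?lerDr ?ltW.
exists (fun p : B * B => kappa b p.1 * kappa b p.2), ((1 + b) * (1 + b)); split.
- by apply: measurable_funM; [apply: measurable_1|apply: measurable_2]; exact: measurable_kappa.
- move=> p; have /andP[p1 p2] := k0 p.1; have /andP[q1 q2] := k0 p.2.
  by rewrite mulr_gt0//= ler_pM// ltW.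
move=> i j.
have Lk l : L2 rho (fun x => (kappa b x)%:C%C * character u (frac2 x) * single_fun l x).
  apply: (@L2_bounded_mul _ _ _ _ ((1 + b) ^+ 2)) (L2_single_fun sigma l).
    apply: cmeasurableM; last by apply: cmeasurable_character_comp; exact: measurable_frac2.
    by split; [exact: measurable_kappa|exact: measurable_cst].
  move=> x; have /andP[x0 x1] := k0 x; rewrite cabs2M cabs2_character mulr1.
  by rewrite /cabs2 /= expr0n addr0 ler_pXn2r// nnegrE; [exact: ltW|apply: le_trans x1; exact: ltW].
have E : (fun x : m2 => (kappa b x.1 * kappa b x.2)%:C%C * (\prod_(0 <= l < 1) character (v l) (sm_sum x)) * sm_fun i x) =
  tens (fun x => (kappa b x)%:C%C * character u (frac2 x) * single_fun i.1 x)
       (fun y => (kappa b y)%:C%C * character u (frac2 y) * single_fun i.2 y).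
  apply/funext => -[x y]; rewrite /tens /= big_nat1 /prod_sum character_tadd -/u.
  by rewrite rmorphM /prod_fun /tens /=; ring.
rewrite E; under eq_fun => n.
  rewrite (_ : (fun x => character (w n) (sm_sum x) * sm_fun i x) =
    tens (fun x => character (w n) (frac2 x) * single_fun i.1 x) (fun y => character (w n) (frac2 y) * single_fun i.2 y)); last first.
    by apply/funext => p; rewrite /= /prod_sum character_tadd /prod_fun /tens mulrACA.
  rewrite (inner_tens (mu := rho) (nu := rho));
    [|exact: (@L2_sm_character _ _ mS _ _ (L2_single_fun sigma _))|exact: (@L2_sm_character _ _ mS _ _ (L2_single_fun sigma _))|exact: (L2_single_fun sigma)..].
  over.
rewrite (inner_tens (mu := rho) (nu := rho)); [|exact: Lk|exact: Lk|exact: (L2_single_fun sigma)..].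
by apply: ccvgM; exact: single_weak.
Qed.

(** A measurable total order that selects one of the two orderings of a pair as its
    representative. *)
Definition lexle (x y : B) : bool := (x.1 < y.1) || ((x.1 == y.1) && (x.2 <= y.2)).

Lemma lexle_total x y : lexle x y || lexle y x.
Proof.
rewrite /lexle; have [//|h|e] := ltgtP x.1 y.1; first by rewrite orbT.
by rewrite /=; exact: le_total.
Qed.

Lemma lexle_anti x y : lexle x y -> lexle y x -> x = y.
Proof.
rewrite /lexle; case: x y => a b [c e] /=; have [//|//|->] := ltgtP a c => /= h1 h2.
by congr pair; apply/eqP; rewrite eq_le h1.
Qed.

Lemma lexle_refl x : lexle x x. Proof. by rewrite /lexle ltxx eqxx lexx. Qed.

Definition pair_idx (p : m2) : nat := ~~ lexle p.1 p.2.
Definition pair_size (p : m2) : nat := if p.1 == p.2 :> B then 1%N else 2%N.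
Definition pair_base (p : m2) : m2 := if lexle p.1 p.2 then p else swap p.
Definition pair_rec n (p : m2) : m2 := if n == 0%N then p else swap p.

Lemma measurable_coord4 : [/\ measurable_fun setT (fun p : B * B => p.1.1),
  measurable_fun setT (fun p : B * B => p.1.2), measurable_fun setT (fun p : B * B => p.2.1) &
  measurable_fun setT (fun p : B * B => p.2.2)].
Proof.
split; first exact: (measurableT_comp measurable_fst (@measurable_fst _ _ B B)).
- exact: (measurableT_comp measurable_snd (@measurable_fst _ _ B B)).
- exact: (measurableT_comp measurable_fst (@measurable_snd _ _ B B)).
- exact: (measurableT_comp measurable_snd (@measurable_snd _ _ B B)).
Qed.

Lemma measurable_lexle : measurable_fun setT (fun p : B * B => lexle p.1 p.2).
Proof.
have [h1 h2 h3 h4] := measurable_coord4.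
apply: measurable_or; first exact: measurable_fun_ltr.
by apply: measurable_and; [exact: measurable_fun_eqr|exact: measurable_fun_ler].
Qed.

Lemma measurable_pair_eq : measurable_fun setT (fun p : B * B => p.1 == p.2 :> B).
Proof.
have [h1 h2 h3 h4] := measurable_coord4.
rewrite (_ : (fun p => _) = fun p : B * B => (p.1.1 == p.2.1) && (p.1.2 == p.2.2)).
  by apply: measurable_and; exact: measurable_fun_eqr.
by apply/funext => -[[a b] [c e]]; rewrite xpair_eqE.
Qed.

Lemma measurable_pair_base : measurable_fun setT pair_base.
Proof.
apply: measurable_fun_if => //; first exact: measurable_lexle.
by apply: measurable_funTS; exact: measurable_swap.
Qed.

Lemma pair_base_swap p : pair_base (swap p) = pair_base p.
Proof.
case: p => x y; rewrite /pair_base /swap /=; have := lexle_total x y; have := @lexle_anti x y.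
by case: (lexle x y); case: (lexle y x) => // -> .
Qed.

Lemma pair_base_size p : pair_size (pair_base p) = pair_size p.
Proof. by rewrite /pair_base; case: ifP => // _; rewrite /pair_size /swap /= eq_sym. Qed.

(** By Fubini: off the extra point, the section of the diagonal over [x] is contained in the
    singleton of [x], which is null by [sm_atom]. *)
Lemma pair_diagonal : {ae M, forall p, pair_size p = 1%N -> p = sm_origin m2}.
Proof.
pose D := [set p : B * B | p.1 = p.2 /\ p.1 <> origin R].
have mo := measurableC (@measurable_origin R).
have mD : measurable D.
  have -> : D = (fun p : B * B => p.1 == p.2 :> B) @^-1` [set true] `&` fst @^-1` (~` [set origin R]).
    by apply/seteqP; split=> p [/= h1 h2]; split => //; apply/eqP.
  apply: measurableI.
    by rewrite -[X in measurable X]setTI; exact: measurable_pair_eq.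
  by rewrite -[X in measurable X]setTI; exact: measurable_fst.
have D0 : M D = 0%E.
  transitivity (\int[rho]_x (rho \o xsection D) x)%E; first by [].
  rewrite (eq_integral (cst 0%E)) ?integral_cst ?mul0e// => x _ /=.
  have [->|/eqP xo] := eqVneq x (origin R).
    rewrite (_ : xsection D _ = set0) ?measure0//.
    by apply/seteqP; split=> y //=; rewrite /xsection /= => /set_mem [].
  have mx : measurable [set x] by exact: measurable_set1_pair.
  have x0 : rho [set x] = 0%E by exact: (sm_atom (m := mS) hX eX mx xo).
  apply: (subset_measure0 _ mx _ x0); first exact: measurable_xsection.
  by move=> y; rewrite /xsection /= => /set_mem [/= <-].
exists D; split => //.
move=> [x y] /= h; split => /=.
  apply: contrapT => xy; apply: h; rewrite /pair_size /=.
  by case: eqP => // e; case: xy.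
move=> xo; apply: h; rewrite /pair_size /= xo; case: eqP => // <- _.
by [].
Qed.

(** The ordered pairs with [N = 0] contribute [F0] to both sides. The pairs numbered 1 on the left
    are the swapped images of the off-diagonal ordered pairs with [N = 1], which the right side
    counts as [F1]; the product measure is invariant under [swap]. *)
Lemma pair_fibre (N : m2 -> nat) (phi : m2 -> \bar R) :
  measurable_fun setT N -> measurable_fun setT phi -> (forall x, 0 <= phi x)%E ->
  (\int[M]_x (weight R (pair_idx x == N (pair_base x)) * phi (pair_base x)) =
   \int[M]_x (weight R ((pair_idx x == 0) && (N (pair_base x) < pair_size x))%N * phi (pair_base x)))%E.
Proof.
move=> mN mphi phi0.
have w0 n p : (0 <= weight R n * phi p)%E by rewrite mule_ge0// weight_ge0.
have wz : weight R 0 = 0%E by [].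
have mle := measurable_nat_of_bool measurable_lexle.
have mne : measurable_fun setT (fun p : B * B => (p.1 != p.2 :> B) : nat).
  by apply: measurable_nat_of_bool; apply: measurable_neg; exact: measurable_pair_eq.
have mN0 n : measurable_fun setT (fun p : B * B => (N p == n) : nat).
  exact: (measurable_nat_comp (fun k => (k == n) : nat) mN).
pose F0 (p : B * B) := (weight R (lexle p.1 p.2 * (N p == 0))%N * phi p)%E.
pose F1 (p : B * B) := (weight R (lexle p.1 p.2 * ((p.1 != p.2 :> B) * (N p == 1)))%N * phi p)%E.
have mF0 : measurable_fun setT F0.
  by apply: measurable_weight => //; apply: (measurable_nat2 muln) => //; exact: mN0.
have mF1 : measurable_fun setT F1.
  apply: measurable_weight => //; apply: (measurable_nat2 muln) => //.
  by apply: (measurable_nat2 muln) => //; exact: mN0.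
have mF1s : measurable_fun setT (F1 \o @swap _ B) by exact: (measurableT_comp mF1 (@measurable_swap _ B)).
have R1 : (\int[M]_x (weight R ((pair_idx x == 0) && (N (pair_base x) < pair_size x))%N * phi (pair_base x)) =
    \int[M]_x F0 x + \int[M]_x F1 x)%E.
  rewrite -ge0_integralD//; try by move=> p _; exact: w0.
  apply: eq_integral => -[x y] _; rewrite /F0 /F1 /pair_idx /pair_base /pair_size /=.
  case: (lexle x y) => /=; last by rewrite /weight /= !mul0e adde0.
  case: (eqVneq x y) => [_|_] /=; rewrite ?muln0 ?mul0n ?mul1n ?muln1; case: (N (x, y)) => [|[|n]] //=;
    by rewrite /weight /= ?mul0e ?mul1e ?adde0 ?add0e.
have L1 : (\int[M]_x (weight R (pair_idx x == N (pair_base x)) * phi (pair_base x)) =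
    \int[M]_x F0 x + \int[M]_x F1 (swap x))%E.
  rewrite -ge0_integralD//; try by move=> p _; exact: w0.
  apply: eq_integral => -[x y] _; rewrite /F0 /F1 /pair_idx /pair_base /swap /=.
  have [xy|yx] := boolP (lexle x y) => /=.
    have -> : (lexle y x * ((y != x) * (N (y, x) == 1)) = 0)%N.
      have [yx|//] := boolP (lexle y x); rewrite (lexle_anti xy yx) eqxx //=.
    by rewrite wz mul0e adde0 mul1n eq_sym.
  have := lexle_total x y; rewrite (negPf yx) /= => ->.
  have -> : (y != x) by apply/eqP => e; move: yx; rewrite e lexle_refl.
  by rewrite !mul1n mul0n wz mul0e add0e eq_sym.
rewrite L1 R1; congr (_ + _)%E; apply: (ge0_integral_swap rho mF1) => p; exact: w0.
Qed.

Lemma base_unit_interval : {ae rho, forall x : B, 0 <= x.1 <= 1 /\ 0 <= x.2 <= 1}.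
Proof.
apply: filterS (base_torus cd) => x [->|[/andP[h1 h2] /andP[h3 h4]]]; first by rewrite /origin /= ler01 lexx.
by rewrite h1 h3 !ltW.
Qed.

(** Each real coordinate of the ordered pair is a symmetric function of the pair, so
    [symmetric_function] applies to it. *)
Lemma pair_base_function : exists2 r : R * R -> m2, measurable_fun setT r &
  {ae M, forall p, pair_base p = r (sm_sum p)}.
Proof.
(* Makes the coordinates bounded everywhere; almost surely they lie in $[0,1]$ and are unchanged. *)
pose clamp (t : R) : R := Num.max 0 (Num.min 1 t).
have clamp1 t : `|clamp t| <= 1.
  rewrite ger0_norm /clamp ?le_max ?lexx// ge_max ler01 ge_min lexx//.
have clampE t : 0 <= t <= 1 -> clamp t = t.
  by move=> /andP[t0 t1]; rewrite /clamp min_r// max_r.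
have mclamp (h : B * B -> R) : measurable_fun setT h -> measurable_fun setT (fun p => clamp (h (pair_base p))).
  move=> mh; have mhp : measurable_fun setT (fun p => h (pair_base p)) by exact: (measurableT_comp mh measurable_pair_base).
  apply: measurable_maxr; first exact: measurable_cst.
  by apply: measurable_minr => //; exact: measurable_cst.
have key (h : B * B -> R) : measurable_fun setT h -> exists2 v : R * R -> R, measurable_fun setT v &
    {ae M, forall p : m2, clamp (h (pair_base p)) = v (sm_sum p)}.
  move=> mh.
  have := @symmetric_function R X mS hX hs eX (fun p => clamp (h (pair_base p))) (mclamp h mh).
  by apply=> p; [exact: clamp1|rewrite pair_base_swap].
have [h1 h2 h3 h4] := measurable_coord4.
have [v1 mv1 e1] := key _ h1; have [v2 mv2 e2] := key _ h2.
have [v3 mv3 e3] := key _ h3; have [v4 mv4 e4] := key _ h4.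
exists (fun y => ((v1 y, v2 y), (v3 y, v4 y))).
  by apply: measurable_fun_pair; exact: measurable_fun_pair.
have bu : {ae M, forall p : B * B, (0 <= p.1.1 <= 1 /\ 0 <= p.1.2 <= 1) /\ (0 <= p.2.1 <= 1 /\ 0 <= p.2.2 <= 1)}.
  by apply: filterS2 (ae_fst rho base_unit_interval) (ae_snd rho base_unit_interval) => p u1 u2.
apply: filterS3 bu (filterI e1 e2) (filterI e3 e4) => p [[u1 u2] [u3 u4]] [<- <-] [<- <-].
rewrite /pair_base; case: (lexle p.1 p.2); rewrite /swap /= !clampE//.
  by case: p {u1 u2 u3 u4} => -[a b] [c e].
by case: p {u1 u2 u3 u4} => -[a b] [c e].
Qed.

Lemma pair_size_gt0 j : (j <= 1)%N -> (0 < M [set x | pair_idx x = 0%N /\ pair_size x = (2 ^ j)%N])%E.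
Proof.
have mI : measurable_fun setT pair_idx.
  exact: (measurable_nat_of_bool (measurable_neg measurable_lexle)).
have mS' : measurable_fun setT pair_size.
  by apply: measurable_fun_if => //; [exact: measurable_pair_eq|exact: measurable_cst..].
have mA l : measurable [set x | pair_idx x = 0%N /\ pair_size x = l].
  rewrite (_ : [set x | _] = pair_idx @^-1` [set 0%N] `&` pair_size @^-1` [set l])//.
  by apply: measurableI; exact: measurable_preimage_nat.
have mo := @measurable_origin R; have mt := @torus_measurable R.
have o0 : (0 < rho [set origin R])%E by exact: (sm_origin_gt0 mS hX).
have t0 : (0 < rho (@torus R))%E.
  rewrite [ltRHS]mixtureE; apply: mule_gt0; first by rewrite lte_fin invr_gt0 ltr0n.
  apply: (@lt_le_trans _ _ (sigma (@torus R))); last by rewrite leeDr// lee_fin.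
  have := probability_setC sigma mt; rewrite (cyclic_torus cd) => h.
  rewrite lt0e measure_ge0 andbT; apply/eqP => s0; move: h; rewrite s0 sube0 => /eqP.
  by rewrite eq_sym onee_eq0.
case: j => [|[|//]] _.
- apply: (@lt_le_trans _ _ (M ([set origin R] `*` [set origin R]))).
    by rewrite [ltRHS]product_measure1E//; exact: mule_gt0.
  apply: le_measure; rewrite ?inE//; first exact: measurableX.
  by move=> [x y] [/= -> ->]; rewrite /pair_idx /pair_size /= lexle_refl eqxx.
(* The first coordinate of the extra point is 1, so every point of the torus precedes it
   lexicographically and such a pair has number 0. *)
- apply: (@lt_le_trans _ _ (M (@torus R `*` [set origin R]))).
    by rewrite [ltRHS]product_measure1E//; exact: mule_gt0.
  apply: le_measure; rewrite ?inE//; first exact: measurableX.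
  move=> [x y] [/= [/andP[x0 x1] tx2] ->]; rewrite /pair_idx /pair_size /lexle /= x1 /=; split => //.
  by case: eqP => // e; move: x1; rewrite e ltxx.
Qed.

Lemma pair_fibred_model (Lim : nat -> (nat -> int * int) -> R -> int * int -> Prop) :
  (forall w a v, Lim 0%N w a v -> weak_limit_at X w a v) -> inhabited (fibred_model X2 1 Lim).
Proof.
move=> hLim; have [r mr rE] := pair_base_function.
have mI : measurable_fun setT pair_idx.
  exact: (measurable_nat_of_bool (measurable_neg measurable_lexle)).
have mS' : measurable_fun setT pair_size.
  by apply: measurable_fun_if => //; [exact: measurable_pair_eq|exact: measurable_cst..].
constructor.
refine (@FibredModel R X2 1 Lim m2 pair_idx pair_size pair_base pair_rec
  (fun=> @sm_sum _ _ m2) (fun c => r (c 0%N)) mI mS' measurable_pair_base _ (fun=> @measurable_sm_sum _ _ m2)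
  _ pair_base_size _ _ _ _ _ pair_diagonal pair_size_gt0 pair_fibre _ (fun=> @torus_sm_sum _ _ m2) _ _ rE _).
- move=> n; rewrite /pair_rec; case: (n == 0%N); first exact: measurable_id.
  exact: measurable_swap.
- move=> p; rewrite /pair_idx /pair_size; case: eqP => [->|_]; first by rewrite lexle_refl.
  by case: (lexle _ _).
- by move=> [x y]; rewrite /pair_rec /pair_idx /pair_base /swap /=; case: (lexle x y).
- by move=> [x y]; rewrite /pair_base /swap /=; case: (lexle x y) => //; rewrite /= /prod_sum /= taddC.
- move=> [x y]; rewrite /pair_base /swap /=; case: (lexle x y) => //; split=> [[-> ->]|[-> ->]] //.
- move=> p; rewrite /pair_size; case: eqP => _; first by exists 0%N.
  by exists 1%N.
- by rewrite /pair_size /= eqxx.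
- by move=> z x; rewrite big_nat1.
- by move=> c c' cc; rewrite cc.
- by move=> g mg; exact: (measurableT_comp mr (mg 0%N)).
- move=> w a v H; apply: (pair_weak (a := a)) => -[//|//] _.
  by have [a0 h] := H 0%N isT; split => //; exact: hLim.
Qed.

End PairModel.

(** * Recursion over the factors and recovery of the coordinates *)

Section Recursion.
Context (R : realType).
Local Notation C := R[i].

Lemma is_action_sys_prod k (F : 'I_k.+1 -> Z2system R) :
  (forall i, is_action (F i)) -> is_action (sys_prod F).
Proof.
elim: k F => [|k ih] F hF /=; first exact: hF.
by apply: is_action_prod2; [apply: ih => i; exact: hF|exact: hF].
Qed.

(** Factors are addressed by natural numbers rather than ordinals, since products renumber the
    coordinates by addition. *)
Definition factor_limit k (T : 'I_k.+1 -> Z2system R) (i : nat) w a v :=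
  exists j : 'I_k.+1, j = i :> nat /\ weak_limit_at (T j) w a v.

(** Induction along [sys_prod], which splits off the last factor; the square of that factor
    contributes one more coordinate, with the last index. *)
Theorem fibred_model_exists k (T : 'I_k.+1 -> Z2system R) :
  (forall i, is_action (T i)) -> (forall i, lebesgue_space (sys_prob (T i))) ->
  (forall i, totally_ergodic (sys_square (T i))) ->
  (forall i, simple_spectrum (sys_prob (sys_square (T i))) (koopman (sys_square (T i))) (L20_sym (T i))) ->
  inhabited (fibred_model (sys_prod (fun i => sys_square (T i))) k.+1 (factor_limit T)).
Proof.
have pair k' (T' : 'I_k'.+1 -> Z2system R) i Lim : is_action (T' i) -> lebesgue_space (sys_prob (T' i)) ->
    totally_ergodic (sys_square (T' i)) ->
    simple_spectrum (sys_prob (sys_square (T' i))) (koopman (sys_square (T' i))) (L20_sym (T' i)) ->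
    (forall w a v, Lim 0%N w a v -> weak_limit_at (T' i) w a v) ->
    inhabited (fibred_model (sys_square (T' i)) 1 Lim).
  move=> h1 h2 h3 h4 h5; have [f [sigma cd]] := cyclic_data_exists h1 h2 h4.
  exact: (pair_fibred_model h1 h4 h3 cd).
elim: k T => [|k ih] T hT hL hE hs /=.
  by apply: pair => // w a v [j [_]]; rewrite (ord1 j).
have [m1] := ih (fun i => T (widen_ord (leqnSn _) i)) (fun i => hT _) (fun i => hL _) (fun i => hE _) (fun i => hs _).
have [m2] := pair _ T ord_max (fun=> weak_limit_at (T ord_max)) (hT _) (hL _) (hE _) (hs _) (fun w a v h => h).
have hX : is_action (sys_prod (fun i => sys_square (T (widen_ord (leqnSn k.+1) i)))).
  by apply: is_action_sys_prod => i; exact: is_action_prod2.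
have hY : is_action (sys_square (T ord_max)) by exact: is_action_prod2.
have : inhabited (fibred_model (sys_prod2 (sys_prod (fun i => sys_square (T (widen_ord (leqnSn k.+1) i))))
    (sys_square (T ord_max))) (k.+1 + 1) (factor_limit T)).
  constructor; apply: (fibred_prod m1 m2 hX hY).
  - move=> i ik w a v [j [ji h]]; exists (Ordinal ik); split => //.
    by rewrite (_ : widen_ord _ _ = j)//; exact: val_inj.
  - move=> [|//] _ w a v [j [ji h]]; rewrite (_ : ord_max = j)//; apply: val_inj => /=.
    by rewrite ji addn0.
by rewrite addn1.
Qed.

Lemma measurable_acos_clamp : measurable_fun setT (fun x : R => acos (Num.max (-1) (Num.min 1 x))).
Proof.
pose cl (x : R) := Num.max (-1) (Num.min 1 x).
have cl1 x : -1 <= cl x <= 1.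
  by rewrite /cl le_max lexx ge_max ge_min lexx /= andbT; lra.
have h : measurable_fun setT (fun x : R => - acos (cl x)).
  apply: nondecreasing_measurable => // x y xy; rewrite lerN2.
  have clxy : cl x <= cl y by rewrite /cl; apply: le_max2; [|apply: le_min2].
  rewrite leNgt; apply/negP => h; move: clxy; apply/negP; rewrite -ltNge.
  rewrite -[ltLHS]acosK ?in_itv//= -[ltRHS]acosK ?in_itv//=.
  by rewrite ltr_cos ?in_itv//= ?acos_ge0 ?acos_lepi.
rewrite (_ : (fun x => _) = fun x => - - acos (cl x)); first exact: measurableT_comp.
by apply/funext => x; rewrite opprK.
Qed.

(** The sign of the sine chooses between the arccosine and its reflection. The arccosine is clamped
    so as to be monotone on the whole line, hence measurable. *)
Lemma argument_function : exists2 g : R * R -> R, measurable_fun setT g &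
  forall t, 0 <= t < 1 -> g (cos (2 * pi * t), sin (2 * pi * t)) = t.
Proof.
pose A x := acos (Num.max (-1) (Num.min 1 x)) / (2 * pi) : R.
have mA : measurable_fun setT (fun p : R * R => A p.1).
  apply: measurable_funM; last exact: measurable_cst.
  exact: (measurableT_comp measurable_acos_clamp measurable_fst).
exists (fun p => if 0 <= p.2 then A p.1 else 1 - A p.1).
  apply: measurable_fun_if => //.
  - by apply: measurable_fun_ler; [exact: measurable_cst|exact: measurable_snd].
  - exact: measurable_funTS.
  - by apply: measurable_funTS; apply: measurable_funB => //; exact: measurable_cst.
have p0 := pi_gt0 R.
have AE t : 0 <= t <= 2^-1 -> A (cos (2 * pi * t)) = t.
  move=> ht; rewrite /A min_r ?cos_le1// max_r ?cos_geN1// cosK ?in_itv/= ?twopi_itv//.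
  by rewrite mulrAC divff ?mul1r// mulf_neq0// ?pnatr_eq0// gt_eqF.
move=> t t01; rewrite /= sin_half//; move/andP: t01 => [t0 t1]; have [th|th] := leP t 2^-1.
  by rewrite AE// t0.
by rewrite -cos_reflect AE; [ring|lra].
Qed.

Section Recover.
Variables (X : Z2system R) (K : nat) (Lim : nat -> (nat -> int * int) -> R -> int * int -> Prop).
Variable m : fibred_model X K Lim.
Hypothesis hlim : forall i v, (i < K)%N -> v = (1, 0) \/ v = (0, 1) ->
  exists w a, forall j, (j < K)%N -> 0 < a j /\ Lim j w (a j) (if j == i then v else 0).
Local Notation M := (sm_prob m).

Lemma fm_coord_character i v : (i < K)%N -> v = (1, 0) \/ v = (0, 1) ->
  exists2 p : R * R -> R * R, measurable_fun setT p &
    {ae M, forall x, (complex.Re (character v (fm_coord i x)), complex.Im (character v (fm_coord i x))) = p (sm_sum x)}.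
Proof.
move=> iK hv; have [w [a H]] := hlim iK hv.
have [c [B [mc cB h]]] := @fm_weak _ _ _ _ m w a (fun j => if j == i then v else 0) H.
pose q x : C := (c x)%:C%C * character v (fm_coord i x).
have prodE x : \prod_(0 <= l < K) character (if l == i then v else 0) (fm_coord l x) = character v (fm_coord i x) :> C.
  rewrite big_mkord (bigD1 (Ordinal iK))//= eqxx big1 ?mulr1// => j ji.
  have -> : (j == i :> nat) = false by apply/negbTE; move: ji; rewrite -val_eqE.
  by rewrite character0.
have mq : cmeasurable q.
  apply: cmeasurableM; last by apply: cmeasurable_character_comp; exact: measurable_fm_coord.
  by split => //; exact: measurable_cst.
(* At least 1, so that it bounds the characters as well as [q]. *)
pose D := 1 + `|B|.
have D1 : 1 <= D by rewrite /D lerDl.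
have D0 : 0 <= D by apply: le_trans D1.
have q1 x : cabs2 (q x) <= D ^+ 2.
  have /andP[c0 c1] := cB x.
  rewrite cabs2M cabs2_character mulr1 /cabs2 /= expr0n addr0 ler_pXn2r ?nnegrE ?(ltW c0)//.
  by apply: le_trans c1 _; rewrite /D; apply: le_trans (ler_norm B) _; rewrite lerDr.
have L1 : L2 M (fun=> 1 : C) by exact: L2_cst.
have Lq : L2 M q by apply: L2_bounded mq q1.
have [||psi mpsi qpsi] := weak_limit_function (mu := M) (s := @sm_sum _ _ m) _ (w := w) (q := q) Lq.
- exact: measurable_sm_sum.
- move=> g Lg.
  have := weak_multiplier_total (c := fun n x => character (w n) (sm_sum x)) (q := q) D0
    (@L2_sm_fun _ _ m) (@total_sm_fun _ _ m).
  move=> /(_ _ _ mq q1 _ _ _ L1 Lg).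
  rewrite (_ : (fun x => q x * 1) = q); last by apply/funext => x; rewrite mulr1.
  apply.
  + by move=> n; apply: cmeasurable_character_comp; exact: measurable_sm_sum.
  + by move=> n x; rewrite cabs2_character expr_ge1.
  + move=> k l; have := h k l; rewrite (_ : (fun x => _ * sm_fun k x) = (fun x => q x * sm_fun k x))//.
    by apply/funext => x; rewrite prodE.
(* The reciprocal of the modulus; where [psi (s x) = q x] it is the inverse of [c x], because
   characters have modulus 1. *)
pose N y := (cabs2 (psi y)) `^ (- 2^-1).
have mN : measurable_fun setT N.
  by apply: (measurableT_comp (@measurable_powR R (- 2^-1))); exact: cmeasurable_cabs2.
case: mpsi => mp1 mp2.
exists (fun y => (N y * complex.Re (psi y), N y * complex.Im (psi y))).
  by apply: measurable_fun_pair; exact: measurable_funM.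
apply: filterS qpsi => x e; have /andP[c0 _] := cB x.
have NE : N (sm_sum x) = (c x)^-1.
  rewrite /N -e /q cabs2M cabs2_character mulr1 /cabs2 /= expr0n addr0.
  rewrite -[c x ^+ 2]powR_mulrn ?ltW// -powRrM (_ : 2 * _ = -1) ?powR_inv1 ?ltW//.
  by rewrite mulrN mulfV// pnatr_eq0.
by rewrite NE -e /q ReZ ImZ !mulKf ?gt_eqF.
Qed.

Lemma fm_coord_function i : (i < K)%N -> exists2 h : R * R -> R * R, measurable_fun setT h &
  {ae M, forall x, fm_coord i x = h (sm_sum x)}.
Proof.
move=> iK; have [g mg gE] := argument_function.
have [p1 mp1 e1] := fm_coord_character iK (or_introl erefl).
have [p2 mp2 e2] := fm_coord_character iK (or_intror erefl).
exists (fun y => (g (p1 y), g (p2 y))).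
  by apply: measurable_fun_pair; exact: (measurableT_comp mg).
apply: filterS2 e1 e2 => x <- <-; have [t1 t2] := torus_fm_coord i x.
rewrite /character /= !mul1r !mul0r addr0 add0r !gE//.
by case: (fm_coord i x).
Qed.

Theorem fm_base_function : exists2 r : R * R -> m, measurable_fun setT r &
  {ae M, forall x, fm_base x = r (sm_sum x)}.
Proof.
have : forall i, exists h : R * R -> R * R, measurable_fun setT h /\
    {ae M, forall x, (i < K)%N -> fm_coord i x = h (sm_sum x)}.
  move=> i; have [iK|iK] := ltnP i K.
    by have [h mh hE] := fm_coord_function iK; exists h; split => //; apply: filterS hE.
  exists (fun=> (0, 0)); split; first exact: measurable_cst.
  by apply: aeW.
move=> /choice [h hP].
exists (fun y => fm_comb m (h^~ y)); first by apply: measurable_fm_comb => i; have [] := hP i.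
have : {ae M, forall x, forall i, (i < K)%N -> fm_coord i x = h i (sm_sum x)}.
  by apply: ae_foralln => i; have [] := hP i.
by apply: filterS2 (@fm_base_comb _ _ _ _ m) => x -> H; exact: fm_comb_ext.
Qed.

End Recover.
End Recursion.

(** * The multiplicity function *)

Section SpectralPart.
Context (R : realType) d (E : measurableType d) (M : probability E R).
Local Notation C := R[i].
Variables (s : E -> (R * R)%type) (D : set E).
Hypotheses (ms : measurable_fun setT s) (mD : measurable D).

Definition spectral_part (A : set (R * R)%type) : \bar R := M (s @^-1` A `&` D).

Let restricted : {measure set (R * R)%type -> \bar R} :=
  measure_function_pushforward__canonical__measure_function_Measure (mrestr M mD) ms.

Let spectral_part0 : spectral_part set0 = 0%E. Proof. exact: (measure0 restricted). Qed.

Let spectral_part_ge0 A : (0 <= spectral_part A)%E. Proof. exact: (measure_ge0 restricted). Qed.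

Let spectral_part_sigma_additive : semi_sigma_additive spectral_part.
Proof. exact: (@measure_semi_sigma_additive _ _ _ restricted). Qed.

HB.instance Definition _ := isMeasure.Build _ _ _ spectral_part
  spectral_part0 spectral_part_ge0 spectral_part_sigma_additive.

Let spectral_part_fin : fin_num_fun spectral_part.
Proof.
move=> A mA; apply: fin_num_measure; apply: measurableI => //.
by rewrite -[X in measurable X]setTI; exact: ms.
Qed.

HB.instance Definition _ := Measure_isFinite.Build _ _ _ spectral_part spectral_part_fin.

Definition spectral_part_measure : {finite_measure set (R * R)%type -> \bar R} := spectral_part.

(** Adding the restriction to the complement of [D], for which the integrand vanishes almost
    everywhere, restores [M]. *)
Lemma ge0_integral_mrestr (g : E -> \bar R) : measurable_fun setT g -> (forall x, 0 <= g x)%E ->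
  (\int[mrestr M mD]_x g x = \int[M]_x (g x * (\1_D x)%:E))%E.
Proof.
move=> mg g0; have mDc := measurableC mD.
pose gD x := (g x * (\1_D x)%:E)%E.
have mgD : measurable_fun setT gD.
  by apply: emeasurable_funM => //; apply/measurable_EFinP; exact: measurable_indic.
have gD0 x : (0 <= gD x)%E by rewrite mule_ge0// lee_fin.
have -> : (\int[M]_x gD x = \int[measure_add (mrestr M mD) (mrestr M mDc)]_x gD x)%E.
  apply: eq_measure_integral => A mA _.
  rewrite [RHS]measure_addE; transitivity (M (A `&` D) + M (A `\` D))%E; last by rewrite setDE.
  by rewrite addeC -measureDI.
rewrite ge0_integral_measure_add//.
have -> : (\int[mrestr M mDc]_x gD x = 0)%E.
  rewrite (ae_eq_integral (cst 0%E))//; first by rewrite integral_cst// mul0e.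
  exists D; split => //; first by transitivity (M (D `&` ~` D)); [|rewrite setICr measure0].
  move=> x /= h; apply: contrapT => xD; apply: h => _.
  by rewrite /gD indicE memNset// mule0.
rewrite adde0; apply: ae_eq_integral => //.
exists (~` D); split => //; first by transitivity (M (~` D `&` D)); [|rewrite setICl measure0].
move=> x /= h xD; apply: h => _.
by rewrite /gD indicE mem_set// mule1.
Qed.

Lemma Rintegral_spectral_part (f : R * R -> R) : measurable_fun setT f -> (forall y, `|f y| <= 1) ->
  \int[spectral_part]_y f y = \int[M]_x (f (s x) * \1_D x).
Proof.
move=> mf f1.
(* Adding 1 makes the function nonnegative, so that the change of variables for nonnegative
   functions applies; the constant is subtracted afterwards. *)
have m1 : measurable_fun setT (fun y => 1 + f y) by apply: measurable_funD => //; exact: measurable_cst.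
have p1 y : 0 <= 1 + f y by have := f1 y; rewrite ler_norml => /andP[h _]; lra.
have ge (g : R * R -> R) : measurable_fun setT g -> (forall y, 0 <= g y) ->
    \int[spectral_part]_y g y = \int[M]_x (g (s x) * \1_D x).
  move=> mg g0; congr fine.
  transitivity (\int[restricted]_y (g y)%:E)%E; first by apply: eq_measure_integral.
  transitivity (\int[mrestr M mD]_x (g (s x))%:E)%E.
    by apply: (ge0_integral_pushforward ms) => //; [exact/measurable_EFinP|move=> y _; rewrite lee_fin].
  apply: ge0_integral_mrestr; last by move=> x; rewrite lee_fin.
  by apply/measurable_EFinP; exact: (measurableT_comp mg ms).
have b (g : R * R -> R) c : measurable_fun setT g -> (forall y, `|g y| <= c) ->
    spectral_part_measure.-integrable setT (EFin \o g).
  move=> mg gc; apply: measurable_bounded_integrable => //.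
    by rewrite ltey_eq fin_num_measure.
  by exists c; split; [exact: num_real|move=> x cx y _ /=; apply: le_trans (gc y) _; exact: ltW].
have bM (g : E -> R) c : measurable_fun setT g -> (forall y, `|g y| <= c) ->
    M.-integrable setT (EFin \o g).
  move=> mg gc; apply: measurable_bounded_integrable => //.
    by rewrite ltey_eq fin_num_measure.
  by exists c; split; [exact: num_real|move=> x cx y _ /=; apply: le_trans (gc y) _; exact: ltW].
have E1 : f = (fun y => (1 + f y) - 1) by apply/funext => y; ring.
have i1 : spectral_part_measure.-integrable setT (EFin \o (fun y => 1 + f y)).
  apply: (b _ 2) => // y; apply: le_trans (ler_normD _ _) _; rewrite normr1.
  by have := f1 y; lra.
have i2 : spectral_part_measure.-integrable setT (EFin \o (fun y : R * R => 1 : R)).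
  by apply: (b _ 1) => //= y; rewrite normr1.
have mDi : measurable_fun setT (\1_D : E -> R) by exact: measurable_indic.
have D1 x : `|\1_D x : R| <= 1 by rewrite indicE; case: (_ \in _); rewrite ?normr1 ?normr0.
rewrite {1}E1 [LHS](RintegralB (mu := spectral_part_measure) measurableT i1 i2).
rewrite [X in X - _](ge (fun y => 1 + f y))// [X in _ - X](ge (fun=> 1))//.
rewrite -RintegralB//.
- by apply: eq_Rintegral => x _; ring.
- apply: (bM _ 2).
    by apply: measurable_funM => //; exact: (measurableT_comp m1 ms).
  move=> x; rewrite normrM; apply: (@le_trans _ _ (`|1 + f (s x)| * 1)).
    by rewrite ler_wpM2l.
  rewrite mulr1; apply: le_trans (ler_normD _ _) _; rewrite normr1.
  by have := f1 (s x); lra.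
- apply: (bM _ 1); first by under eq_fun do rewrite mul1r.
  by move=> x; rewrite mul1r.
Qed.

Lemma cintegral_spectral_part z : cintegral spectral_part_measure (character z) =
  cintegral M (fun x => character z (s x) * chi R D x).
Proof.
have [m1 m2] := cmeasurable_character R z.
apply: cplx_ext; rewrite /cintegral /=.
- transitivity (\int[M]_x (complex.Re (character z (s x)) * \1_D x)).
    by apply: Rintegral_spectral_part => // y; rewrite /character /= ler_norml cos_geN1 cos_le1.
  by apply: eq_Rintegral => x _; rewrite mulr0 subr0.
- transitivity (\int[M]_x (complex.Im (character z (s x)) * \1_D x)).
    by apply: Rintegral_spectral_part => // y; rewrite /character /= ler_norml sin_geN1 sin_le1.
  by apply: eq_Rintegral => x _; rewrite mulr0 add0r.
Qed.

End SpectralPart.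

(** * Decomposition into cyclic subspaces *)

Section Assembly.
Context (R : realType).
Local Notation C := R[i].
Variables (X : Z2system R) (K : nat) (Lim : nat -> (nat -> int * int) -> R -> int * int -> Prop).
Variable m : fibred_model X K Lim.
Hypothesis hX : is_action X.
Variable r : R * R -> m.
Hypothesis mr : measurable_fun setT r.
Local Notation mu := (sys_prob X).
Local Notation M := (sm_prob m).
Local Notation s := (@sm_sum R X m).
Local Notation o := (sm_origin m).
Hypothesis rE : {ae M, forall x, fm_base x = r (s x)}.

Let ms : measurable_fun setT s := @measurable_sm_sum R X m.
Let midx := @measurable_fm_idx _ _ _ _ m.
Let msize := @measurable_fm_size _ _ _ _ m.
Let mbase := @measurable_fm_base _ _ _ _ m.

(** On a slice a point is almost surely recovered from its sum, as [fm_rec n (r (s x))]; so the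
    functions on it form a cyclic subspace, generated by its indicator. Removing the origin removes
    the constants. *)
Definition slice n : set m := [set x | fm_idx x = n /\ x <> o].

Lemma measurable_slice_set n : measurable (slice n).
Proof.
rewrite (_ : slice n = @fm_idx _ _ _ _ m @^-1` [set n] `&` ~` [set o])//.
by apply: measurableI; [exact: measurable_preimage_nat|apply: measurableC; exact: measurable_sm_origin].
Qed.

Definition slice_measure n := spectral_part_measure M ms (measurable_slice_set n).
Definition multiplicity_set n : set (R * R)%type := [set y | (n < fm_size (r y))%N].

Lemma measurable_sum_preimage B : measurable B -> measurable (s @^-1` B).
Proof. by move=> mB; rewrite -[X in measurable X]setTI; exact: ms. Qed.

Lemma measurable_multiplicity_set n : measurable (multiplicity_set n).
Proof.
have h : measurable_fun setT (fun y => fm_size (r y)) by exact: (measurableT_comp msize mr).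
exact: (measurable_preimage_nat [set k | (n < k)%N] h).
Qed.

(** Equidistribution with the constant [N = n] and the indicator of [W], whose membership depends on
    the representative only. *)
Lemma slice_measure_size n B : measurable B ->
  slice_measure n B = M [set x | [/\ s x \in B, slice 0 x & (n < fm_size x)%N]].
Proof.
move=> mB; pose W := s @^-1` B `&` ~` [set o].
have mW : measurable W.
  by apply: measurableI; [exact: measurable_sum_preimage|apply: measurableC; exact: measurable_sm_origin].
have baseW x : (fm_base x \in W) = (x \in W).
  by apply/idP/idP => /set_mem[/= h1 h2]; apply/mem_set; split; rewrite /= ?fm_sum_base// in h1 *;
    move=> e; apply: h2; apply/fm_base_origin.
have := @fm_fibre _ _ _ _ m (fun=> n) (fun x => (\1_W x)%:E) (measurable_cst n).
have m1 : measurable_fun setT (fun x => (\1_W x : R)%:E) by apply/measurable_EFinP; exact: measurable_indic.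
move=> /(_ m1) H.
have mS : measurable (s @^-1` B `&` slice n).
  by apply: measurableI; [exact: measurable_sum_preimage|exact: measurable_slice_set].
pose V := [set x | [/\ s x \in B, slice 0 x & (n < fm_size x)%N]].
have mV : measurable V.
  rewrite (_ : V = s @^-1` B `&` slice 0 `&` @fm_size _ _ _ _ m @^-1` [set k | (n < k)%N]).
    apply: measurableI; last exact: measurable_preimage_nat.
    by apply: measurableI; [exact: measurable_sum_preimage|exact: measurable_slice_set].
  by apply/seteqP; split=> x => [[/set_mem h1 h2 h3]|[[h1 h2] h3]]; split => //; exact: mem_set.
have {}H := H (fun x => _).
transitivity (\int[M]_x (\1_(s @^-1` B `&` slice n) x)%:E)%E; first by rewrite integral_indic// setIT.
transitivity (\int[M]_x (\1_V x)%:E)%E; last by rewrite integral_indic// setIT.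
transitivity (\int[M]_x (weight R (fm_idx x == n) * (\1_W (fm_base x))%:E))%E.
  apply: eq_integral => x _; rewrite !indicE baseW /weight -EFinM -natrM mulnb; congr (_ %:R)%:E; congr nat_of_bool.
  apply/idP/andP => [/set_mem[/= h1 [h2 h3]]|[/eqP h1 /set_mem[/= h2 h3]]].
    by split; [exact/eqP|exact: mem_set].
  by apply/mem_set.
rewrite H; last by move=> x; rewrite lee_fin.
apply: eq_integral => x _; rewrite !indicE baseW /weight -EFinM -natrM mulnb; congr (_ %:R)%:E; congr nat_of_bool.
apply/andP/idP => [[/andP[/eqP h1 h2] /set_mem[/= h3 h4]]|/set_mem[/= /set_mem h1 [h2 h3] h4]].
  by apply/mem_set; split => //; exact: mem_set.
by split; [rewrite h2 eqxx|exact: mem_set].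
Qed.

(** Because [r] recovers the representative from the sum, the size of the fibre is almost everywhere
    a function of the sum, and the condition on the size becomes a condition on the spectral
    side. *)
Lemma slice_measure_multiplicity n B : measurable B ->
  slice_measure n B = slice_measure 0 (B `&` multiplicity_set n).
Proof.
move=> mB; have mBA : measurable (B `&` multiplicity_set n).
  by apply: measurableI => //; exact: measurable_multiplicity_set.
rewrite slice_measure_size//.
transitivity (M (s @^-1` (B `&` multiplicity_set n) `&` slice 0)); last by [].
apply: ae_eq_measure.
- rewrite (_ : [set x | _] = s @^-1` B `&` slice 0 `&` @fm_size _ _ _ _ m @^-1` [set k | (n < k)%N]).
    apply: measurableI; last exact: measurable_preimage_nat.
    by apply: measurableI; [exact: measurable_sum_preimage|exact: measurable_slice_set].
  by apply/seteqP; split=> x => [[/set_mem h1 h2 h3]|[[h1 h2] h3]]; split => //; exact: mem_set.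
- by apply: measurableI; [exact: measurable_sum_preimage|exact: measurable_slice_set].
apply: filterS rE => x e; split=> [[/set_mem h1 h2 h3]|[[/= h1 h2] h3]].
  by split => //; split => //=; rewrite /multiplicity_set /= -e fm_size_base.
split=> //; first exact: mem_set.
by move: h2; rewrite /multiplicity_set /= -e fm_size_base.
Qed.

Lemma sum_indic_size y :
  (\sum_(0 <= n <oo) (\1_(multiplicity_set n) y : R)%:E)%E = ((fm_size (r y))%:R)%:E.
Proof.
set N := fm_size (r y).
have nn k : (0 <= k)%N -> (0%:E <= (\1_(multiplicity_set k) y : R)%:E)%E by rewrite lee_fin.
rewrite (nneseries_split 0 N)// eseries0 ?adde0; last first.
  by move=> k; rewrite add0n => Nk _; rewrite indicE memNset// /multiplicity_set /= -/N; apply/negP; rewrite -leqNgt.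
rewrite add0n (eq_big_nat _ _ (F2 := fun=> 1%:E)).
  by rewrite sumEFin; congr EFin; rewrite sumr_const_nat subn0.
by move=> k /andP[_ kN]; rewrite indicE mem_set.
Qed.

Lemma chi_slice_origin n x : chi R [set o] x * chi R (slice n) x = 0.
Proof.
rewrite /chi !indicE; have [/set_mem /= ->|_] := boolP (x \in [set o]); last by rewrite mul0r.
by rewrite memNset ?mulr0// => -[].
Qed.

Lemma conjc_chi (A : set m) x : conjc (chi R A x) = chi R A x.
Proof. by apply: cplx_ext; rewrite ?ReJ ?ImJ /chi /= ?oppr0. Qed.

(** The cyclic vectors [h n] correspond to the indicators of the slices. Disjointness gives
    orthogonality, [slice_measure_size] the decrease of the spectral measures, and
    [slice_measure_multiplicity] their supports; the multiplicity at [y] is the size of the fibre of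
    [r y]. *)
Theorem spectral_multiplicities : has_spectral_multiplicities mu (koopman X) (L20 mu)
  [set v : \bar R | exists2 j : nat, (1 <= j <= K)%N & v = ((2 ^ j)%N%:R)%:E].
Proof.
have Lc n := L2_chi M (measurable_slice_set n).
have /boolp.choice [h hc] n : exists g : X -> C, sm_corr m g (chi R (slice n)).
  exact: sm_corr_exists_l.
have Lh n : L2 mu (h n) by case: (hc n).
have hzc n z : sm_corr m (koopman X z (h n)) (fun x => character z (s x) * chi R (slice n) x).
  exact: (sm_corr_koopman hX).
have Lzh (i : nat * (int * int)) : L2 mu (koopman X i.2 (h i.1)) by exact: L2_koopman.
have h20 n z : L20 mu (koopman X z (h n)).
  apply/(sm_L20 hX (hzc n z)); apply: aeW => x.
  by rewrite mulrCA chi_slice_origin mulr0.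
exists (slice_measure 0%N), (fun y => (\sum_(0 <= n <oo) (\1_(multiplicity_set n) y : R)%:E)%E); split.
- exists h, slice_measure, multiplicity_set; split.
  + split=> [n|n n' z z' nn].
      by apply/(sm_L20 hX (hc n)); apply: aeW => x; exact: chi_slice_origin.
    rewrite (sm_corr_inner hX (hzc n z) (hzc n' z')).
    rewrite (_ : inner M _ _ = cintegral M (fun=> 0)); last first.
      apply: eq_cintegral => x; rewrite conjcM mulrACA.
      rewrite (_ : chi R (slice n) x * conjc (chi R (slice n') x) = 0) ?mulr0//.
      rewrite conjc_chi /chi !indicE; have [/set_mem /= [xn _]|_] := boolP (x \in slice n); last by rewrite mul0r.
      rewrite memNset ?mulr0// => -[xn' _].
      by case/eqP: nn; rewrite -xn -xn'.
    by apply: cplx_ext; rewrite /= Rintegral_cst// mul0r.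
  + apply/seteqP; split=> F; last first.
      move=> cF; split; first exact: cF.1.
      move=> c; apply: (inner_closed_span0 Lzh cF); first exact: L2_cst.
      by move=> i; exact: (h20 i.1 i.2).2.
    move=> [LF F0]; have [P cP PF] := projection Lzh LF; have LP := cP.1.
    have LG := L2B LF LP.
    have G20 : L20 mu (fun x => F x - P x).
      split => // c; have Lcc : L2 mu (cst c) by exact: L2_cst.
      rewrite innerBl// F0 (inner_closed_span0 Lzh cP)// ?subr0//.
      by move=> i; exact: (h20 i.1 i.2).2.
    have [gamma cg] := sm_corr_exists_r m hX LG; have [_ Lg _] := cg.
    have go := (sm_L20 hX cg).1 G20.
    (* The residual [F - P] is orthogonal to the orbit of every [h n], so Fourier uniqueness kills
       its model [gamma] slice by slice; the origin is covered by [go]. *)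
    have gz n : {ae M, forall x, chi R (slice n) x * gamma x = 0}.
      have Lcg : L2 M (fun x => chi R (slice n) x * gamma x).
        apply: L2_bounded_mul Lg; first exact: cmeasurable_chi (measurable_slice_set n).
        exact: cabs2_chi_le1.
      apply: (@fourier_total R _ _ M s (fun y => fm_rec n (r y)) ms (@torus_sm_sum R X m)).
      * exact: (measurableT_comp (@measurable_fm_rec _ _ _ _ m n) mr).
      * exact: L2_cintegrable Lcg.
      * apply: filterS rE => x e; rewrite /chi indicE.
        have [/set_mem [xn _]|_] := boolP (x \in slice n); last by left; rewrite mul0r.
        by right; rewrite -e -xn fm_recK.
      * move=> z; rewrite -[RHS](PF (n, - z)) (sm_corr_inner hX cg (hzc n (- z))).
        apply: eq_cintegral => x; rewrite conjcM characterN conjcK.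
        by rewrite conjc_chi; ring.
    have g0 : {ae M, forall x, gamma x = 0}.
      have : {ae M, forall x, forall n, chi R (slice n) x * gamma x = 0} by exact: ae_foralln.
      apply: filterS2 go => x xo xn; have [e|xno] := pselect (x = o).
        by move: xo; rewrite /chi indicE mem_set ?mul1r.
      by move: (xn (fm_idx x)); rewrite /chi indicE mem_set ?mul1r.
    have G0 : {ae mu, forall x, F x - P x = 0}.
      apply: nsq_inner0 => //; rewrite (sm_corr_inner hX cg cg).
      rewrite -(inner0l Lg); apply: ae_eq_inner; [exact: L2_cmeasurable Lg|exact: cmeasurable_cst|exact: L2_cmeasurable Lg..|exact: g0|exact: aeW].
    apply: (closed_span_ae Lzh (L2_cmeasurable LF) _ cP).
    by apply: filterS G0 => x /eqP; rewrite subr_eq0 => /eqP.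
  + move=> n; split.
      transitivity (M set0); last exact: measure0.
      congr (M _); apply/seteqP; split=> x //= -[h1 _].
      by apply: h1; exact: torus_sm_sum.
    move=> z; rewrite (sm_corr_inner hX (hzc n z) (hc n)) cintegral_spectral_part.
    apply: eq_cintegral => x; rewrite -mulrA; congr (_ * _).
    rewrite conjc_chi /chi indicE; case: (_ \in _); first by rewrite mulr1.
    by rewrite mul0r.
  + move=> n; apply/null_content_dominatesP => B mB h0.
    move: (h0 : slice_measure n B = 0%E); rewrite slice_measure_size// => {}h0.
    rewrite slice_measure_size//.
    have mV k : measurable [set x | [/\ s x \in B, slice 0 x & (k < fm_size x)%N]].
      rewrite (_ : [set x | _] = s @^-1` B `&` slice 0 `&` @fm_size _ _ _ _ m @^-1` [set j | (k < j)%N]).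
        apply: measurableI; last exact: measurable_preimage_nat.
        by apply: measurableI; [exact: measurable_sum_preimage|exact: measurable_slice_set].
      by apply/seteqP; split=> x => [[/set_mem h1 h2 h3]|[[h1 h2] h3]]; split => //; exact: mem_set.
    apply: (subset_measure0 (mV _) (mV n) _ h0) => x [h1 h2 h3]; split => //.
    exact: ltnW.
  + split=> //; first exact: measurable_multiplicity_set.
    by move=> n B mB; rewrite slice_measure_multiplicity.
have msr : measurable_fun setT (fun y => fm_size (r y)) by exact: (measurableT_comp msize mr).
have sizeE (v : \bar R) : slice_measure 0%N [set y | ((fm_size (r y))%:R)%:E = v] =
    M [set x | slice 0 x /\ ((fm_size x)%:R)%:E = v].
  transitivity (M (s @^-1` [set y | ((fm_size (r y))%:R)%:E = v] `&` slice 0)); first by [].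
  apply: ae_eq_measure.
  - apply: measurableI; last exact: measurable_slice_set.
    apply: measurable_sum_preimage.
    exact: (measurable_preimage_nat [set k | (k%:R)%:E = v] msr).
  - rewrite (_ : [set x | _] = slice 0 `&` @fm_size _ _ _ _ m @^-1` [set k | (k%:R)%:E = v])//.
    by apply: measurableI; [exact: measurable_slice_set|exact: measurable_preimage_nat].
  - by apply: filterS rE => x e; rewrite /= -e fm_size_base; split=> -[].
apply/seteqP; split=> v.
- move=> [j /andP[j1 jK] ->]; rewrite /essential_values /=.
  rewrite (_ : _ @^-1` _ = [set y | ((fm_size (r y))%:R)%:E = ((2 ^ j)%N%:R)%:E :> \bar R]); last first.
    by apply/seteqP; split=> y /=; rewrite sum_indic_size.
  rewrite sizeE; apply: lt_le_trans (fm_size_gt0 m jK) _; apply: le_measure; rewrite ?inE.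
  + rewrite (_ : [set x | _] = @fm_idx _ _ _ _ m @^-1` [set 0%N] `&` @fm_size _ _ _ _ m @^-1` [set (2 ^ j)%N])//.
    by apply: measurableI; exact: measurable_preimage_nat.
  + rewrite (_ : [set x | _] = slice 0 `&` @fm_size _ _ _ _ m @^-1` [set k | (k%:R)%:E = ((2 ^ j)%N%:R)%:E :> \bar R])//.
    by apply: measurableI; [exact: measurable_slice_set|exact: measurable_preimage_nat].
  + move=> x [/= x0 xs]; split; last by rewrite xs.
    split => // xo; move: xs; rewrite xo fm_size_origin => /esym/eqP.
    by rewrite -(expn0 2) eqn_exp2l// => /eqP j0; rewrite j0 in j1.
(* Sizes are powers of 2 with exponent at most [K], so another value could only come from the
   exponent 0; almost surely this occurs at the origin alone, which no slice contains. *)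
- rewrite /essential_values /= => vpos; apply: contrapT => hv.
  move: vpos; rewrite (_ : _ @^-1` _ = [set y | ((fm_size (r y))%:R)%:E = v]); last first.
    by apply/seteqP; split=> y /=; rewrite sum_indic_size.
  rewrite sizeE; apply/negP; rewrite -leNgt.
  have mV : measurable [set x : m | slice 0 x /\ ((fm_size x)%:R)%:E = v].
    rewrite (_ : [set x | _] = slice 0 `&` @fm_size _ _ _ _ m @^-1` [set k | (k%:R)%:E = v])//.
    by apply: measurableI; [exact: measurable_slice_set|exact: measurable_preimage_nat].
  have [N [mN N0 NP]] := @fm_size1 _ _ _ _ m.
  rewrite (subset_measure0 mV mN _ N0)// => x [[x0 xo] xv]; apply: NP => /= H.
  have [j jK xj] := fm_size_pow x.
  have [j0|jpos] := posnP j; first by apply: xo; apply: H; rewrite xj j0.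
  by apply: hv; exists j; [rewrite jpos|rewrite -xv xj].
Qed.

End Assembly.

Theorem mainTheorem3 (R : realType) (k : nat) (T : 'I_k.+1 -> Z2system R)
  (hT : forall i, is_action (T i))
  (hL : forall i, lebesgue_space (sys_prob (T i)))
  (hE : totally_ergodic (sys_prod (fun i => sys_square (T i))))
  (hsimple : forall i,
    simple_spectrum (sys_prob (sys_square (T i)))
      (koopman (sys_square (T i))) (L20_sym (T i)))
  (hweak : forall i, exists (w u : nat -> int * int) (a b : 'I_k.+1 -> R),
    [/\ forall j, 0 < a j /\ 0 < b j,
        weak_cvg (sys_prob (T i)) (fun n => koopman (T i) (w n))
          (mix (sys_prob (T i)) (a i) (koopman (T i) (1, 0))),
        forall j, j != i ->
          weak_cvg (sys_prob (T j)) (fun n => koopman (T j) (w n))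
            (mix (sys_prob (T j)) (a j) id),
        weak_cvg (sys_prob (T i)) (fun n => koopman (T i) (u n))
          (mix (sys_prob (T i)) (b i) (koopman (T i) (0, 1))) &
        forall j, j != i ->
          weak_cvg (sys_prob (T j)) (fun n => koopman (T j) (u n))
            (mix (sys_prob (T j)) (b j) id)]) :
  let X := sys_prod (fun i => sys_square (T i)) in
  has_spectral_multiplicities (sys_prob X) (koopman X) (L20 (sys_prob X))
    [set v : \bar R | exists2 j : nat, (1 <= j <= k.+1)%N & v = ((2 ^ j)%N%:R)%:E].

Proof.
have hE' i : totally_ergodic (sys_square (T i)) by apply: (@totally_ergodic_factor R k _ hE).
have [m] := fibred_model_exists hT hL hE' hsimple.
have hX : is_action (sys_prod (fun i => sys_square (T i))).
  by apply: is_action_sys_prod => i; exact: is_action_prod2.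
(* The action by 0 is the identity only almost everywhere, so the limits stated with [id] have to be
   transferred to [koopman (T j) 0]. *)
have weak0 j w a : weak_cvg (sys_prob (T j)) (fun n => koopman (T j) (w n)) (mix (sys_prob (T j)) a id) ->
    weak_limit_at (T j) w a 0.
  move=> h f g Lf Lg.
  rewrite (_ : inner _ (mix _ a (koopman (T j) 0) f) g = inner (sys_prob (T j)) (mix (sys_prob (T j)) a id f) g).
    exact: h.
  have L0 := L2_koopman (hT j) 0 Lf.
  have LT : L2 (sys_prob (T j)) (Theta (sys_prob (T j)) f) by exact: L2_cst.
  apply: ae_eq_inner.
  - by apply: cmeasurableD; apply: cmeasurableM; [exact: cmeasurable_cst|exact: L2_cmeasurable L0|exact: cmeasurable_cst|exact: L2_cmeasurable LT].
  - by apply: cmeasurableD; apply: cmeasurableM; [exact: cmeasurable_cst|exact: L2_cmeasurable Lf|exact: cmeasurable_cst|exact: L2_cmeasurable LT].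
  - exact: L2_cmeasurable Lg.
  - exact: L2_cmeasurable Lg.
  - by case: (hT j) => _ _ _; apply: filterS => x x0; rewrite /mix /koopman x0.
  - exact: aeW.
(* Both families of limits in one form: the sequence of the factor [i] produces [v] there and the
   trivial shift 0 at all other factors. *)
have hlim i (v : int * int) : (i < k.+1)%N -> v = (1, 0) \/ v = (0, 1) -> exists w (a : nat -> R), forall j, (j < k.+1)%N ->
    0 < a j /\ factor_limit T j w (a j) (if j == i then v else 0).
  move=> ik hv; have [w [u [a [b [ab0 wi wj ui uj]]]]] := hweak (Ordinal ik).
  case: hv => ->.
  - exists w, (fun j => a (inord j)) => j jk; split; first by have [] := ab0 (inord j).
    exists (inord j); split; first by rewrite inordK.
    have [ji|ji] := eqVneq j i.
      have -> : inord j = Ordinal ik by apply: val_inj; rewrite /= inordK.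
      exact: wi.
    apply: weak0; apply: wj; apply/eqP => e; move/eqP: ji; apply.
    by move/(congr1 val): e; rewrite /= inordK.
  - exists u, (fun j => b (inord j)) => j jk; split; first by have [] := ab0 (inord j).
    exists (inord j); split; first by rewrite inordK.
    have [ji|ji] := eqVneq j i.
      have -> : inord j = Ordinal ik by apply: val_inj; rewrite /= inordK.
      exact: ui.
    apply: weak0; apply: uj; apply/eqP => e; move/eqP: ji; apply.
    by move/(congr1 val): e; rewrite /= inordK.
have [r mr rE] := fm_base_function m hlim.
exact: (spectral_multiplicities hX mr rE).
Qed.
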